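(* Let $q$ be an odd prime power, $K=\mathbb F_q$ the finite field with $q$ elements, $G=\mathrm{SL}_2(K)$, and $S=K[a,b,c,d]$. For the conjugation action of $G$ on $S$, the element $$f_4=-\prod_{A\in K,\,B\in K^\times}\Big(Aa+Bb-\tfrac{A^2+\delta}{B}c-Ad\Big)$$ (where $x^2+\delta\in K[x]$ is a fixed irreducible polynomial) has a square root $\sqrt{f_4}$ in $S$, and $$S^G=K\big[\mathrm{trace},\ \det,\ \mathcal P^1(\det),\ \sqrt{f_4},\ h\big],$$ where $\mathrm{trace}=a+d$, $\det=ad-bc$, $\mathcal P^1(\det)=a^qd+ad^q-b^qc-bc^q$, and $h$ is the Jacobian of the other four invariants listed. The invariant ring is a hypersurface with Hilbert series $$\mathrm{Hilb}(S^G,z)=\frac{1+z^{\binom{q+1}2}}{(1-z)(1-z^2)(1-z^{q+1})(1-z^{\binom q2})}.$$ Additionally, $S^G$ is not $F$-regular, is a unique factorisation domain, and has $a$-invariant $-4$.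
   Context: The conjugation action: $\sigma\in G$ acts on $S$ by the $K$-algebra automorphism sending each variable to the corresponding entry of $\sigma^{-1}\begin{pmatrix}a&b\\c&d\end{pmatrix}\sigma$. $S$ has the standard grading. $\mathrm{Hilb}(R,z)=\sum_n\dim_K(R_n)z^n$. The $a$-invariant of a graded Cohen–Macaulay ring equals the degree (numerator degree minus denominator degree) of its Hilbert series. A hypersurface is a graded $K$-algebra isomorphic to a (weighted) polynomial ring modulo one homogeneous element. The Jacobian is the determinant of the matrix of partial derivatives with respect to $a,b,c,d$. *)

(* Defs.v *)
From HB Require Import structures.
From mathcomp Require Export all_boot all_order all_algebra all_field.
From mathcomp.multinomials Require Export mpoly.

Set Implicit Arguments.
Unset Strict Implicit.
Unset Printing Implicit Defensive.

Import GRing.Theory.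
Local Open Scope ring_scope.

(* Ideals are Prop-valued predicates: they are not assumed decidable. *)
Definition is_ideal (R : comNzRingType) (I : R -> Prop) : Prop :=
  [/\ I 0, forall x y, I x -> I y -> I (x + y)
    & forall a x, I x -> I (a * x)].

Definition ideal_gen (R : comNzRingType) (X : R -> Prop) (r : R) : Prop :=
  exists k (c g : 'I_k -> R), (forall i, X (g i)) /\ r = \sum_i c i * g i.

Definition is_prime_ideal (R : comNzRingType) (I : R -> Prop) : Prop :=
  [/\ is_ideal I, ~ I 1 & forall x y, I (x * y) -> I x \/ I y].

Definition is_minimal_prime (R : comNzRingType) (I : R -> Prop) : Prop :=
  is_prime_ideal I /\
  forall J, is_prime_ideal J -> (forall x, J x -> I x) -> forall x, I x -> J x.

(* I^[q], the ideal generated by the q-th powers of the elements of I *)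
Definition frobenius_power (R : comNzRingType) (q : nat) (I : R -> Prop) :
    R -> Prop :=
  ideal_gen (fun y => exists2 x, I x & y = x ^+ q).

(* I^* for a ring of prime characteristic p: x is in I^* when some c outside
   all minimal primes satisfies c x^(p^e) \in I^[p^e] for all large e *)
Definition tight_closure (R : comNzRingType) (p : nat) (I : R -> Prop) (x : R) :
    Prop :=
  exists c, (forall P, is_minimal_prime P -> ~ P c) /\
  exists e0 : nat, forall e, (e0 <= e)%N ->
    frobenius_power (p ^ e) I (c * x ^+ (p ^ e)).

Definition weakly_F_regular (p : nat) (R : comNzRingType) : Prop :=
  forall I : R -> Prop, is_ideal I -> forall x, tight_closure p I x -> I x.

(* f : R -> L exhibits L as the localization W^-1 R *)
Definition is_localization (R L : comNzRingType) (W : R -> Prop)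
    (f : {rmorphism R -> L}) : Prop :=
  [/\ W 1 /\ (forall v w, W v -> W w -> W (v * w)),
      forall w, W w -> exists u, f w * u = 1,
      forall y, exists r w, W w /\ f w * y = f r
    & forall r, f r = 0 <-> exists w, W w /\ w * r = 0].

(* Hochster-Huneke: every localization is weakly F-regular (the zero ring,
   which is not a comNzRingType, is so trivially). To be used for Noetherian
   rings of prime characteristic p only. *)
Definition F_regular (p : nat) (R : comNzRingType) : Prop :=
  forall (L : comNzRingType) (W : R -> Prop) (f : {rmorphism R -> L}),
    is_localization W f -> weakly_F_regular p L.

Definition is_irreducible (R : idomainType) (x : R) : Prop :=
  [/\ x != 0, x \isn't a GRing.unit
    & forall y z, x = y * z -> y \is a GRing.unit \/ z \is a GRing.unit].

Definition associated (R : idomainType) (x y : R) : Prop :=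
  exists2 u, u \is a GRing.unit & y = u * x.

Definition is_UFD (R : idomainType) : Prop :=
  (forall x : R, x != 0 -> x \isn't a GRing.unit ->
     exists s : seq R,
       (forall y, y \in s -> is_irreducible y) /\ x = \prod_(y <- s) y)
  /\
  (forall s t : seq R,
     (forall y, y \in s -> is_irreducible y) ->
     (forall y, y \in t -> is_irreducible y) ->
     \prod_(y <- s) y = \prod_(y <- t) y ->
     exists t', [/\ perm_eq t' t, size t' = size s
       & forall i, (i < size s)%N -> associated s`_i t'`_i]).

(* A grading is given below by the family gr of its homogeneous components,
   0 being homogeneous of every degree. *)

Definition has_dim (K : fieldType) (V : lmodType K) (W : {pred V}) (d : nat) :
    Prop :=
  exists b : 'I_d -> V,
    [/\ forall i, b i \in W,
        forall c : 'I_d -> K, \sum_i c i *: b i = 0 -> forall i, c i = 0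
      & forall v, v \in W -> exists c : 'I_d -> K, v = \sum_i c i *: b i].

(* \sum_n dim (gr n) z^n = N / D, i.e. D(z) * \sum_n dim (gr n) z^n = N(z)
   coefficient by coefficient *)
Definition has_hilbert_series (K : fieldType) (V : lmodType K)
    (gr : nat -> {pred V}) (N D : {poly int}) : Prop :=
  D != 0 /\
  exists H : nat -> nat, (forall n, has_dim (gr n) (H n)) /\
    forall n, \sum_(i < n.+1) D`_i * (H (n - i)%N)%:Z = N`_n.

Definition wdeg (k : nat) (w : 'I_k -> nat) (m : 'X_{1..k}) : nat :=
  (\sum_(i < k) m i * w i)%N.

Lemma wdeg0 k (w : 'I_k -> nat) : wdeg w 0%MM = 0%N.
Proof. by rewrite /wdeg big1 // => i _; rewrite mnm0E. Qed.

Lemma wdegD k (w : 'I_k -> nat) :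
  {morph wdeg w : m1 m2 / (m1 + m2)%MM >-> (m1 + m2)%N}.
Proof.
move=> m1 m2; rewrite /wdeg -big_split /=.
by apply: eq_bigr => i _; rewrite mnmDE mulnDl.
Qed.

HB.instance Definition _ (k : nat) (w : 'I_k -> nat) :=
  isMeasure.Build k (wdeg w) (wdeg0 w) (wdegD w).

(* R is graded isomorphic to K[x_1, ..., x_k] / (F) with deg x_i = w_i > 0: there
   is a degree preserving surjection of K-algebras with kernel (F) *)
Definition is_hypersurface (K : fieldType) (R : comAlgType K)
    (gr : nat -> {pred R}) : Prop :=
  exists (k : nat) (w : 'I_k -> nat) (F : {mpoly K[k]}) (dF : nat)
         (phi : {lrmorphism {mpoly K[k]} -> R}),
    [/\ (forall i, 0 < w i)%N, F \is dF.-homog for (wdeg w),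
        forall d P, P \is d.-homog for (wdeg w) -> phi P \in gr d,
        forall r, exists P, phi P = r
      & forall P, phi P = 0 <-> exists Q, P = Q * F].

(* x_1, ..., x_d, of degrees e_1, ..., e_d, is a homogeneous system of parameters:
   R is module-finite over the polynomial subring K[x_1, ..., x_d] *)
Definition is_hsop (K : fieldType) (R : comAlgType K) (gr : nat -> {pred R})
    (d : nat) (x : 'I_d -> R) (e : 'I_d -> nat) : Prop :=
  [/\ forall i, (0 < e i)%N /\ x i \in gr (e i),
      forall P : {mpoly K[d]}, mmap (in_alg R) x P = 0 -> P = 0
    & exists k (b : 'I_k -> R), forall r, exists P : 'I_k -> {mpoly K[d]},
        r = \sum_i mmap (in_alg R) x (P i) * b i].

(* [H^d_m(R)]_n != 0, where the top local cohomology H^d_m(R) is computed by the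
   Cech complex on x, as the cokernel of
     \bigoplus_i R_{x_1 .. x_(i-1) x_(i+1) .. x_d} -> R_{x_1 .. x_d}.
   The class of r / (x_1 .. x_d)^t vanishes iff
     (x_1 .. x_d)^j r \in (x_1^(t + j), ..., x_d^(t + j)) for some j,
   and it has degree deg r - t * (e_1 + .. + e_d). *)
Definition top_local_cohomology_neq0 (R : comNzRingType) (gr : nat -> {pred R})
    (d : nat) (x : 'I_d -> R) (e : 'I_d -> nat) (n : int) : Prop :=
  exists (t m : nat) (r : R),
    [/\ r \in gr m, n = m%:Z - (t * \sum_i e i)%N%:Z
      & forall j : nat, ~ ideal_gen (fun y => exists i, y = x i ^+ (t + j))
                            ((\prod_i x i) ^+ j * r)].

(* a(R) = max {n | [H^d_m(R)]_n != 0}, d = dim R (Goto-Watanabe) *)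
Definition has_a_invariant (K : fieldType) (R : comAlgType K)
    (gr : nat -> {pred R}) (a : int) : Prop :=
  exists (d : nat) (x : 'I_d -> R) (e : 'I_d -> nat),
    [/\ is_hsop gr x e, top_local_cohomology_neq0 gr x e a
      & forall n : int, (a < n)%R -> ~ top_local_cohomology_neq0 gr x e n].

Section Conjugation.
Variable K : finFieldType.
Implicit Types (s : 'M[K]_2) (p : {mpoly K[4]}).

Definition SL2 : {set 'M[K]_2} := [set s | \det s == 1].

Definition va : {mpoly K[4]} := 'X_(inord 0).
Definition vb : {mpoly K[4]} := 'X_(inord 1).
Definition vc : {mpoly K[4]} := 'X_(inord 2).
Definition vd : {mpoly K[4]} := 'X_(inord 3).

Definition generic_mx : 'M[{mpoly K[4]}]_2 :=
  \matrix_(i < 2, j < 2)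
    if i == 0 then (if j == 0 then va else vb)
    else (if j == 0 then vc else vd).

Definition conj_mx s : 'M[{mpoly K[4]}]_2 :=
  map_mx (@mpolyC 4 K) (invmx s) *m generic_mx *m map_mx (@mpolyC 4 K) s.

Definition conj_act s p : {mpoly K[4]} :=
  p \mPo [tuple conj_mx s 0 0; conj_mx s 0 1; conj_mx s 1 0; conj_mx s 1 1].

Definition conj_invariant : {pred {mpoly K[4]}} :=
  fun p => [forall s in SL2, conj_act s p == p].

Lemma conj_invariantP p :
  reflect (forall s, s \in SL2 -> conj_act s p = p) (p \in conj_invariant).
Proof. by apply: (iffP forall_inP) => Hp s /Hp; [move/eqP | move->]. Qed.

Lemma conj_invariant_divalg : divalg_closed conj_invariant.
Proof.
split=> [|c p1 p2 /conj_invariantP H1 /conj_invariantP H2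
         |p1 p2 /conj_invariantP H1 /conj_invariantP H2];
  apply/conj_invariantP => s sG.
- by rewrite /conj_act rmorph1.
- by rewrite /conj_act linearP /=; congr (_ *: _ + _); [exact: H1 | exact: H2].
rewrite /conj_act rmorphM /=; congr (_ * _); first exact: H1.
have [U2|nU2] := boolP (p2 \is a GRing.unit); last by rewrite invr_out //; exact: H2.
by rewrite rmorphV //=; congr (_^-1); exact: H2.
Qed.

HB.instance Definition _ :=
  GRing.isDivalgClosed.Build K {mpoly K[4]} conj_invariant conj_invariant_divalg.

Record inv_ring := InvRing { inv_val : {mpoly K[4]};
                             inv_valP : inv_val \in conj_invariant }.

HB.instance Definition _ := [isSub for inv_val].
HB.instance Definition _ := [Choice of inv_ring by <:].
HB.instance Definition _ := [SubChoice_isSubIntegralDomain of inv_ring by <:].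
HB.instance Definition _ := [SubZmodule_isSubLmodule of inv_ring by <:].
HB.instance Definition _ := [SubNzRing_SubLmodule_isSubLalgebra of inv_ring by <:].
HB.instance Definition _ := [SubLalgebra_isSubAlgebra of inv_ring by <:].

Definition inv_gr (n : nat) : {pred inv_ring} := fun r => val r \is n.-homog.

Definition inv_trace : {mpoly K[4]} := va + vd.
Definition inv_det : {mpoly K[4]} := va * vd - vb * vc.

(* P^1(det), the first Steenrod operation applied to det *)
Definition inv_P1det : {mpoly K[4]} :=
  let q := #|K| in va ^+ q * vd + va * vd ^+ q - vb ^+ q * vc - vb * vc ^+ q.

Definition f4 (delta : K) : {mpoly K[4]} :=
  - \prod_(A : K) \prod_(B : K | B != 0)
      (A *: va + B *: vb - ((A ^+ 2 + delta) / B) *: vc - A *: vd).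

Definition jacobian (g : 4.-tuple {mpoly K[4]}) : {mpoly K[4]} :=
  \det (\matrix_(i < 4, j < 4) (tnth g i)^`M(j)).

Definition in_subalg_gen (k : nat) (g : k.-tuple {mpoly K[4]}) p : Prop :=
  exists P : {mpoly K[k]}, p = P \mPo g.

End Conjugation.

(* Main.v *)
From HB Require Import structures.
Require Import Defs.
From Stdlib Require Import Classical.
From mathcomp Require Import all_boot all_order all_algebra all_field.
From mathcomp.multinomials Require Import mpoly.
From mathcomp Require Import cyclic ring zify.

Import GRing.Theory.
Local Open Scope ring_scope.

Set Implicit Arguments.
Unset Strict Implicit.
Unset Printing Implicit Defensive.

(** Let H be the group generated by SL_2 and the involution exchanging a and d.
    - A form tr(N X) with N traceless and det N = delta has a G-orbit consisting, up to
      sign, of all such forms; g0, the product of one out of each pair of opposite forms,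
      is semi-invariant, hence invariant, and f4 is a scalar square times g0^2.
    - K[trace, det, P^1(det), g] = S^H. A symmetric invariant is restricted to the plane
      tr X = tr(N X) = 0, where det is the norm form of F_{q^2}. A restriction which
      vanishes at X0 = [w, delta; 1, -w], w^2 = -delta, is a multiple of det; otherwise
      the elements of norm -1 make its degree a multiple of q + 1, and a multiple of a
      power of P^1(det) is subtracted. Once the restriction to the plane is zero, the
      restriction to tr X = 0 is divisible by tr(N X), hence by g0; once that is zero,
      the invariant is divisible by the trace.
    - h is anti-symmetric by the chain rule, and nonzero at X0. Each anti-symmetric
      invariant is divisible by the product D0 of the split forms (det N = -1), which
      has the degree of h, so S^G = S^H + h S^H, a free S^H-module. The hypersurface, the
      Hilbert series and the a-invariant are read off this presentation.
    - The greatest common divisor in S of two invariants is a semi-invariant, hence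
      invariant, so S^G is factorial.
    - h is in the ideal of S generated by trace, det and P^1(det), because deg g = 0 in
      K (Euler). The transfer of S to S^G puts h in the tight closure of the ideal they
      generate in S^G, whereas h is not in that ideal. *)

(** * Factorial domains *)

(** The order of G is divisible by p, so invariants cannot be obtained by averaging over G: only the
    quotient of H by G, of order 2, is averaged. Hence the method of restricting to smaller
    subspaces and lifting back, and hence the possibility that h lies in an ideal of S without lying
    in its counterpart in S^G. Orbit products, Jacobians and greatest common divisors are only
    controlled up to a scalar. This is enough, because SL_2(K) is generated by transvections, which
    have order p, and K has no p-th root of unity other than 1. N0 = [0, -delta; 1, 0] is the
    companion matrix of x^2 + delta. The plane orthogonal to it carries no nonzero isotropic vector
    over K. Over F_{q^2} it has two isotropic lines, exchanged by Frobenius; X0 is a nilpotent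
    matrix spanning one of them, so that a form over K vanishing at X0 vanishes on both and is a
    multiple of det. The involution is the reflection in the split form a - d. An anti-symmetric
    invariant therefore vanishes on the hyperplane a = d and on its conjugates, which are q(q+1)/2
    in number. *)

Definition divides (R : comNzRingType) (x y : R) : Prop := exists z, y = z * x.

Definition prime_elt (R : idomainType) (x : R) : Prop :=
  [/\ x != 0, x \isn't a GRing.unit
    & forall y z, divides x (y * z) -> divides x y \/ divides x z].

(** Prime factors instead of irreducible ones: such factorizations are unique of themselves, and
    their existence passes from R to R[X]. *)
Definition factorial_domain (R : idomainType) : Prop :=
  forall x : R, x != 0 -> exists u (s : seq R),
    [/\ u \is a GRing.unit, forall y, y \in s -> prime_elt y
      & x = u * \prod_(y <- s) y].

Section Divides.
Variable R : comNzRingType.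
Implicit Types x y z : R.

Lemma divides_refl x : divides x x.
Proof. by exists 1; rewrite mul1r. Qed.

Lemma divides_trans y x z : divides x y -> divides y z -> divides x z.
Proof. by move=> [u ->] [v ->]; exists (v * u); rewrite mulrA. Qed.

Lemma divides_mull x y z : divides x z -> divides x (y * z).
Proof. by move=> [u ->]; exists (y * u); rewrite mulrA. Qed.

Lemma divides_mulr x y z : divides x y -> divides x (y * z).
Proof. by rewrite mulrC; apply: divides_mull. Qed.

Lemma divides0 x : divides x 0.
Proof. by exists 0; rewrite mul0r. Qed.

Lemma dividesD x y z : divides x y -> divides x z -> divides x (y + z).
Proof. by move=> [u ->] [v ->]; exists (u + v); rewrite mulrDl. Qed.

Lemma dividesN x y : divides x y -> divides x (- y).
Proof. by move=> [u ->]; exists (- u); rewrite mulNr. Qed.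

Lemma dividesB x y z : divides x y -> divides x z -> divides x (y - z).
Proof. by move=> xy xz; apply: dividesD => //; apply: dividesN. Qed.

Lemma divides_sum x (I : Type) (r : seq I) (P : pred I) (F : I -> R) :
  (forall i, P i -> divides x (F i)) -> divides x (\sum_(i <- r | P i) F i).
Proof. by move=> H; elim/big_ind: _ => //; [apply: divides0|exact: dividesD]. Qed.

End Divides.

Lemma divides_morph (R R' : comNzRingType) (f : {rmorphism R -> R'}) x y :
  divides x y -> divides (f x) (f y).
Proof. by move=> [z ->]; exists (f z); rewrite rmorphM. Qed.

Section FactorialGcd.
Variable R : idomainType.
Hypothesis fR : factorial_domain R.
Implicit Types x y z : R.

Lemma divides_unit x y : divides x y -> y \is a GRing.unit -> x \is a GRing.unit.
Proof. by move=> [z ->]; rewrite unitrM => /andP[]. Qed.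

Lemma exists_gcd x y : x != 0 ->
  exists d, [/\ divides d x, divides d y
    & forall e, divides e x -> divides e y -> divides e d].
Proof.
move=> /fR[u [s [uu ps ->]]] {x}.
elim: s ps y => [|x s IHs] ps y.
  exists 1; split.
  - by eexists; rewrite mulr1.
  - by eexists; rewrite mulr1.
  by rewrite big_nil mulr1 => e [z Ez] _; exists (u^-1 * z); rewrite -mulrA -Ez mulVr.
have [x0 xu xp] : prime_elt x by apply: ps; rewrite mem_head.
have {}IHs := IHs (fun y ys => ps y (mem_behead (s := x :: s) ys)).
set P := u * _ in IHs; rewrite big_cons mulrCA -/P.
have [[y' ->]|nxy] := classic (divides x y).
  have [d [[z Pz] [t Yt] dmax]] := IHs y'.
  exists (x * d); split; first by exists z; rewrite Pz mulrCA.
    by exists t; rewrite Yt -mulrA [x * d]mulrC.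
  move=> e [v Ev] [w Ew].
  have [[e' Ee]|nxe] := classic (divides x e).
    rewrite Ee; suff [k ->] : divides e' d.
      by exists k; ring.
    apply: dmax; [exists v|exists w]; apply: (mulfI x0); first by rewrite Ev Ee; ring.
    by rewrite mulrC Ew Ee; ring.
  have [[v' Ev']|//] : divides x v \/ divides x e by apply: xp; exists P; rewrite -Ev mulrC.
  have [[w' Ew']|//] : divides x w \/ divides x e by apply: xp; exists y'; rewrite -Ew.
  apply: divides_mull; apply: dmax; [exists v'|exists w']; apply: (mulfI x0).
    by rewrite Ev Ev'; ring.
  by rewrite mulrC Ew Ew'; ring.
have [d [dP dy dmax]] := IHs y; exists d; split=> //; first exact: divides_mull.
move=> e [v Ev] ey; apply: dmax => //.
have [[v' Ev']|xe] : divides x v \/ divides x e by apply: xp; exists P; rewrite -Ev mulrC.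
  by exists v'; apply: (mulfI x0); rewrite Ev Ev'; ring.
by case: nxy; apply: divides_trans ey.
Qed.

Lemma coprime_divides x y z : x != 0 ->
    (forall e, divides e x -> divides e y -> e \is a GRing.unit) ->
  divides x (y * z) -> divides x z.
Proof.
move=> /fR[u [s [uu ps ->]]] {x}; elim: s ps z => [|x s IHs] ps z co.
  by move=> _; rewrite big_nil mulr1; exists (u^-1 * z); rewrite mulrAC mulVr ?mul1r.
have [x0 xu xp] : prime_elt x by apply: ps; rewrite mem_head.
move: co; rewrite big_cons mulrCA; set P := u * _ => co [t Et].
have [|xy|[z' Ez]] := xp y z; first by exists (t * P); rewrite Et; ring.
  have := co x _ xy; rewrite (negPf xu) => H.
  by have : false by apply: H; exists P; rewrite mulrC.
rewrite Ez; suff [k Ek] : divides P z'.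
  by exists k; rewrite Ek; ring.
apply: IHs => [w ws||]; first by apply: ps; rewrite inE ws orbT.
  by move=> e eP; apply: co; apply: divides_mull.
exists t; apply: (mulfI x0); transitivity (y * z); first by rewrite Ez; ring.
by rewrite Et -/P; ring.
Qed.

End FactorialGcd.

Lemma factorial_iso (R R' : idomainType) (f : {rmorphism R -> R'})
    (g : {rmorphism R' -> R}) :
  cancel f g -> cancel g f -> factorial_domain R -> factorial_domain R'.
Proof.
move=> fK gK fR y y0.
have fU x : (f x \is a GRing.unit) = (x \is a GRing.unit).
  by apply/idP/idP => [/(rmorph_unit g)|/(rmorph_unit f)//]; rewrite fK.
have [|u [s [uu ps Es]]] := fR (g y).
  by rewrite -(inj_eq (can_inj gK)) rmorph0 in y0.
exists (f u), (map f s); split; first by rewrite fU.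
  move=> _ /mapP[x /ps[x0 xu xp] ->]; split.
  - by rewrite -(rmorph0 f) (inj_eq (can_inj fK)).
  - by rewrite fU.
  move=> v w /(divides_morph g); rewrite fK rmorphM => /xp.
  by move=> [/(divides_morph f)|/(divides_morph f)]; rewrite gK; [left|right].
by rewrite -[y]gK Es rmorphM rmorph_prod big_map.
Qed.

Lemma factorial_field (F : fieldType) : factorial_domain F.
Proof. by move=> x x0; exists x, [::]; rewrite unitfE x0 big_nil mulr1. Qed.

(** * Gauss's lemma and polynomials over a factorial domain *)

Section FactorialPoly.
Variable R : idomainType.
Hypothesis fR : factorial_domain R.
Implicit Types (a b c : R) (f g h d k : {poly R}).

Lemma divides_polyC c f : divides c%:P f <-> forall i, divides c f`_i.
Proof.
split=> [[g ->] i|H]; first by exists g`_i; rewrite coefMC.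
have := fin_all_exists (fun i : 'I_(size f) => H i) => -[z Ez].
exists (\poly_(i < size f) if insub i is Some j then z j else 0).
apply/polyP=> i; rewrite coefMC coef_poly; case: ltnP => [lt|ge].
  by rewrite insubT -Ez.
by rewrite mul0r nth_default.
Qed.

(** If i and j are the first indices at which [f] and [g] have a coefficient not divisible by [c],
    then in the coefficient of index i + j of the product every term but one is divisible by [c]. *)
Lemma prime_polyC c : prime_elt c -> prime_elt c%:P.
Proof.
move=> [c0 cu cp]; split; first by rewrite polyC_eq0.
  by rewrite poly_unitE coefC eqxx (negPf cu) andbF.
move=> f g /divides_polyC fg; apply: NNPP => /not_or_and[nf ng].
have minw h : ~ divides c%:P h -> exists i, ~ divides c h`_i /\
    forall j, (j < i)%N -> divides c h`_j.
  move=> nh; have [i] : exists i, ~ divides c h`_i.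
    by apply: not_all_ex_not => H; apply: nh; apply/divides_polyC.
  elim/ltn_ind: i => i IHi ni.
  have [[j [ji /IHi]]|H] := classic (exists j, (j < i)%N /\ ~ divides c h`_j).
    exact.
  by exists i; split=> // j ji; apply: NNPP => nj; apply: H; exists j.
have [i [ni mi]] := minw f nf; have [j [nj mj]] := minw g ng.
have := fg (i + j)%N; rewrite coefM.
rewrite (bigD1 (inord i)) //= inordK ?ltnS ?leq_addr // addKn => H.
have {H} : divides c (f`_i * g`_j).
  rewrite -[X in divides c X](addrK (\sum_(l < (i + j).+1 | l != inord i) f`_l * g`_(i + j - l))).
  apply: dividesB => //; apply: divides_sum => l li.
  case: (ltngtP l i) => [lt|gt|eq].
  - by apply: divides_mulr; apply: mi.
  - by apply: divides_mull; apply: mj; rewrite ltn_subLR ?ltn_add2r // -ltnS.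
  - by case/eqP: li; apply: val_inj; rewrite /= inordK ?ltnS ?leq_addr.
by case/cp.
Qed.

(** Clears denominators: pseudo-division gives factorizations only up to a scalar [a], and each
    prime factor of [a], being still prime in R[X], can be cancelled from one of the two factors. *)
Lemma strip_constant a f d k : a != 0 -> a *: f = d * k ->
  exists b c d' k', [/\ b != 0, c != 0, d = b *: d', k = c *: k' & f = d' * k'].
Proof.
move=> /fR[u [s [uu ps ->]]] {a}; elim: s ps d k => [|x s IHs] ps d k.
  rewrite big_nil mulr1 => E; exists 1, u, d, (u^-1 *: k); split=> //.
  - exact: oner_neq0.
  - by apply: contraTneq uu => ->; rewrite unitr0.
  - by rewrite scale1r.
  - by rewrite scalerA divrr ?scale1r.
  by rewrite -scalerAr -E scalerA mulVr ?scale1r.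
have px : prime_elt x by apply: ps; rewrite mem_head.
have [x0 _ _] := px; have [_ _ xp] := prime_polyC px.
have {}IHs := IHs (fun y ys => ps y (mem_behead (s := x :: s) ys)).
rewrite big_cons mulrCA -scalerA; set P := u * _ => E.
have [|[d' Ed]|[k' Ek]] := xp d k; first by exists (P *: f); rewrite -E -mul_polyC mulrC.
- have [|b [c [d2 [k2 [b0 c0 E1 E2 Ef]]]]] := IHs d' k.
    apply: (mulfI (_ : x%:P != 0)); first by rewrite polyC_eq0.
    by rewrite mul_polyC E Ed mulrAC mulrC.
  exists (x * b), c, d2, k2; split=> //; first by rewrite mulf_neq0.
  by rewrite Ed E1 mulrC mul_polyC scalerA.
have [|b [c [d2 [k2 [b0 c0 E1 E2 Ef]]]]] := IHs d k'.
  apply: (mulfI (_ : x%:P != 0)); first by rewrite polyC_eq0.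
  by rewrite mul_polyC E Ek mulrA mulrC.
exists b, (x * c), d2, k2; split=> //; first by rewrite mulf_neq0.
by rewrite Ek E2 mulrC mul_polyC scalerA.
Qed.

Definition primitive f := forall c, divides c%:P f -> c \is a GRing.unit.

(** Here [%|] is divisibility up to a nonzero scalar, as over the fraction field. After clearing
    denominators, the constant split off from [f] divides [f], hence is a unit. *)
Lemma primitive_dvdp f g : f != 0 -> primitive f -> f %| g -> divides f g.
Proof.
move=> f0 pf /Pdiv.WeakIdomain.dvdpP[[a k] /= a0 E].
have [b [c [k' [f' [b0 c0 Ek Ef Eg]]]]] := strip_constant a0 E.
have cu : c \is a GRing.unit by apply: pf; rewrite Ef -mul_polyC; exists f'; rewrite mulrC.
exists (c^-1 *: k'); rewrite Eg Ef -scalerAl -scalerAr scalerA mulVr ?scale1r //.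
Qed.

(** Over the fraction field, the gcd of [f] and [g] is either constant, and then [f] divides [h], or
    a constant multiple of [f] by irreducibility. *)
Lemma primitive_prime f : (1 < size f)%N -> primitive f ->
    (forall g h, f = g * h -> (size g <= 1)%N \/ (size h <= 1)%N) ->
  prime_elt f.
Proof.
move=> sf pf irr; have f0 : f != 0 by rewrite -size_poly_eq0; case: size sf.
split=> // [|g h fgh].
  by rewrite poly_unitE; case: eqP sf => // ->.
have fgh' : f %| g * h by case: fgh => z ->; apply: dvdp_mulIr.
set d := gcdp f g; have d0 : d != 0 by rewrite gcdp_eq0 negb_and f0.
case: (leqP (size d) 1) => sd.
  right; apply: primitive_dvdp => //; rewrite -(@Gauss_dvdpr _ _ g) //.
  by rewrite coprimep_def eqn_leq sd size_poly_gt0.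
left; apply: primitive_dvdp => //.
have /Pdiv.WeakIdomain.dvdpP[[a k] /= a0 E] : d %| f by apply: dvdp_gcdl.
have [b [c [k' [d' [b0 c0 Ek Ed Ef]]]]] := strip_constant a0 E.
have [sk|] := irr _ _ Ef; last first.
  by rewrite -(size_scale _ c0) -Ed leqNgt sd.
have k'0 : k' != 0 by apply: contraNneq f0 => E0; rewrite Ef E0 mul0r.
have k'E : k' = (k'`_0)%:P by apply: size1_polyC.
have : d %| g by apply: dvdp_gcdr.
rewrite Ed dvdpZl // Ef k'E mul_polyC dvdpZl //.
by apply: contraNneq k'0 => E0; rewrite k'E E0.
Qed.

Lemma seq_gcd (s : seq R) : exists c, (forall x, x \in s -> divides c x) /\
  forall e, (forall x, x \in s -> divides e x) -> divides e c.
Proof.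
elim: s => [|x s [c [cs cmax]]]; first by exists 0; split=> // e _; apply: divides0.
have [->|x0] := eqVneq x 0.
  exists c; split=> [y|e H]; last by apply: cmax => y ys; apply: H; rewrite inE ys orbT.
  by rewrite inE => /orP[/eqP->|/cs//]; apply: divides0.
have [d [dx dc dmax]] := exists_gcd fR c x0.
exists d; split=> [y|e H]; last first.
  apply: dmax; first by apply: H; rewrite mem_head.
  by apply: cmax => y ys; apply: H; rewrite inE ys orbT.
by rewrite inE => /orP[/eqP->//|/cs]; apply: divides_trans.
Qed.

Lemma primitive_part f : f != 0 ->
  exists c g, [/\ c != 0, primitive g & f = c *: g].
Proof.
move=> f0; have [c [cf cmax]] := seq_gcd f.
have /divides_polyC[g Ef] : forall i, divides c f`_i.
  move=> i; case: (ltnP i (size f)) => [lt|ge]; first by apply: cf; rewrite mem_nth.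
  by rewrite nth_default //; apply: divides0.
have c0 : c != 0 by apply: contraNneq f0 => E; rewrite Ef E mulr0.
exists c, g; split; rewrite // -?mul_polyC 1?mulrC // => e [h Eg].
have [|k Ek] := cmax (e * c).
  move=> x xf; have /divides_polyC/(_ (index x f)) : divides (e * c)%:P f.
    by exists h; rewrite Ef Eg polyCM; ring.
  by rewrite nth_index.
apply: (@divides_unit _ _ 1); last exact: unitr1.
by exists k; apply: (mulIf c0); rewrite mul1r {1}Ek; ring.
Qed.

(** Induction on the size: the content factors in R, and the primitive part is constant, a product
    of two shorter nonconstant factors, or prime. *)
Lemma factorial_poly : factorial_domain {poly R}.
Proof.
move=> f; have [n] := ubnP (size f); elim: n f => // n IHn f sfn f0.
have FM (g h : {poly R}) : (exists u (s : seq {poly R}),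
    [/\ u \is a GRing.unit, forall y, y \in s -> prime_elt y & g = u * \prod_(y <- s) y]) ->
    (exists u (s : seq {poly R}),
    [/\ u \is a GRing.unit, forall y, y \in s -> prime_elt y & h = u * \prod_(y <- s) y]) ->
    (exists u (s : seq {poly R}),
    [/\ u \is a GRing.unit, forall y, y \in s -> prime_elt y & g * h = u * \prod_(y <- s) y]).
  move=> [u [s [uu ps ->]]] [v [t [vu pt ->]]]; exists (u * v), (s ++ t).
  rewrite unitrM uu vu big_cat /=; split=> //; last by ring.
  by move=> y; rewrite mem_cat => /orP[/ps|/pt].
have FC c : c != 0 -> exists u (s : seq {poly R}),
    [/\ u \is a GRing.unit, forall y, y \in s -> prime_elt y & c%:P = u * \prod_(y <- s) y].
  move=> /fR[u [s [uu ps ->]]]; exists u%:P, (map polyC s); split.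
  - by rewrite poly_unitE coefC eqxx uu size_polyC (contraTneq _ uu) // => ->; rewrite unitr0.
  - by move=> _ /mapP[y /ps/prime_polyC py ->].
  by rewrite polyCM rmorph_prod big_map.
have [c [g [c0 pg Ef]]] := primitive_part f0.
rewrite Ef -mul_polyC; apply: (FM _ _); first exact: (FC _).
have g0 : g != 0 by apply: contraNneq f0 => E; rewrite Ef E scaler0.
have sg : size g = size f by rewrite Ef size_scale.
case: (leqP (size g) 1) => [/size1_polyC E|sg1].
  by rewrite E; apply: (FC _); rewrite -polyC_eq0 -E.
have [[k [h [Eg sk sh]]]|irr] := classic (exists k h, [/\ g = k * h, (1 < size k)%N & (1 < size h)%N]).
  have k0 : k != 0 by rewrite -size_poly_gt0 ltnW.
  have h0 : h != 0 by rewrite -size_poly_gt0 ltnW.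
  have skh : size g = (size k + size h).-1 by rewrite Eg size_mul.
  by rewrite Eg; apply: (FM _ _); apply: IHn => //; lia.
exists 1, [:: g]; rewrite big_seq1 mul1r unitr1; split=> // y.
rewrite inE => /eqP->; apply: primitive_prime => // k h Eg.
case: (leqP (size k) 1) => [|sk]; [by left|right].
by rewrite leqNgt; apply/negP => sh; apply: irr; exists k, h.
Qed.

End FactorialPoly.

Section FactorialMpoly.
Variable R : idomainType.

(** The inverse of [muni], which singles out the last variable; it is made a ring morphism so that
    factoriality can be transported. *)
Definition mpoly_of_poly n (p : {poly {mpoly R[n]}}) : {mpoly R[n.+1]} :=
  (map_poly (@mwiden n R) p).['X_ord_max].

Fact mpoly_of_poly_is_additive n : additive (@mpoly_of_poly n).
Proof. by move=> p q; rewrite /mpoly_of_poly rmorphB hornerD hornerN. Qed.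
HB.instance Definition _ n := GRing.isAdditive.Build {poly {mpoly R[n]}}
  {mpoly R[n.+1]} (@mpoly_of_poly n) (@mpoly_of_poly_is_additive n).

Fact mpoly_of_poly_is_multiplicative n : multiplicative (@mpoly_of_poly n).
Proof.
split=> [p q|]; rewrite /mpoly_of_poly ?rmorph1 ?hornerC //.
by rewrite rmorphM hornerM.
Qed.
HB.instance Definition _ n := GRing.isMultiplicative.Build {poly {mpoly R[n]}}
  {mpoly R[n.+1]} (@mpoly_of_poly n) (@mpoly_of_poly_is_multiplicative n).

Lemma muniX_max n : muni ('X_ord_max : {mpoly R[n.+1]}) = 'X.
Proof.
rewrite muniE msuppX big_seq1 mcoeffX eqxx scale1r mnm1E eqxx expr1.
rewrite (_ : [multinom _ | i < n] = 0%MM) ?mpolyX0 ?scale1r //.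
by apply/mnmP=> i; rewrite mnmE mnm1E mnm0E; case: eqP => // /(congr1 val) /= E;
  have := ltn_ord i; rewrite -E ltnn.
Qed.

Lemma muni_mwiden n (p : {mpoly R[n]}) : muni (mwiden p) = p%:P.
Proof.
elim/mpolyind: p => [|c m p _ _ IHp]; first by rewrite mwiden0 muni0.
rewrite mwidenD muniD polyCD IHp; congr (_ + _).
rewrite mwidenZ muniZ mwidenX muniE msuppX big_seq1 mcoeffX eqxx scale1r.
rewrite mnmwiden_ordmax expr0 (_ : [multinom _ | i < n] = m).
  by rewrite -mul_mpolyC polyCM alg_polyC mul_polyC.
by apply/mnmP=> i; rewrite mnmE mnmwiden_widen.
Qed.

Lemma mpoly_of_polyK n : cancel (@mpoly_of_poly n) (@muni n R).
Proof.
elim/poly_ind => [|p c IHp]; first by rewrite !rmorph0.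
rewrite rmorphD rmorphM /= rmorphD rmorphM /= IHp.
rewrite {1}/mpoly_of_poly map_polyX hornerX muniX_max.
by rewrite /mpoly_of_poly map_polyC hornerC muni_mwiden.
Qed.

Lemma muniK n : cancel (@muni n R) (@mpoly_of_poly n).
Proof.
move=> p; rewrite [p in RHS]mpolyE muniE rmorph_sum /=; apply: eq_bigr => m _.
rewrite -mul_polyC /mpoly_of_poly rmorphM /= map_polyC map_polyXn hornerM.
rewrite hornerC hornerXn /= mwidenZ mwidenX mpolyXn -scalerAl -mpolyXD.
congr (_ *: 'X_[_]).
apply/mnmP=> i; rewrite mnmDE mulmnE mnm1E.
have [<-|ne] := eqVneq ord_max i.
  by rewrite mnmwiden_ordmax mul1n.
have lt : (i < n)%N.
  by rewrite ltn_neqAle -ltnS ltn_ord andbT; apply: contraNneq ne => E; apply/eqP/val_inj.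
have -> : i = widen_ord (leqnSn n) (Ordinal lt) by apply: val_inj.
by rewrite mnmwiden_widen mnmE mul0n addn0.
Qed.

End FactorialMpoly.

Lemma factorial_mpoly (F : fieldType) n : factorial_domain {mpoly F[n]}.
Proof.
elim: n => [|n IHn].
  apply: (@factorial_iso F _ (@mpolyC 0 F) (@mcoeff 0 F 0%MM)).
  - exact: mpolyCK.
  - exact: mpolyKC.
  exact: factorial_field.
apply: (factorial_iso (@mpoly_of_polyK F n) (@muniK F n)).
exact: factorial_poly.
Qed.

(** * Unique factorization when irreducible elements are prime *)

Section UFD.
Variables (R : idomainType) (mu : R -> nat).
Hypothesis muM : forall x y : R, x != 0 -> y != 0 ->
  x \isn't a GRing.unit -> (mu y < mu (x * y))%N.
Hypothesis irr_prime : forall x y z : R,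
  is_irreducible x -> divides x (y * z) -> divides x y \/ divides x z.

Lemma irreducible_factorization (x : R) : x != 0 -> x \isn't a GRing.unit ->
  exists s : seq R, (forall y, y \in s -> is_irreducible y) /\ x = \prod_(y <- s) y.
Proof.
have [n] := ubnP (mu x); elim: n x => // n IHn x mx x0 xu.
have [xi|nxi] := classic (is_irreducible x).
  by exists [:: x]; rewrite big_seq1; split=> // y; rewrite inE => /eqP->.
have [y [z [Ex yu zu]]] :
    exists y z, [/\ x = y * z, y \isn't a GRing.unit & z \isn't a GRing.unit].
  apply: NNPP => H; apply: nxi; split=> // y z Ex.
  case: (boolP (y \is a GRing.unit)) => yu; [by left|right].
  by case: (boolP (z \is a GRing.unit)) => // zu; case: H; exists y, z.
move: x0; rewrite Ex mulf_eq0 negb_or => /andP[y0 z0].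
have mz : (mu z < mu x)%N by rewrite Ex muM.
have my : (mu y < mu x)%N by rewrite Ex mulrC muM.
have [|//|//|s [si ->]] := IHn y; first exact: leq_trans my _.
have [|//|//|t [ti ->]] := IHn z; first exact: leq_trans mz _.
exists (s ++ t); rewrite big_cat; split=> // w.
by rewrite mem_cat => /orP[/si|/ti].
Qed.

Lemma irreducible_divides_prod (x : R) (t : seq R) : is_irreducible x ->
  divides x (\prod_(y <- t) y) -> exists2 y, y \in t & divides x y.
Proof.
move=> xi; elim: t => [|y t IHt].
  by rewrite big_nil => /divides_unit/(_ (unitr1 _)); have [_ /negPf->] := xi.
rewrite big_cons => /(irr_prime xi)[xy|/IHt[z zt xz]].
  by exists y; rewrite ?mem_head.
by exists z; rewrite ?inE ?zt ?orbT.
Qed.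

Lemma is_UFD_irreducible_prime : is_UFD R.
Proof.
split=> [x x0 xu|s t si ti E]; first exact: irreducible_factorization.
(* The unit [u] absorbs the discrepancies between the associated factors already cancelled. *)
suff H u : u \is a GRing.unit -> \prod_(y <- s) y = u * \prod_(y <- t) y ->
    exists t', [/\ perm_eq t' t, size t' = size s
       & forall i, (i < size s)%N -> associated s`_i t'`_i].
  by apply: (H 1); rewrite ?unitr1 ?mul1r.
elim: s t si ti u {E} => [|x s IHs] t si ti u uu.
  case: t ti => [|y t] ti; first by exists [::].
  have [y0 yu _] := ti y (mem_head _ _).
  rewrite big_nil big_cons => E; suff : y \is a GRing.unit by rewrite (negPf yu).
  apply: (@divides_unit _ _ 1); last exact: unitr1.
  by exists (u * \prod_(j <- t) j); rewrite [LHS]E; ring.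
have xi : is_irreducible x by apply: si; rewrite mem_head.
have [x0 xu _] := xi; rewrite big_cons => E.
have [|y yt [v Ey]] := @irreducible_divides_prod x t xi.
  exists (u^-1 * \prod_(y <- s) y); apply: (mulrI uu).
  by rewrite -E mulrA mulrA divrr // mul1r mulrC.
have vu : v \is a GRing.unit.
  by have [_ _ /(_ v x Ey)[//|]] := ti y yt; rewrite (negPf xu).
move: E; rewrite (perm_big _ (perm_to_rem yt)) big_cons /=.
set P := \prod_(z <- rem y t) z; rewrite Ey => E.
have [||||t' [pt' st' at']] := IHs (rem y t) _ _ (u * v).
- by move=> z zs; apply: si; rewrite inE zs orbT.
- by move=> z /mem_rem /ti.
- by rewrite unitrM uu.
- by rewrite -/P; apply: (mulfI x0); rewrite E; ring.
exists (y :: t'); split.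
- by rewrite (permPr (perm_to_rem yt)) perm_cons.
- by rewrite /= st'.
by case=> [_|i /at'//]; exists v.
Qed.

End UFD.

(** * Polynomial substitutions *)

Lemma mpoly_alg_ind (n : nat) (R : nzRingType) (P : {mpoly R[n]} -> Prop) :
    (forall c, P c%:MP) -> (forall i, P 'X_i) ->
    (forall p q, P p -> P q -> P (p + q)) ->
    (forall p q, P p -> P q -> P (p * q)) ->
  forall p, P p.
Proof.
move=> PC PX PD PM; elim/mpolyind => [|c m p _ _ IHp]; first by rewrite -mpolyC0.
apply: PD => //; rewrite -mul_mpolyC; apply: (PM _ _) => //; rewrite mpolyXE_id.
elim/big_ind: _ => [||i _]; [by rewrite -mpolyC1| exact: PM|].
by elim: (m i) => [|k IHk]; rewrite ?expr0 -?mpolyC1 // exprS; apply: (PM _ _).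
Qed.

Section MmapMorph.
Variables (n : nat) (R : comNzRingType).

Lemma rmorph_mpolyE (B : comNzRingType) (f : {rmorphism {mpoly R[n]} -> B})
    (iota : {rmorphism R -> B}) (v : 'I_n -> B) p :
  (forall c, f c%:MP = iota c) -> (forall i, f 'X_i = v i) -> f p = mmap iota v p.
Proof.
move=> fC fX; elim/mpoly_alg_ind: p => [c|i|p q IHp IHq|p q IHp IHq].
- by rewrite mmapC.
- by rewrite mmapX mmap1U.
- by rewrite !rmorphD IHp IHq.
- by rewrite !rmorphM IHp IHq.
Qed.

Lemma rmorph_mmap (B B' : comNzRingType) (f : {rmorphism B -> B'})
    (iota : {rmorphism R -> B}) (iota' : {rmorphism R -> B'}) (v : 'I_n -> B) p :
  (forall c, f (iota c) = iota' c) ->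
  f (mmap iota v p) = mmap iota' (fun i => f (v i)) p.
Proof.
move=> fC; rewrite /mmap rmorph_sum; apply: eq_bigr => m _ /=.
by rewrite rmorphM fC rmorph_prod; congr (_ * _); apply: eq_bigr => i _; rewrite rmorphXn.
Qed.

Lemma eq_mmap (B : comNzRingType) (iota : {rmorphism R -> B}) (u v : 'I_n -> B) p :
  u =1 v -> mmap iota u p = mmap iota v p.
Proof.
by move=> uv; apply: eq_bigr => m _; congr (_ * _); apply: eq_bigr => i _; rewrite uv.
Qed.

(** The typical use has the variables for [u] and their images under a projection to a hyperplane
    for [v]: a polynomial then agrees with its restriction modulo the equation [x] of the
    hyperplane. *)
Lemma mmap_congr (B : comNzRingType) (iota : {rmorphism R -> B}) (u v : 'I_n -> B)
    (x : B) p :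
  (forall i, divides x (u i - v i)) -> divides x (mmap iota u p - mmap iota v p).
Proof.
move=> uv; elim/mpoly_alg_ind: p => [c|i|p q IHp IHq|p q IHp IHq].
- by rewrite !mmapC subrr; apply: divides0.
- by rewrite !mmapX !mmap1U.
- by rewrite !rmorphD opprD addrACA; apply: dividesD.
rewrite !rmorphM /=.
set a := mmap _ _ _ in IHp *; set b := mmap _ _ _ in IHq *.
set a' := mmap _ _ _ in IHp *; set b' := mmap _ _ _ in IHq *.
have -> : a * b - a' * b' = (a - a') * b + a' * (b - b') by ring.
by apply: dividesD; [apply: divides_mulr|apply: divides_mull].
Qed.

End MmapMorph.

Lemma mderiv_comp (R : comNzRingType) (n k : nat) (p : {mpoly R[n]})
    (t : n.-tuple {mpoly R[k]}) (j : 'I_k) :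
  (p \mPo t)^`M(j) = \sum_i (p^`M(i) \mPo t) * (tnth t i)^`M(j).
Proof.
elim/mpoly_alg_ind: p => [c|i|p q IHp IHq|p q IHp IHq].
- rewrite comp_mpolyC mderivC big1 // => i _.
  by rewrite mderivC comp_mpolyC mpolyC0 mul0r.
- rewrite comp_mpolyXU -tnth_nth (bigD1 i) //= big1 ?addr0 => [|l li].
    rewrite mderivX mnm1E eqxx scale1r (_ : (U_(i) - U_(i))%MM = 0%MM) ?mpolyX0 ?comp_mpoly1 ?mul1r //.
    by apply/mnmP=> l; rewrite mnmBE mnm0E subnn.
  by rewrite mderivX mnm1E eq_sym (negPf li) scale0r comp_mpolyC mul0r.
- rewrite rmorphD mderivD IHp IHq -big_split; apply: eq_bigr => i _ /=.
  by rewrite mderivD rmorphD mulrDl.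
rewrite rmorphM mderivM IHp IHq mulr_suml mulr_sumr -big_split.
apply: eq_bigr => i _ /=; rewrite mderivM rmorphD !rmorphM /=; ring.
Qed.

Lemma msupp_sum_mono (n : nat) (R : nzRingType) (I : eqType) (s : seq I) (P : pred I)
    (c : I -> R) (g : I -> 'X_{1..n}) m :
  m \in msupp (\sum_(i <- s | P i) c i *: 'X_[g i]) ->
  exists2 i, i \in s & P i /\ m = g i.
Proof.
rewrite mcoeff_msupp => ms; apply: NNPP => H; case/eqP: ms.
rewrite raddf_sum big_seq_cond big1 // => i /andP[si Pi] /=.
rewrite mcoeffZ mcoeffX; case: eqP => [E|]; last by rewrite mulr0.
by case: H; exists i.
Qed.

Lemma mpoly_split_var (n : nat) (R : comNzRingType) (j : 'I_n) (P : {mpoly R[n]}) :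
  exists P0 Q, [/\ P = P0 + Q * 'X_j,
    forall m, m \in msupp P0 -> m \in msupp P /\ m j = 0%N
    & forall m, m \in msupp Q -> (m + U_(j))%MM \in msupp P].
Proof.
exists (\sum_(m <- msupp P | m j == 0%N) P@_m *: 'X_[m]).
exists (\sum_(m <- msupp P | m j != 0%N) P@_m *: 'X_[m - U_(j)]).
split=> [|m /msupp_sum_mono[m' sm' [/eqP mj ->]]//|m /msupp_sum_mono[m' sm' [mj ->]]].
  rewrite [LHS]mpolyE (bigID (fun m : 'X_{1..n} => m j == 0%N)) /=; congr (_ + _).
  rewrite mulr_suml; apply: eq_bigr => m mj.
  by rewrite -scalerAl -mpolyXD submK // lep1mP.
by rewrite submK // lep1mP.
Qed.

(** * Algebraic independence by successive restrictions *)

Section Independence.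
Variables (n : nat) (K : fieldType).

Definition vars_in (J : pred 'I_n) (P : {mpoly K[n]}) : Prop :=
  forall m, m \in msupp P -> forall i, ~~ J i -> m i = 0%N.

Definition alg_indep (B : comNzRingType) (iota : {rmorphism K -> B})
    (J : pred 'I_n) (f : 'I_n -> B) : Prop :=
  forall P, vars_in J P -> mmap iota f P = 0 -> P = 0.

Lemma alg_indep0 (B : comNzRingType) (iota : {rmorphism K -> B}) f :
  alg_indep iota pred0 f.
Proof.
move=> P sP; have {sP}-> : P = (P@_0)%:MP.
  apply/mpolyP=> m; rewrite mcoeffC; case: eqP => [->|m0]; first by rewrite mulr1.
  rewrite mulr0; apply: memN_msupp_eq0; apply/negP => ms; apply: m0.
  by apply/mnmP=> i; rewrite (sP m ms i) // mnm0E.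
by rewrite mmapC => /eqP; rewrite fmorph_eq0 => /eqP->; rewrite mpolyC0.
Qed.

(** Write P = P0 + Q X_j with P0 free of X_j. Since [rho] kills [f j], it turns a relation P(f) = 0
    into one for P0, so P0 = 0; then Q(f) f_j = 0, and Q is a relation of smaller degree. *)
Lemma alg_indep_step (B : idomainType) (B' : comNzRingType) (rho : {rmorphism B -> B'})
    (iota : {rmorphism K -> B}) (iota' : {rmorphism K -> B'}) (j : 'I_n)
    (J J' : pred 'I_n) (f : 'I_n -> B) :
  (forall c, rho (iota c) = iota' c) -> rho (f j) = 0 -> f j != 0 ->
  (forall i, J' i -> J i \/ i = j) ->
  alg_indep iota' J (fun i => rho (f i)) -> alg_indep iota J' f.
Proof.
move=> rhoC rfj fj sJ iJ P.
have [N] : exists N, forall m, m \in msupp P -> (mdeg m < N)%N.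
  by exists (msize P) => m; apply: msize_mdeg_lt.
elim: N P => [|N IHN] P dP vP Pf.
  by apply: msuppnil0; case E: (msupp P) => [//|m s]; have := dP m; rewrite E mem_head => /(_ isT).
have [P0 [Q [EP sP0 sQ]]] := mpoly_split_var j P.
have P00 : P0 = 0.
  apply: iJ => [m /sP0[mP mj] i nJ|].
    have [->//|ij] := eqVneq i j; apply: (vP m mP); apply/negP => /sJ[J'i|E].
      by rewrite J'i in nJ.
    by rewrite E eqxx in ij.
  rewrite -(rmorph_mmap _ _ rhoC).
  have <- : rho (mmap iota f P) = rho (mmap iota f P0).
    by rewrite EP rmorphD !rmorphM /= mmapX mmap1U rmorphD rmorphM rfj mulr0 addr0.
  by rewrite Pf rmorph0.
move: Pf; rewrite EP P00 add0r rmorphM /= mmapX mmap1U => /eqP.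
rewrite mulf_eq0 (negPf fj) orbF => /eqP Qf.
rewrite (IHN Q _ _ Qf) ?mul0r // => m /sQ mP.
  by have := dP _ mP; rewrite mdegD mdeg1 addn1.
by move=> i nJ; have := vP _ mP i nJ; rewrite mnmDE => /eqP; rewrite addn_eq0 => /andP[/eqP].
Qed.

End Independence.

Section Homog.
Variables (n : nat) (K : idomainType).
Implicit Types p q : {mpoly K[n]}.

Lemma pihomogM d e p q : q \is e.-homog ->
  pihomog mdeg (d + e) (p * q) = pihomog mdeg d p * q.
Proof.
move=> hq; elim/mpolyind: p => [|c m p _ _ IHp].
  by rewrite mul0r !pihomog0 mul0r.
rewrite mulrDl !pihomogD mulrDl IHp; congr (_ + _).
rewrite -scalerAl !linearZ /= -scalerAl; congr (_ *: _).
have hmq : 'X_[m] * q \is (mdeg m + e).-homog by rewrite dhomogM // dhomogX.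
rewrite pihomogX; case: eqP => [<-|/eqP ne]; first by rewrite pihomog_dE.
by rewrite mul0r (@pihomog_ne0 _ _ _ (mdeg m + e)) // eqn_add2r.
Qed.

(** [p] and its component of degree [d - e] have the same product with [q]. Comparing sizes shows
    that this subtraction is not truncated. *)
Lemma dhomog_divides d e p q : p * q \is d.-homog -> q \is e.-homog -> p * q != 0 ->
  (e <= d)%N /\ p \is (d - e).-homog.
Proof.
move=> hpq hq pq0; have q0 : q != 0 by apply: contraNneq pq0 => ->; rewrite mulr0.
have p0 : p != 0 by apply: contraNneq pq0 => ->; rewrite mul0r.
have ed : (e <= d)%N.
  have sz (r : {mpoly K[n]}) k : r != 0 -> r \is k.-homog -> msize r = k.+1.
    by move=> r0 hr; rewrite -mlead_deg // (dhomog_mf hr) ?mlead_supp.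
  have p1 : msize p != 0%N by rewrite msize_poly_eq0.
  have := msizeM p0 q0; rewrite (sz _ _ pq0 hpq) (sz _ _ q0 hq) => E.
  move: p1 E; case: (msize p) => // k _; rewrite addSn addnS /= => -[->].
  by rewrite leq_addl.
split=> //; rewrite homog_piE; apply/eqP; apply: (mulIf q0).
by rewrite -(pihomogM _ _ hq) // subnK // pihomog_dE.
Qed.

Lemma dhomog0_const p : p \is 0.-homog -> exists c, p = c%:MP.
Proof.
move=> /dhomogP hp; exists p@_0; apply: msize1_polyC.
by rewrite msizeE; apply/bigmax_leqP_seq => m mp _; rewrite ltnS leqn0; apply/eqP/hp.
Qed.

End Homog.

Lemma wdeg1 k (w : 'I_k -> nat) i : wdeg w U_(i) = w i.
Proof.
rewrite /wdeg (bigD1 i) //= mnm1E eqxx mul1n big1 ?addn0 // => j ji.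
by rewrite mnm1E eq_sym (negPf ji).
Qed.

Section WeightedSubst.
Variables (n k : nat) (K : idomainType) (mf : measure n) (w : 'I_k -> nat).
Variable f : 'I_k -> {mpoly K[n]}.
Hypothesis hf : forall i, f i \is (w i).-homog for mf.

Lemma mmap1_homog m : mmap1 f m \is (wdeg w m).-homog for mf.
Proof.
rewrite /mmap1 /wdeg; elim/big_ind2: _ => [|p d q e hp hq|i _]; first exact: dhomog1.
  exact: dhomogM.
by rewrite mulnC; apply: dhomogMn.
Qed.

Lemma mmap_homog d P : P \is d.-homog for (wdeg w) -> mmap (@mpolyC n K) f P \is d.-homog for mf.
Proof.
move=> /dhomogP hP; rewrite /mmap big_seq; apply: rpred_sum => m mP.
by rewrite mul_mpolyC; apply: rpredZ; rewrite -(hP m mP) mmap1_homog.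
Qed.

Lemma pihomog_mmap d P : pihomog mf d (mmap (@mpolyC n K) f P) =
  mmap (@mpolyC n K) f (pihomog (wdeg w) d P).
Proof.
elim/mpolyind: P => [|c m P _ _ IHP]; first by rewrite !(raddf0, pihomog0).
rewrite raddfD !pihomogD raddfD IHP; congr (_ + _).
rewrite [pihomog (wdeg w) d _]linearZ /= !mmapZ !mmapX !mul_mpolyC linearZ /=.
congr (_ *: _); rewrite pihomogX; case: eqP => [<-|/eqP ne].
  by rewrite mmapX pihomog_dE // mmap1_homog.
by rewrite (pihomog_ne0 ne) ?mmap1_homog // raddf0.
Qed.

End WeightedSubst.

Lemma ord4_ind (P : 'I_4 -> Prop) :
  P (inord 0) -> P (inord 1) -> P (inord 2) -> P (inord 3) -> forall i, P i.
Proof.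
by move=> P0 P1 P2 P3 i; rewrite -[i]inord_val; case: i => -[|[|[|[|]]]].
Qed.

Lemma sum_ord4 (V : nmodType) (F : 'I_4 -> V) :
  \sum_i F i = F (inord 0) + F (inord 1) + F (inord 2) + F (inord 3).
Proof.
rewrite !big_ord_recl big_ord0 addr0 !addrA.
by congr (F _ + F _ + F _ + F _); apply: val_inj; rewrite /= inordK.
Qed.

Lemma det2 (R : comNzRingType) (M : 'M[R]_2) :
  \det M = M 0 0 * M 1 1 - M 0 1 * M 1 0.
Proof.
rewrite (expand_det_row M ord0) !big_ord_recl big_ord0 /cofactor !det_mx11 !mxE /=.
have -> : lift ord0 0 = 1 :> 'I_2 by apply: val_inj.
have -> : lift (1 : 'I_2) 0 = 0 :> 'I_2 by apply: val_inj.
by rewrite /bump /= expr0 expr1 mul1r addr0 mulN1r mulrN.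
Qed.

Lemma mulmx2E (R : pzRingType) m n (M : 'M[R]_(m, 2)) (N : 'M[R]_(2, n)) i j :
  (M *m N) i j = M i 0 * N 0 j + M i 1 * N 1 j.
Proof.
rewrite !mxE !big_ord_recl big_ord0 addr0; congr (_ + M _ _ * N _ _); exact: val_inj.
Qed.

Lemma mx2_eq (T : Type) (M N : 'M[T]_2) : M 0 0 = N 0 0 -> M 0 1 = N 0 1 ->
  M 1 0 = N 1 0 -> M 1 1 = N 1 1 -> M = N.
Proof.
move=> E00 E01 E10 E11; apply/matrixP=> i j.
have H (k : 'I_2) : k = 0 \/ k = 1.
  by case: k => -[|[|//]] ?; [left|right]; apply: val_inj.
by have [->|->] := H i; have [->|->] := H j.
Qed.

Lemma det3 (R : comNzRingType) (M : 'M[R]_3) (m := fun i j => M (inord i) (inord j)) :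
  \det M = m 0%N 0%N * (m 1%N 1%N * m 2%N 2%N - m 1%N 2%N * m 2%N 1%N)
         - m 0%N 1%N * (m 1%N 0%N * m 2%N 2%N - m 1%N 2%N * m 2%N 0%N)
         + m 0%N 2%N * (m 1%N 0%N * m 2%N 1%N - m 1%N 1%N * m 2%N 0%N).
Proof.
have mE i j : M i j = m (val i) (val j) by rewrite /m !inord_val.
rewrite (expand_det_row M ord0) !big_ord_recl big_ord0 /cofactor !det2 !mxE !mE /= /bump /=.
ring.
Qed.

Lemma det4 (R : comNzRingType) (M : 'M[R]_4) (m := fun i j => M (inord i) (inord j)) :
  \det M =
    m 0%N 0%N * (m 1%N 1%N * (m 2%N 2%N * m 3%N 3%N - m 2%N 3%N * m 3%N 2%N)
             - m 1%N 2%N * (m 2%N 1%N * m 3%N 3%N - m 2%N 3%N * m 3%N 1%N)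
             + m 1%N 3%N * (m 2%N 1%N * m 3%N 2%N - m 2%N 2%N * m 3%N 1%N))
  - m 0%N 1%N * (m 1%N 0%N * (m 2%N 2%N * m 3%N 3%N - m 2%N 3%N * m 3%N 2%N)
             - m 1%N 2%N * (m 2%N 0%N * m 3%N 3%N - m 2%N 3%N * m 3%N 0%N)
             + m 1%N 3%N * (m 2%N 0%N * m 3%N 2%N - m 2%N 2%N * m 3%N 0%N))
  + m 0%N 2%N * (m 1%N 0%N * (m 2%N 1%N * m 3%N 3%N - m 2%N 3%N * m 3%N 1%N)
             - m 1%N 1%N * (m 2%N 0%N * m 3%N 3%N - m 2%N 3%N * m 3%N 0%N)
             + m 1%N 3%N * (m 2%N 0%N * m 3%N 1%N - m 2%N 1%N * m 3%N 0%N))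
  - m 0%N 3%N * (m 1%N 0%N * (m 2%N 1%N * m 3%N 2%N - m 2%N 2%N * m 3%N 1%N)
             - m 1%N 1%N * (m 2%N 0%N * m 3%N 2%N - m 2%N 2%N * m 3%N 0%N)
             + m 1%N 2%N * (m 2%N 0%N * m 3%N 1%N - m 2%N 1%N * m 3%N 0%N)).
Proof.
have mE i j : M i j = m (val i) (val j) by rewrite /m !inord_val.
rewrite (expand_det_row M ord0) !big_ord_recl big_ord0 /cofactor !det3 !mxE !mE /= /bump /= !inordK //=.
ring.
Qed.

Notation ev iota a b c d := (mmap iota (tnth [tuple a; b; c; d])).

Section Eval.
Variables (K : finFieldType) (B : comNzRingType) (iota : {rmorphism K -> B}).
Variables a b c d : B.
Implicit Types p r : {mpoly K[4]}.

Lemma ev_va : ev iota a b c d (va K) = a.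
Proof. by rewrite mmapX mmap1U (tnth_nth a) /= inordK. Qed.
Lemma ev_vb : ev iota a b c d (vb K) = b.
Proof. by rewrite mmapX mmap1U (tnth_nth a) /= inordK. Qed.
Lemma ev_vc : ev iota a b c d (vc K) = c.
Proof. by rewrite mmapX mmap1U (tnth_nth a) /= inordK. Qed.
Lemma ev_vd : ev iota a b c d (vd K) = d.
Proof. by rewrite mmapX mmap1U (tnth_nth a) /= inordK. Qed.
Lemma ev_C x : ev iota a b c d x%:MP = iota x.
Proof. exact: mmapC. Qed.
Lemma ev_D p r : ev iota a b c d (p + r) = ev iota a b c d p + ev iota a b c d r.
Proof. exact: rmorphD. Qed.
Lemma ev_N p : ev iota a b c d (- p) = - ev iota a b c d p.
Proof. exact: rmorphN. Qed.
Lemma ev_M p r : ev iota a b c d (p * r) = ev iota a b c d p * ev iota a b c d r.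
Proof. exact: rmorphM. Qed.
Lemma ev_X p n : ev iota a b c d (p ^+ n) = ev iota a b c d p ^+ n.
Proof. exact: rmorphXn. Qed.
Lemma ev_1 : ev iota a b c d 1 = 1.
Proof. exact: rmorph1. Qed.
Lemma ev_0 : ev iota a b c d 0 = 0.
Proof. exact: rmorph0. Qed.

Definition evE := (ev_va, ev_vb, ev_vc, ev_vd, ev_C, ev_D, ev_N, ev_M, ev_X, ev_1, ev_0).
End Eval.

Notation sub a b c d := (ev (@mpolyC 4 _) a b c d).

Lemma rmorph_ev (K : finFieldType) (B B' : comNzRingType) (f : {rmorphism B -> B'})
    (iota : {rmorphism K -> B}) (iota' : {rmorphism K -> B'}) (a b c d : B) p :
  (forall x, f (iota x) = iota' x) ->
  f (ev iota a b c d p) = ev iota' (f a) (f b) (f c) (f d) p.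
Proof.
move=> fC; rewrite (rmorph_mmap _ _ fC); apply: eq_mmap => i.
by elim/ord4_ind: i; rewrite !(tnth_nth 0) /= inordK.
Qed.

Lemma ev_sub (K : finFieldType) (B : comNzRingType) (iota : {rmorphism K -> B})
    (a b c d : B) (e f g h : {mpoly K[4]}) p :
  ev iota a b c d (sub e f g h p) =
  ev iota (ev iota a b c d e) (ev iota a b c d f) (ev iota a b c d g) (ev iota a b c d h) p.
Proof. by apply: rmorph_ev => x; apply: mmapC. Qed.

Lemma sub_id (K : finFieldType) (p : {mpoly K[4]}) :
  sub (va K) (vb K) (vc K) (vd K) p = p.
Proof.
symmetry; apply: (@rmorph_mpolyE 4 K _ idfun) => // i.
by elim/ord4_ind: i; rewrite (tnth_nth 0) /= inordK.
Qed.

Lemma ev_eq (K : finFieldType) (B : comNzRingType) (iota : {rmorphism K -> B})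
    (a b c d a' b' c' d' : B) p :
  a = a' -> b = b' -> c = c' -> d = d' -> ev iota a b c d p = ev iota a' b' c' d' p.
Proof. by move=> -> -> -> ->. Qed.

(** * The conjugation action *)

Section Action.
Variable K : finFieldType.
Local Notation S := {mpoly K[4]}.
Local Notation va := (va K).
Local Notation vb := (vb K).
Local Notation vc := (vc K).
Local Notation vd := (vd K).
Implicit Types (p r : S) (x y z t A B C : K).

(* Conjugation by [x, y; z, t], the inverse being written as the adjugate: [cj] is
   the action only when x t - y z = 1. *)
Definition cj x y z t : S -> S :=
  sub ((t%:MP * va - y%:MP * vc) * x%:MP + (t%:MP * vb - y%:MP * vd) * z%:MP)
      ((t%:MP * va - y%:MP * vc) * y%:MP + (t%:MP * vb - y%:MP * vd) * t%:MP)
      ((x%:MP * vc - z%:MP * va) * x%:MP + (x%:MP * vd - z%:MP * vb) * z%:MP)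
      ((x%:MP * vc - z%:MP * va) * y%:MP + (x%:MP * vd - z%:MP * vb) * t%:MP).

HB.instance Definition _ x y z t := GRing.RMorphism.on (cj x y z t).

Lemma conj_actE (s : 'M[K]_2) p : \det s = 1 ->
  conj_act s p = cj (s 0 0) (s 0 1) (s 1 0) (s 1 1) p.
Proof.
move=> ds; have su : s \in unitmx by rewrite unitmxE ds unitr1.
pose m := \matrix_(i < 2, j < 2) (if i == 0 then (if j == 0 then s 1 1 else - s 0 1)
                                else if j == 0 then - s 1 0 else s 0 0).
have smE : s *m m = 1%:M.
  by apply: mx2_eq; rewrite mulmx2E !mxE /= ?mulr1n ?mulr0n -?ds ?det2; ring.
have iE : invmx s = m by rewrite -[RHS]mul1mx -(mulVmx su) -mulmxA smE mulmx1.
have cE i j : conj_mx s i j =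
    ((m i 0)%:MP * va + (m i 1)%:MP * vc) * (s 0 j)%:MP +
    ((m i 0)%:MP * vb + (m i 1)%:MP * vd) * (s 1 j)%:MP.
  by rewrite /conj_mx iE !mulmx2E !mxE.
rewrite /conj_act !cE !mxE /= !mpolyCN.
by rewrite /cj /comp_mpoly; apply: ev_eq; ring.
Qed.

Lemma conj_invariantE p : p \in @conj_invariant K <->
  forall x y z t, x * t - y * z = 1 -> cj x y z t p = p.
Proof.
split=> [/conj_invariantP H x y z t D|H].
  pose s := \matrix_(i < 2, j < 2) (if i == 0 then (if j == 0 then x else y)
                                     else if j == 0 then z else t).
  have ds : \det s = 1 by rewrite det2 !mxE.
  by have := H s; rewrite inE ds eqxx conj_actE // !mxE /=; apply.
apply/conj_invariantP=> s; rewrite inE => /eqP ds.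
by rewrite conj_actE // H // -det2.
Qed.

Lemma cj_eq x y z t x' y' z' t' p :
  x = x' -> y = y' -> z = z' -> t = t' -> cj x y z t p = cj x' y' z' t' p.
Proof. by move=> -> -> -> ->. Qed.

Lemma cj_comp x y z t x' y' z' t' p :
  cj x' y' z' t' (cj x y z t p) =
  cj (x' * x + y' * z) (x' * y + y' * t) (z' * x + t' * z) (z' * y + t' * t) p.
Proof.
by rewrite /cj ev_sub; apply: ev_eq; rewrite !evE !mpolyCD !mpolyCM; ring.
Qed.

Lemma cj_id p : cj 1 0 0 1 p = p.
Proof.
rewrite -[RHS]sub_id /cj !mpolyC1 !mpolyC0.
by apply: ev_eq; ring.
Qed.

Lemma cj_inv x y z t p : x * t - y * z = 1 -> cj t (- y) (- z) x (cj x y z t p) = p.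
Proof.
move=> D; by rewrite cj_comp -[RHS]cj_id; apply: cj_eq; rewrite -?D; ring.
Qed.

Lemma cj_C x y z t A : cj x y z t A%:MP = A%:MP.
Proof. exact: mmapC. Qed.

Lemma transvections_generate p :
    (forall y, cj 1 y 0 1 p = p) -> (forall z, cj 1 0 z 1 p = p) ->
  forall x y z t, x * t - y * z = 1 -> cj x y z t p = p.
Proof.
move=> HU HL.
have H0 x y z t : z != 0 -> x * t - y * z = 1 -> cj x y z t p = p.
  move=> z0 D.
  (* For z != 0, [x, y; z, t] is the product of an upper, a lower and an upper transvection; their
     parameters are read off the entries x, z and t, and the determinant gives y. *)
  transitivity (cj 1 ((x - 1) / z) 0 1 (cj 1 0 z 1 (cj 1 ((t - 1) / z) 0 1 p))).
    rewrite !cj_comp; apply: cj_eq; try by field.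
    have -> : y = (x * t - 1) / z by rewrite -D; field.
    by field.
  by rewrite HU HL HU.
move=> x y z t D; have [z0|] := eqVneq z 0; last by move/H0; apply.
have t0 : t != 0 by apply: contra_eq_neq D => ->; rewrite z0 !mulr0 subrr eq_sym oner_neq0.
(* A lower transvection is split off on the right, leaving t != 0 as lower left entry. *)
transitivity (cj (x + y) y (z + t) t (cj 1 0 (-1) 1 p)).
  by rewrite cj_comp; apply: cj_eq; ring.
by rewrite HL H0 ?z0 ?add0r // -D z0; ring.
Qed.

Section Semi.
Variable l : nat.
Hypothesis charl : l \in [pchar K].

(** A transvection has order [l], the characteristic, so its scalar [c] satisfies c^l = 1; Frobenius
    being injective, c = 1. Transvections generate SL_2. *)
Lemma semi_invariant p :
    (forall x y z t, x * t - y * z = 1 -> exists c : K, cj x y z t p = c%:MP * p) ->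
  p \in @conj_invariant K.
Proof.
move=> H; apply/conj_invariantE; have [->|p0] := eqVneq p 0.
  by move=> *; apply: rmorph0.
have fixed x y z t : x * t - y * z = 1 -> iter l (cj x y z t) p = p -> cj x y z t p = p.
  move=> D; have [c Ec] := H _ _ _ _ D.
  have -> k : iter k (cj x y z t) p = (c ^+ k)%:MP * p.
    elim: k => [|k IHk]; first by rewrite expr0 mpolyC1 mul1r.
    by rewrite iterS IHk rmorphM /= Ec cj_C exprSr mpolyCM mulrA.
  rewrite -{2}[p]mul1r => /(mulIf p0) /eqP.
  rewrite -mpolyC1 mpolyC_eq => /eqP Ecl.
  suff c1 : c = 1 by rewrite Ec c1 mpolyC1 mul1r.
  by apply/eqP; rewrite -(fmorph_eq1 (pFrobenius_aut charl)); apply/eqP.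
have l0 : l%:R = 0 :> K by apply: pcharf0.
apply: transvections_generate => y; apply: fixed; try by ring.
  have -> k : iter k (cj 1 y 0 1) p = cj 1 (k%:R * y) 0 1 p.
    elim: k => [|k IHk]; first by rewrite mul0r cj_id.
    by rewrite iterS IHk cj_comp; apply: cj_eq; rewrite -?[k.+1]addn1 ?natrD; ring.
  by rewrite l0 mul0r cj_id.
have -> k : iter k (cj 1 0 y 1) p = cj 1 0 (k%:R * y) 1 p.
  elim: k => [|k IHk]; first by rewrite mul0r cj_id.
  by rewrite iterS IHk cj_comp; apply: cj_eq; rewrite -?[k.+1]addn1 ?natrD; ring.
by rewrite l0 mul0r cj_id.
Qed.

End Semi.

End Action.

(** * Traceless linear forms *)

Section LinearForms.
Variable K : finFieldType.
Hypothesis two_neq0 : (2%:R : K) != 0.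
Local Notation S := {mpoly K[4]}.
Local Notation va := (va K).
Local Notation vb := (vb K).
Local Notation vc := (vc K).
Local Notation vd := (vd K).
Implicit Types (p r : S) (x y z t A B C k : K) (N : K * K * K) (s : seq (K * K * K)).

(* [lf A B C] is the linear form tr(N X), for X the generic matrix and
   N = [A, C; B, -A], and [nrm A B C] is det N. *)
Definition lf A B C : S := A%:MP * va + B%:MP * vb + C%:MP * vc - A%:MP * vd.
Definition nrm A B C : K := - A ^+ 2 - B * C.

(* The adjugate followed by conjugation by diag(1, -1): it commutes with the action
   up to an automorphism of SL_2. *)
Definition sw : S -> S := sub vd vb vc va.
HB.instance Definition _ := GRing.RMorphism.on sw.

Lemma ev_lf (R : comNzRingType) (iota : {rmorphism K -> R}) a b c d A B C :
  ev iota a b c d (lf A B C) = iota A * a + iota B * b + iota C * c - iota A * d.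
Proof. by rewrite /lf !evE. Qed.

Lemma cj_lf x y z t A B C : cj x y z t (lf A B C) =
  lf ((x * A + y * B) * t - (x * C - y * A) * z)
     ((z * A + t * B) * t - (z * C - t * A) * z)
     (- (x * A + y * B) * y + (x * C - y * A) * x).
Proof. rewrite /cj ev_lf /lf !(mpolyCD, mpolyCN, mpolyCM, mpolyCB); ring. Qed.

Lemma nrm_cj x y z t A B C : x * t - y * z = 1 ->
  nrm ((x * A + y * B) * t - (x * C - y * A) * z)
     ((z * A + t * B) * t - (z * C - t * A) * z)
     (- (x * A + y * B) * y + (x * C - y * A) * x) = nrm A B C.
Proof.
move=> D; transitivity ((x * t - y * z) ^+ 2 * nrm A B C); first by rewrite /nrm; ring.
by rewrite D expr1n mul1r.
Qed.

Lemma sw_lf A B C : sw (lf A B C) = lf (- A) B C.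
Proof. rewrite /sw ev_lf /lf !mpolyCN; ring. Qed.

Lemma lfN A B C : lf (- A) (- B) (- C) = - lf A B C.
Proof. rewrite /lf !mpolyCN; ring. Qed.

Lemma lf_inj A B C A' B' C' : lf A B C = lf A' B' C' -> [/\ A = A', B = B' & C = C'].
Proof.
move=> E; split.
- by have := congr1 (ev idfun 1 0 0 0) E; rewrite !ev_lf /= !(mulr0, mulr1, addr0, subr0).
- by have := congr1 (ev idfun 0 1 0 0) E; rewrite !ev_lf /= !(mulr0, mulr1, addr0, subr0, add0r).
- by have := congr1 (ev idfun 0 0 1 0) E; rewrite !ev_lf /= !(mulr0, mulr1, addr0, subr0, add0r).
Qed.

Lemma var_homog i : ('X_i : S) \is 1.-homog.
Proof. by rewrite dhomogX /= mdeg1. Qed.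

Lemma cst_mul_homog d A p : p \is d.-homog -> A%:MP * p \is d.-homog.
Proof. by rewrite mul_mpolyC; apply: rpredZ. Qed.

Lemma lf_homog A B C : lf A B C \is 1.-homog.
Proof. by rewrite /lf rpredB ?rpredD ?cst_mul_homog ?var_homog. Qed.

Lemma sub_homog d (e f g h : S) p : e \is 1.-homog -> f \is 1.-homog ->
  g \is 1.-homog -> h \is 1.-homog -> p \is d.-homog -> sub e f g h p \is d.-homog.
Proof.
move=> he hf hg hh hp; apply: (@mmap_homog 4 4 K mdeg (fun=> 1%N)).
  by elim/ord4_ind; rewrite (tnth_nth 0) /= inordK.
apply/dhomogP => m /(dhomogP _ _ _ hp) <-.
by rewrite /= /wdeg mdegE; apply: eq_bigr => i _; rewrite muln1.
Qed.

Lemma pihomog_sub d (e f g h : S) p : e \is 1.-homog -> f \is 1.-homog ->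
  g \is 1.-homog -> h \is 1.-homog ->
  pihomog mdeg d (sub e f g h p) = sub e f g h (pihomog mdeg d p).
Proof.
move=> he hf hg hh; rewrite (@pihomog_mmap 4 4 K mdeg (fun=> 1%N)); last first.
  by elim/ord4_ind; rewrite (tnth_nth 0) /= inordK.
congr mmap; rewrite !pihomogE; apply: eq_bigl => m.
by rewrite /= /wdeg mdegE; congr (_ == _); apply: eq_bigr => i _; rewrite muln1.
Qed.

Let cjh x y p r : p \is 1.-homog -> r \is 1.-homog ->
  p * x%:MP + r * y%:MP \is 1.-homog.
Proof. by move=> hp hr; rewrite rpredD // mulrC cst_mul_homog. Qed.

Lemma cj_homog d x y z t p : p \is d.-homog -> cj x y z t p \is d.-homog.
Proof.
by apply: sub_homog; rewrite cjh // rpredB // cst_mul_homog // var_homog.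
Qed.

Lemma pihomog_cj d x y z t p : pihomog mdeg d (cj x y z t p) = cj x y z t (pihomog mdeg d p).
Proof.
by apply: pihomog_sub; rewrite cjh // rpredB // cst_mul_homog // var_homog.
Qed.

Lemma sw_homog d p : p \is d.-homog -> sw p \is d.-homog.
Proof. by apply: sub_homog; rewrite var_homog. Qed.

(* The substitution of the orthogonal projection of X to the complement of N,
   where k = det N. *)
Definition rho k A B C : S -> S :=
  sub (va + lf A B C * (A / (2%:R * k))%:MP) (vb + lf A B C * (C / (2%:R * k))%:MP)
      (vc + lf A B C * (B / (2%:R * k))%:MP) (vd - lf A B C * (A / (2%:R * k))%:MP).
HB.instance Definition _ k A B C := GRing.RMorphism.on (rho k A B C).

Lemma rho_lf k A B C A' B' C' : rho k A B C (lf A' B' C') =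
  lf A' B' C' + lf A B C * ((2%:R * A * A' + B' * C + C' * B) / (2%:R * k))%:MP.
Proof.
rewrite /rho ev_lf; set L := lf _ _ _.
have -> : (2%:R * A * A' + B' * C + C' * B) / (2%:R * k) =
    2%:R * (A / (2%:R * k)) * A' + B' * (C / (2%:R * k)) + C' * (B / (2%:R * k)).
  ring.
move: (A / _) (B / _) (C / _) => A1 B1 C1.
rewrite /lf !mpolyCD !mpolyCM mpolyC_nat; ring.
Qed.

Lemma rho_congr k A B C p : divides (lf A B C) (p - rho k A B C p).
Proof.
rewrite -{1}[p]sub_id; apply: mmap_congr => i; rewrite /rho; set L := lf _ _ _.
move: (A / _) (B / _) (C / _) => A1 B1 C1.
elim/ord4_ind: i; rewrite !(tnth_nth 0) /= !inordK //=;
  [exists (- A1%:MP)|exists (- C1%:MP)|exists (- B1%:MP)|exists A1%:MP]; ring.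
Qed.

Lemma rho_lf_id k A B C : k != 0 -> nrm A B C = k -> rho k A B C (lf A B C) = 0.
Proof.
move=> k0 Nk; rewrite rho_lf.
have -> : 2%:R * A * A + B * C + C * B = - (2%:R * k) by rewrite -Nk /nrm; ring.
rewrite mulNr divff ?mulf_neq0 //.
by rewrite mpolyCN mpolyC1 mulrN mulr1 subrr.
Qed.

(** [rho] changes a polynomial by a multiple of the form and kills the form. As [rho] is a morphism
    into a domain, the form is a prime element. *)
Lemma lf_divides k A B C p : k != 0 -> nrm A B C = k ->
  divides (lf A B C) p <-> rho k A B C p = 0.
Proof.
move=> k0 Nk; split=> [[z ->]|E]; first by rewrite rmorphM /= rho_lf_id // mulr0.
by rewrite -[p]subr0 -E; apply: rho_congr.
Qed.

(** A form killed by [rho] is proportional to the first one, by a ratio [m]; equal norms force m^2 =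
    1. *)
Lemma rho_lf_neq0 k A B C A' B' C' : k != 0 -> nrm A B C = k -> nrm A' B' C' = k ->
  (A', B', C') != (A, B, C) -> (A', B', C') != (- A, - B, - C) ->
  rho k A B C (lf A' B' C') != 0.
Proof.
move=> k0 Nk Nk' ne1 ne2; apply/eqP; rewrite rho_lf => /eqP.
set m := _ / _ => E.
have [EA EB EC] : [/\ A' = - (m * A), B' = - (m * B) & C' = - (m * C)].
  apply: lf_inj; move: E; rewrite addr_eq0 => /eqP ->.
  by rewrite /lf !mpolyCN !mpolyCM; ring.
have : m ^+ 2 == 1.
  rewrite -(inj_eq (mulIf k0)) mul1r -{1}Nk -Nk' /nrm EA EB EC; apply/eqP; ring.
rewrite -subr_eq0 subr_sqr_1 mulf_eq0 subr_eq0 addr_eq0 => /orP[]/eqP m1.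
  by case/eqP: ne2; rewrite EA EB EC m1 !mul1r.
by case/eqP: ne1; rewrite EA EB EC m1 !mulN1r !opprK.
Qed.

Lemma lf_neq0 A B C : nrm A B C != 0 -> lf A B C != 0.
Proof.
apply: contraNneq => E; have [->->->] : [/\ A = 0, B = 0 & C = 0].
  by apply: lf_inj; rewrite E /lf !mpolyC0; ring.
by rewrite /nrm; apply/eqP; ring.
Qed.

Definition lft N : S := lf N.1.1 N.1.2 N.2.
Definition nrmt N : K := nrm N.1.1 N.1.2 N.2.
Definition oppt N : K * K * K := (- N.1.1, - N.1.2, - N.2).

Lemma lftN N : lft (oppt N) = - lft N.
Proof. exact: lfN. Qed.

Lemma prod_lf_divides k s p : k != 0 -> {in s, forall N, nrmt N = k} -> uniq s ->
    {in s, forall N, oppt N \notin s} -> {in s, forall N, divides (lft N) p} ->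
  divides (\prod_(N <- s) lft N) p.
Proof.
move=> k0; elim: s p => [|N s IHs] p Nk us sN dv.
  by rewrite big_nil; exists p; rewrite mulr1.
have inS N' : N' \in s -> N' \in N :: s by move=> sN'; rewrite inE sN' orbT.
have [|||N' sN'|z Ez] := IHs p.
- by move=> N' /inS/Nk.
- by have /andP[] := us.
- move=> N' /inS/sN; apply: contra; exact: inS.
- by apply: dv; apply: inS.
rewrite big_cons Ez; suff [w ->] : divides (lft N) z.
  by exists w; rewrite mulrA.
have NkN : nrmt N = k by apply: Nk; rewrite mem_head.
have /(lf_divides _ k0 NkN) : divides (lft N) p by apply: dv; rewrite mem_head.
rewrite Ez rmorphM => /eqP; rewrite mulf_eq0 => /orP[/eqP|]; first by move/lf_divides; apply.
rewrite rmorph_prod prodf_seq_eq0 /=.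
case/hasP => N' xs /= /eqP E; exfalso.
move: E; apply/eqP.
apply: rho_lf_neq0 => //; first by rewrite -[LHS]/(nrmt N') Nk ?inS.
  case: us => /andP[] Ns _; apply: contraNneq Ns.
  by case: N' N xs {sN dv NkN Nk IHs inS} => [[? ?] ?] [[? ?] ?] /= xs <-.
have := sN N (mem_head _ _); apply: contraNneq => E.
by rewrite /oppt -E; case: N' xs {E} => [[? ?] ?] /= /inS.
Qed.

End LinearForms.

(** * Representatives of the forms modulo sign *)

Section Halves.
Variable K : finFieldType.
Hypothesis two_neq0 : (2%:R : K) != 0.
Local Notation S := {mpoly K[4]}.
Local Notation q := #|K|.
Implicit Types (p r : S) (x y z t A B C k : K) (N : K * K * K) (s : seq (K * K * K)).

(* A system of representatives of K^* modulo -1. *)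
Definition hsys : pred K := fun B => (enum_rank B < enum_rank (- B))%N.

Lemma oppr_neq B : B != 0 -> - B != B.
Proof.
move=> B0; rewrite eq_sym -subr_eq0 opprK -mulr2n -mulr_natl.
by rewrite mulf_neq0.
Qed.

Lemma half0 : hsys 0 = false.
Proof. by rewrite /hsys oppr0 ltnn. Qed.

Lemma halfN B : B != 0 -> hsys (- B) = ~~ hsys B.
Proof.
move=> B0; rewrite /hsys opprK -leqNgt [RHS]leq_eqVlt.
case: eqP => // E; have {}E := enum_rank_inj (val_inj E).
by have := oppr_neq B0; rewrite E eqxx.
Qed.

Lemma half_neq0 B : hsys B -> B != 0.
Proof. by apply: contraTneq => ->; rewrite half0. Qed.

Lemma half_opp B : hsys B -> hsys (- B) = false.
Proof. by move=> hB; rewrite halfN ?half_neq0 // hB. Qed.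

Lemma card_half : q = (#|hsys|.*2).+1.
Proof.
rewrite (cardD1 0) add1n; congr _.+1.
rewrite -(cardID hsys) -addnn; congr (_ + _)%N.
  apply: eq_card => B; rewrite !inE -!topredE /=.
  by case: (boolP (hsys B)) => [/half_neq0->|]; rewrite ?andbF.
rewrite -(card_image (@oppr_inj K) hsys); apply: eq_card => B.
rewrite -[in RHS](opprK B) mem_image; last exact: oppr_inj.
rewrite !inE -!topredE /=.
have [->|B0] := eqVneq B 0; first by rewrite oppr0 andbF half0.
by rewrite !andbT halfN.
Qed.

Lemma prod_half (F : K -> S) :
  \prod_(B | B != 0) F B = \prod_(B | hsys B) (F B * F (- B)).
Proof.
rewrite (bigID hsys) big_split /=; congr (_ * _).
  apply: eq_bigl => B; case: (boolP (hsys B)) => [/half_neq0->|] //.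
  by rewrite andbF.
rewrite (reindex_inj (@oppr_inj K)) /=; apply: eq_bigl => B.
have [->|B0] := eqVneq B 0; first by rewrite oppr0 eqxx half0.
by rewrite oppr_eq0 B0 halfN // negbK.
Qed.

(** With m = (q - 1)/2, counting the roots of X^m - 1 gives x != 0 with x^m != 1, hence x^m = -1,
    which is a square as m is even. *)
Lemma sqrt_opp_one : ~~ odd #|hsys| -> exists c : K, c ^+ 2 = -1.
Proof.
set m := #|hsys| => mev.
have q2 : (2 < q)%N.
  rewrite card_half ltnS -/m.
  suff : (0 < m)%N by case: (m) => // k; rewrite doubleS.
  apply/card_gt0P; have [h|h] := boolP (hsys (1 : K)); first by exists 1.
  by exists (-1); rewrite -topredE /= halfN ?oner_neq0.
have m0 : (0 < m)%N by move: q2; rewrite card_half -/m; case: (m).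
have [x [x0 xm]] : exists x : K, x != 0 /\ x ^+ m != 1.
  apply: NNPP => H.
  have := @max_unity_roots K m (enum (predC1 (0 : K))) m0.
  rewrite enum_uniq -cardE cardC1 card_half /= -/m.
  have -> : all m.-unity_root (enum (predC1 (0 : K))).
    apply/allP => x; rewrite mem_enum inE => x0; rewrite unity_rootE.
    by apply/eqP; apply: NNPP => /eqP xm; apply: H; exists x.
  by move=> /(_ isT isT); rewrite -addnn; lia.
exists (x ^+ m./2); rewrite -exprM mulnC -[X in X ^+ _]/x.
have -> : (2 * m./2 = m)%N by have := odd_double_half m; rewrite (negPf mev); lia.
have : (x ^+ m) ^+ 2 == 1.
  rewrite -exprM muln2; have := expf_card x; rewrite card_half exprS -/m => E.
  by apply/eqP; apply: (mulfI x0); rewrite E mulr1.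
by rewrite -subr_eq0 subr_sqr_1 mulf_eq0 subr_eq0 (negPf xm) addr_eq0 => /eqP.
Qed.

(* [ells k] represents, modulo sign, the traceless matrices of determinant k with
   B != 0; when -k is not a square these are all of them, whereas for k = -1 those with
   B = 0 are added in [spl]. *)
Definition elltriple k A B : K * K * K := (A, B, - (A ^+ 2 + k) / B).
Definition ells k := [seq elltriple k A B | A <- enum K, B <- enum hsys].
Definition spl := ells (-1) ++ [seq (1, 0, C) | C <- enum K].

Lemma size_ells k : size (ells k) = (q * #|hsys|)%N.
Proof. by rewrite size_allpairs -!cardE. Qed.

Lemma size_spl : size spl = (q * #|hsys| + q)%N.
Proof. by rewrite size_cat size_ells size_map -cardE. Qed.

Lemma mem_ells k A B C : ((A, B, C) \in ells k) = hsys B && (nrm A B C == k).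
Proof.
apply/allpairsP/andP => [[[A' B'] /= [_ hB [-> -> ->]]]|[hB /eqP Nk]].
  rewrite mem_enum unfold_in in hB; split=> //; apply/eqP; rewrite /nrm.
  by have := half_neq0 hB => B0; field.
exists (A, B); rewrite !mem_enum; split=> //=; congr (_, _, _).
by have := half_neq0 hB => B0; rewrite -Nk /nrm; field.
Qed.

Lemma mem_tail A B C : ((A, B, C) \in [seq (1 : K, 0 : K, C) | C <- enum K]) =
  (A == 1) && (B == 0).
Proof.
apply/mapP/andP => [[C' _ [-> ->]] //|[/eqP-> /eqP->]].
by exists C; rewrite ?mem_enum.
Qed.

Lemma mem_spl A B C : ((A, B, C) \in spl) =
  (hsys B && (nrm A B C == -1)) || ((A == 1) && (B == 0)).
Proof. by rewrite mem_cat mem_ells mem_tail. Qed.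

Lemma nrm_ells k : {in ells k, forall N, nrmt N = k}.
Proof. by move=> [[A B] C]; rewrite mem_ells => /andP[_ /eqP]. Qed.

Lemma nrm_spl : {in spl, forall N, nrmt N = -1}.
Proof.
move=> [[A B] C]; rewrite mem_spl => /orP[/andP[_ /eqP//]|/andP[/eqP-> /eqP->]].
by rewrite /nrmt /nrm /=; ring.
Qed.

Lemma uniq_ells k : uniq (ells k).
Proof.
apply: allpairs_uniq; rewrite ?enum_uniq // => -[A B] [A' B'] /= _ _ [-> ->] //.
Qed.

Lemma uniq_spl : uniq spl.
Proof.
rewrite cat_uniq uniq_ells map_inj_uniq ?enum_uniq ?andbT; last by move=> C C' [].
apply/hasPn => -[[A B] C]; rewrite mem_tail => /andP[_ /eqP->].
by rewrite mem_ells half0.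
Qed.

Lemma opp_ells k : {in ells k, forall N, oppt N \notin ells k}.
Proof.
move=> [[A B] C]; rewrite mem_ells => /andP[hB _].
by rewrite /oppt mem_ells half_opp.
Qed.

Lemma opp_spl : {in spl, forall N, oppt N \notin spl}.
Proof.
move=> [[A B] C]; rewrite mem_spl /oppt mem_spl => /orP[/andP[hB _]|/andP[/eqP-> /eqP->]].
  by rewrite half_opp // oppr_eq0 (negPf (half_neq0 hB)) andbF.
rewrite oppr0 half0 eqxx /= andbT.
by rewrite oppr_neq // oner_neq0.
Qed.

Lemma ells_complete k N : N.1.2 != 0 -> nrmt N = k -> N \in ells k \/ oppt N \in ells k.
Proof.
case: N => [[A B] C] /= B0 Nk; rewrite /oppt !mem_ells halfN //=.
rewrite /nrmt /= in Nk; case: (hsys B) => /=; first by left; apply/eqP.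
by right; apply/eqP; rewrite -Nk /nrm; ring.
Qed.

End Halves.

(** * The orbit products [g0] and [D0], and the square root of f4 *)

Section Products.
Variables (K : finFieldType) (l : nat) (delta : K).
Hypothesis charl : l \in [pchar K].
Hypothesis two_neq0 : (2%:R : K) != 0.
Hypothesis irr : forall x : K, x ^+ 2 + delta != 0.
Local Notation S := {mpoly K[4]}.
Local Notation q := #|K|.
Local Notation va := (va K).
Local Notation vb := (vb K).
Local Notation vc := (vc K).
Local Notation vd := (vd K).
Implicit Types (p r : S) (x y z t A B C k : K) (N : K * K * K) (s : seq (K * K * K)).

Lemma delta_neq0 : delta != 0.
Proof. by have := irr 0; rewrite expr0n add0r. Qed.

(** Squaring is injective on 0 together with the representatives modulo sign. *)
Lemma card_squares : (#|@hsys K| < #|[set x ^+ 2 | x : K]|)%N.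
Proof.
pose D := (0 : K) |: [set x | hsys x].
have cD : #|D| = #|@hsys K|.+1.
  by rewrite cardsU1 inE half0 add1n; congr _.+1; apply: eq_card => x; rewrite inE.
have <- : #|[set x ^+ 2 | x in D]| = #|@hsys K|.+1.
  rewrite -cD card_in_imset // => x y; rewrite !inE => hx hy /eqP.
  rewrite -subr_eq0 subr_sqr mulf_eq0 subr_eq0 addr_eq0 => /orP[/eqP//|/eqP Exy].
  move: hx; rewrite Exy oppr_eq0; case: eqP => [->|_]; first by rewrite oppr0.
  by case/orP: hy => [/eqP->|/(half_opp two_neq0)->//]; rewrite oppr0.
by apply/subset_leq_card/subsetP => _ /imsetP[x _ ->]; apply: imset_f.
Qed.

(** Pigeonhole: the squares x^2 and the elements k - delta y^2 each fill more than half of K. *)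
Lemma norm_surjective k : exists x y, x ^+ 2 + delta * y ^+ 2 = k.
Proof.
pose X := [set x ^+ 2 | x : K].
pose Y := [set k - delta * y | y in X].
have cY : #|Y| = #|X|.
  by apply: card_imset => x y /addrI/oppr_inj/(mulfI delta_neq0).
have /card_gt0P[z] : (0 < #|X :&: Y|)%N.
  have := cardsUI X Y; have := max_card (X :|: Y); rewrite cY (card_half two_neq0).
  by have := card_squares; rewrite -/X -addnn; lia.
rewrite inE => /andP[/imsetP[x _ ->] /imsetP[_ /imsetP[y _ ->] E]].
by exists x, y; rewrite E subrK.
Qed.

(** Since N^2 = -delta, in a basis of rows v N, v the matrix N becomes the companion matrix
    [0, -delta; 1, 0]. The determinant of this basis is B (r^2 + delta u^2) for v = (B u, r - A u),
    and v is chosen to make it 1; the conjugating matrix is the inverse of the one with rows v N and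
    v. *)
Lemma ell_transitive N : nrmt N = delta -> exists x y z t,
  x * t - y * z = 1 /\ cj x y z t (lf 0 1 (- delta)) = lft N.
Proof.
case: N => [[A B] C]; rewrite /nrmt /nrm /= => Nk.
have B0 : B != 0.
  apply: contraTneq isT => B0; have := irr A; rewrite -Nk B0 mul0r subr0.
  by rewrite subrr eqxx.
have [r [u Eru]] := norm_surjective B^-1.
pose v1 := B * u; pose v2 := r - A * u.
have EC : C = - (A ^+ 2 + delta) / B by rewrite -Nk; field.
have dM : (v1 * A + v2 * B) * v2 - (v1 * C - v2 * A) * v1 = 1.
  transitivity (B * (r ^+ 2 + delta * u ^+ 2)); last by rewrite Eru divff.
  by rewrite EC /v1 /v2; field.
exists v2, (- (v1 * C - v2 * A)), (- v1), (v1 * A + v2 * B); split.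
  by rewrite -[RHS]dM; ring.
rewrite cj_lf /lft /=; have Cd : delta = - A ^+ 2 - B * C by rewrite Nk.
have e (x y z x' y' z' : K) : x = x' -> y = y' -> z = z' -> lf x y z = lf x' y' z'.
  by move=> -> -> ->.
by rewrite Cd; apply: e; rewrite -[RHS]mulr1 -[X in _ = _ * X]dM; ring.
Qed.

Lemma spl_transitive N : nrmt N = -1 -> exists x y z t,
  x * t - y * z = 1 /\ cj x y z t (lf 1 0 0) = lft N.
Proof.
case: N => [[A B] C]; rewrite /nrmt /nrm /= => Nk.
have e (x y z x' y' z' : K) : x = x' -> y = y' -> z = z' -> lf x y z = lf x' y' z'.
  by move=> -> -> ->.
have [B0|B0] := eqVneq B 0; last first.
  have EC : C = (1 - A ^+ 2) / B by rewrite -[1]opprK -Nk; field.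
  (* The columns are eigenvectors of N for the eigenvalues 1 and -1, scaled so that the determinant
     is 1. *)
  exists (-1 - A), ((1 - A) / (2%:R * B)), (- B), (- 2%:R^-1); split.
    by field; rewrite ?two_neq0 ?B0.
  by rewrite cj_lf /lft /=; apply: e; rewrite ?EC; field; rewrite ?two_neq0 ?B0.
have : (A - 1) * (A + 1) == 0.
  by rewrite -subr_sqr_1 subr_eq0; apply/eqP/oppr_inj; rewrite -Nk B0; ring.
rewrite mulf_eq0 subr_eq0 addr_eq0 => /orP[]/eqP EA.
  exists 1, (- (C / 2%:R)), 0, 1; split; first by ring.
  by rewrite cj_lf /lft /= EA B0; apply: e; field.
exists (- (C / 2%:R)), 1, (-1), 0; split; first by ring.
by rewrite cj_lf /lft /= EA B0; apply: e; field.
Qed.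

Definition g0 : S := \prod_(N <- ells delta) lft N.
Definition D0 : S := \prod_(N <- spl K) lft N.

Lemma prod_lf_homog s : \prod_(N <- s) lft N \is (size s).-homog.
Proof.
elim: s => [|N s IHs]; first by rewrite big_nil dhomog1.
by rewrite big_cons; apply: (dhomogM (lf_homog _ _ _) IHs).
Qed.

Lemma g0_homog : g0 \is (q * #|@hsys K|).-homog.
Proof. by rewrite -(size_ells delta) prod_lf_homog. Qed.

Lemma D0_homog : D0 \is (q * #|@hsys K| + q).-homog.
Proof. by rewrite -size_spl prod_lf_homog. Qed.

Lemma lft_neq0 N k : k != 0 -> nrmt N = k -> lft N != 0.
Proof. by move=> k0 Nk; apply: lf_neq0; rewrite -[nrm _ _ _]/(nrmt N) Nk. Qed.

Lemma g0_neq0 : g0 != 0.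
Proof.
rewrite prodf_seq_neq0; apply/allP => N /nrm_ells Nk /=.
exact: (lft_neq0 delta_neq0).
Qed.

Lemma g0_divides p : {in ells delta, forall N, divides (lft N) p} -> divides g0 p.
Proof.
apply: (prod_lf_divides two_neq0 delta_neq0).
- exact: nrm_ells.
- exact: uniq_ells.
- exact: opp_ells.
Qed.

Lemma lft_divides_g0 N : nrmt N = delta -> divides (lft N) g0.
Proof.
move=> Nk; have mem N' : N' \in ells delta -> divides (lft N') g0.
  by move=> N's; rewrite /g0 (big_rem _ N's) /=; apply: divides_mulr; apply: divides_refl.
have B0 : N.1.2 != 0.
  apply: contraTneq isT => B0; have := irr N.1.1; rewrite -Nk /nrmt /nrm B0 mul0r subr0.
  by rewrite subrr eqxx.
have [/mem//|/mem] := ells_complete two_neq0 B0 Nk.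
by rewrite lftN => -[w ->]; exists (- w); rewrite mulNr mulrN.
Qed.

Lemma inv_g0_divides p : p \in @conj_invariant K ->
  divides (lf 0 1 (- delta)) p -> divides g0 p.
Proof.
move=> /conj_invariantE pinv dp; apply: g0_divides => N /nrm_ells.
move=> /ell_transitive[x [y [z [t [dt <-]]]]].
by rewrite -(pinv x y z t dt); apply: divides_morph.
Qed.

Lemma inv_D0_divides p : p \in @conj_invariant K ->
  divides (va - vd) p -> divides D0 p.
Proof.
move=> /conj_invariantE pinv dp.
apply: (prod_lf_divides (k := -1) two_neq0); rewrite ?oppr_eq0 ?oner_neq0 //.
- exact: nrm_spl.
- exact: uniq_spl.
- exact: opp_spl.
move=> N /nrm_spl/spl_transitive[x [y [z [t [dt <-]]]]].
rewrite -(pinv x y z t dt); apply: divides_morph.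
by rewrite /lf !mpolyC1 !mpolyC0 !mul0r !mul1r !addr0.
Qed.

(** The action permutes the chosen forms only up to sign. Instead of following the signs, [g0] is
    shown to divide its image, which has the same degree, so that the two differ by a scalar. *)
Lemma g0_inv : g0 \in @conj_invariant K.
Proof.
apply: (semi_invariant charl) => x y z t dt.
have [w Ew] : divides g0 (cj x y z t g0).
  apply: g0_divides => N /nrm_ells Nk.
  have dt' : t * x - (- y) * (- z) = 1 by rewrite -[RHS]dt; ring.
  pose N' := ((t * N.1.1 + - y * N.1.2) * x - (t * N.2 - - y * N.1.1) * - z,
     (- z * N.1.1 + x * N.1.2) * x - (- z * N.2 - x * N.1.1) * - z,
     - (t * N.1.1 + - y * N.1.2) * - y + (t * N.2 - - y * N.1.1) * t).
  have EN' : cj t (- y) (- z) x (lft N) = lft N' by rewrite cj_lf.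
  have NkN' : nrmt N' = delta by rewrite -Nk; apply: nrm_cj.
  have -> : lft N = cj x y z t (lft N').
    have := cj_inv (lft N) dt'; rewrite !opprK EN' => <-.
    by [].
  by apply: divides_morph; apply: lft_divides_g0.
have E0 : cj x y z t g0 != 0.
  apply: contraNneq g0_neq0 => E; rewrite -(cj_inv g0 dt) E; apply/eqP; exact: rmorph0.
have [_] : (q * #|@hsys K| <= q * #|@hsys K|)%N /\ w \is (q * #|@hsys K| - q * #|@hsys K|).-homog.
  by apply: (@dhomog_divides _ _ _ _ w g0); rewrite -?Ew ?cj_homog ?g0_homog.
by rewrite subnn => /dhomog0_const[c Ec]; exists c; rewrite Ew Ec.
Qed.

Lemma big_ells k (F : K * K * K -> S) :
  \prod_(N <- ells k) F N = \prod_(A : K) \prod_(B | hsys B) F (elltriple k A B).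
Proof.
rewrite /ells big_allpairs_dep big_enum /=; apply: eq_bigr => A _.
by rewrite -big_enum.
Qed.

Lemma sw_g0 : sw g0 = g0.
Proof.
rewrite /g0 big_ells rmorph_prod (reindex_inj (@oppr_inj K)) /=.
apply: eq_bigr => A _; rewrite rmorph_prod; apply: eq_bigr => B _.
by rewrite /elltriple /lft /= sw_lf opprK sqrrN.
Qed.

Lemma f4E : f4 delta = (- (-1) ^+ (q * #|@hsys K|))%:MP * g0 ^+ 2.
Proof.
rewrite /f4 mpolyCN mulNr; congr (- _).
(* The factor at (A, -B) is the opposite of the representative at (-A, B); reindexing A by -A then
   makes the second half another copy of [g0]. *)
have E A : \prod_(B | B != 0) (A *: va + B *: vb - ((A ^+ 2 + delta) / B) *: vc - A *: vd)
   = \prod_(B | hsys B) (lft (elltriple delta A B) * - lft (elltriple delta (- A) B)).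
  rewrite (prod_half two_neq0); apply: eq_bigr => B hB; rewrite -lfN /elltriple /lft /lf /=.
  rewrite -!mul_mpolyC sqrrN !invrN !(mulrN, mulNr, opprK) !mpolyCN !mulNr.
  by congr (_ * _); ring.
rewrite (eq_bigr _ (fun A _ => E A)).
rewrite (eq_bigr (fun A => ((-1) ^+ #|@hsys K|)%:MP * (\prod_(B | hsys B)
  (lft (elltriple delta A B)) * \prod_(B | hsys B) (lft (elltriple delta (- A) B))))); last first.
  move=> A _; rewrite big_split prodrN /= mulrCA.
  by rewrite rmorphXn /= mpolyCN mpolyC1.
rewrite big_split /= prodr_const -rmorphXn /= -exprM [(_ * #|_|)%N]mulnC; congr (_ * _).
by rewrite big_split /= /g0 big_ells expr2; congr (_ * _); rewrite [RHS](reindex_inj (@oppr_inj K)).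
Qed.

(** As q is odd, the scalar is 1 if m = (q - 1)/2 is odd, and otherwise -1, which is then a
    square. *)
Lemma f4_scalar : exists2 c : K, c != 0 & c ^+ 2 = - (-1) ^+ (q * #|@hsys K|).
Proof.
have oq : odd q by rewrite (card_half two_neq0) /= odd_double.
rewrite -signr_odd oddM oq /=; case: (boolP (odd _)) => om.
  by exists 1; rewrite ?oner_neq0 // expr1n expr1 opprK.
have [c Ec] := sqrt_opp_one two_neq0 om; exists c; rewrite ?expr0 //.
by apply: contra_eq_neq Ec => ->; rewrite expr0n eq_sym oppr_eq0 oner_neq0.
Qed.

Lemma f4_sqrt : exists g, g ^+ 2 = f4 delta.
Proof.
have [c c0 Ec] := f4_scalar; exists (c%:MP * g0).
by rewrite exprMn f4E -rmorphXn /= Ec.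
Qed.

Lemma f4_sqrtE g : g ^+ 2 = f4 delta -> exists2 c : K, c != 0 & g = c%:MP * g0.
Proof.
have [c c0 Ec] := f4_scalar; rewrite f4E -Ec rmorphXn -exprMn => /eqP.
rewrite -subr_eq0 subr_sqr mulf_eq0 subr_eq0 addr_eq0 => /orP[]/eqP->.
  by exists c.
by exists (- c); rewrite ?oppr_eq0 // mpolyCN mulNr.
Qed.

(** [sw] fixes the hyperplane a = d pointwise, so a - d divides p - sw p = 2 p; the conjugates of a
    - d follow by invariance. *)
Lemma anti_divides p : p \in @conj_invariant K -> sw p = - p -> divides D0 p.
Proof.
move=> pinv ap; apply: inv_D0_divides => //.
have [w Ew] : divides (va - vd) (p - sw p).
  rewrite -{1}[p]sub_id; apply: mmap_congr => i.
  elim/ord4_ind: i; rewrite !(tnth_nth 0) /= !inordK //=;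
    [exists 1|exists 0|exists 0|exists (-1)]; ring.
exists ((2%:R^-1)%:MP * w); rewrite -mulrA -Ew ap opprK -mulr2n -[p *+ 2]mulr_natl.
by rewrite mulrA -mpolyC_nat -mpolyCM mulVf // mpolyC1 mul1r.
Qed.

End Products.

Lemma jacobian_comp (K : finFieldType) (t u : 4.-tuple {mpoly K[4]}) :
  jacobian [tuple tnth t i \mPo u | i < 4] =
  (jacobian t \mPo u) * \det (\matrix_(i < 4, j < 4) (tnth u i)^`M(j)).
Proof.
rewrite /jacobian -det_map_mx -det_mulmx; congr (\det _); apply/matrixP => i j.
rewrite !mxE tnth_mktuple mderiv_comp; apply: eq_bigr => k _.
by rewrite !mxE.
Qed.

Lemma mderivXn (R : comNzRingType) (n k : nat) (p : {mpoly R[n]}) i :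
  (p ^+ k)^`M(i) = k%:R * p ^+ k.-1 * p^`M(i).
Proof.
elim: k => [|k IHk]; first by rewrite expr0 -mpolyC1 mderivC !mul0r.
rewrite exprS mderivM IHk /=; case: k {IHk} => [|k] /=.
  by rewrite !expr0; ring.
by rewrite exprS -[k.+2]add1n natrD; ring.
Qed.

(** * The Jacobian *)

Section Invariants.
Variables (K : finFieldType) (l n : nat) (delta : K).
Hypothesis charl : l \in [pchar K].
Hypothesis cardK : #|K| = (l ^ n)%N.
Hypothesis n_gt0 : (0 < n)%N.
Hypothesis two_neq0 : (2%:R : K) != 0.
Hypothesis irr : forall x : K, x ^+ 2 + delta != 0.
Local Notation S := {mpoly K[4]}.
Local Notation q := #|K|.
Local Notation va := (va K).
Local Notation vb := (vb K).
Local Notation vc := (vc K).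
Local Notation vd := (vd K).
Local Notation tr := (inv_trace K).
Local Notation dt := (inv_det K).
Local Notation P1 := (inv_P1det K).
Implicit Types (p r g : S) (x y z t A B C k : K).

Section Frobenius.
Variables (B : comNzRingType) (iota : {rmorphism K -> B}).

Lemma frobD (u v : B) : (u + v) ^+ q = u ^+ q + v ^+ q.
Proof.
rewrite cardK exprDn_pchar // pnatX; apply/orP; left.
rewrite pnatE ?(pcharf_prime charl) //; exact: (rmorph_pchar iota charl).
Qed.

Lemma q_odd : odd q.
Proof. by rewrite (card_half two_neq0) /= odd_double. Qed.

Lemma frobN (u : B) : (- u) ^+ q = - u ^+ q.
Proof. by rewrite exprNn -signr_odd q_odd expr1 mulN1r. Qed.

Lemma frobM (u v : B) : (u * v) ^+ q = u ^+ q * v ^+ q.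
Proof. exact: exprMn. Qed.

Lemma frobC x : iota x ^+ q = iota x.
Proof. by rewrite -rmorphXn /= expf_card. Qed.

Definition frobE := (frobD, frobN, frobM, frobC).

Lemma card_eq0 : q%:R = 0 :> B.
Proof.
rewrite -(rmorph_nat iota) cardK natrX (pcharf0 charl).
by rewrite expr0n; case: n n_gt0 => //= m _; rewrite rmorph0.
Qed.

Variables a b c d : B.

Lemma ev_tr : ev iota a b c d tr = a + d.
Proof. by rewrite /inv_trace !evE. Qed.

Lemma ev_dt : ev iota a b c d dt = a * d - b * c.
Proof. by rewrite /inv_det !evE. Qed.

Lemma ev_P1 : ev iota a b c d P1 = a ^+ q * d + a * d ^+ q - b ^+ q * c - b * c ^+ q.
Proof. by rewrite /inv_P1det !evE. Qed.

End Frobenius.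

Lemma tr_inv : tr \in @conj_invariant K.
Proof.
apply/conj_invariantE => x y z t D; rewrite /cj ev_tr /inv_trace.
have {}D : x%:MP * t%:MP = 1 + y%:MP * z%:MP :> S.
  by rewrite -!mpolyCM -mpolyC1 -mpolyCD -D subrK.
ring: D.
Qed.

Lemma dt_inv : dt \in @conj_invariant K.
Proof.
apply/conj_invariantE => x y z t D; rewrite /cj ev_dt /inv_det.
have {}D : x%:MP * t%:MP = 1 + y%:MP * z%:MP :> S.
  by rewrite -!mpolyCM -mpolyC1 -mpolyCD -D subrK.
ring: D.
Qed.

(** P1 is the polar form of det at X and at the matrix of the q-th powers of its entries, on which G
    acts by the same formulas because Frobenius fixes K. *)
Lemma P1_inv : P1 \in @conj_invariant K.
Proof.
apply/conj_invariantE => x y z t D; rewrite /cj ev_P1 /inv_P1det.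
have {}D : x%:MP * t%:MP = 1 + y%:MP * z%:MP :> S.
  by rewrite -!mpolyCM -mpolyC1 -mpolyCD -D subrK.
rewrite !(frobE (@mpolyC 4 K)).
move: (va ^+ q) (vb ^+ q) (vc ^+ q) (vd ^+ q) => aq bq cq dq.
ring: D.
Qed.

Lemma sw_tr : sw tr = tr.
Proof. by rewrite /sw ev_tr addrC. Qed.

Lemma sw_dt : sw dt = dt.
Proof. by rewrite /sw ev_dt mulrC. Qed.

Lemma sw_P1 : sw P1 = P1.
Proof. rewrite /sw ev_P1 /inv_P1det; ring. Qed.

Lemma tr_homog : tr \is 1.-homog.
Proof. by rewrite rpredD // var_homog. Qed.

Lemma dt_homog : dt \is 2.-homog.
Proof. by rewrite rpredB // -[2%N]/(1 + 1)%N dhomogM // var_homog. Qed.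

Lemma P1_homog : P1 \is q.+1.-homog.
Proof.
have h1 (i j : 'I_4) : ('X_i ^+ q * 'X_j : S) \is q.+1.-homog.
  rewrite -[q.+1]addn1; apply: dhomogM; last exact: var_homog.
  by have := dhomogMn q (var_homog K i); rewrite mul1n.
have h2 (i j : 'I_4) : ('X_i * 'X_j ^+ q : S) \is q.+1.-homog by rewrite mulrC.
by rewrite /inv_P1det /= rpredB ?rpredB ?rpredD ?h1 ?h2.
Qed.

Definition jac g := jacobian [tuple tr; dt; P1; g].

Lemma mderiv_var (i j : 'I_4) : ('X_i : S)^`M(j) = (i == j)%:R.
Proof.
rewrite mderivX mnm1E; case: eqP => [->|_]; last by rewrite scale0r.
rewrite scale1r (_ : (U_(j) - U_(j))%MM = 0%MM) ?mpolyX0 //.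
by apply/mnmP=> k; rewrite mnmBE mnm0E subnn.
Qed.

(** Since q = 0 in K, the q-th powers have zero derivatives, and the row of P1 consists of the q-th
    powers of the entries of the row of det. *)
Lemma jac_rows g (M := \matrix_(i < 4, j < 4) (tnth [tuple tr; dt; P1; g] i)^`M(j))
    (r := fun i => [:: M (inord i) (inord 0); M (inord i) (inord 1);
                      M (inord i) (inord 2); M (inord i) (inord 3)]) :
  [/\ r 0%N = [:: 1; 0; 0; 1], r 1%N = [:: vd; - vc; - vb; va],
      r 2%N = [:: vd ^+ q; - vc ^+ q; - vb ^+ q; va ^+ q]
    & r 3%N = [:: g^`M(inord 0); g^`M(inord 1); g^`M(inord 2); g^`M(inord 3)]].
Proof.
have eqo i j : (i < 4)%N -> (j < 4)%N -> (inord i == inord j :> 'I_4) = (i == j).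
  by move=> i4 j4; rewrite -val_eqE /= !inordK.
have q0 : q%:R = 0 :> S := card_eq0 (@mpolyC 4 K).
rewrite /r /M !mxE !(tnth_nth 0) /= !inordK //= /inv_trace /inv_det /inv_P1det.
rewrite !(mderivD, mderivN, mderivM, mderivXn, q0, mul0r, mulr0) !mderiv_var !eqo //=.
by split; congr [:: _; _; _; _]; ring.
Qed.

Lemma jacE g : jac g =
  let gi i := g^`M(inord i) in
  (- vc * (- vb ^+ q * gi 3%N - va ^+ q * gi 2%N)
   + vb * (- vc ^+ q * gi 3%N - va ^+ q * gi 1%N)
   + va * (- vc ^+ q * gi 2%N + vb ^+ q * gi 1%N))
 - (vd * (- vc ^+ q * gi 2%N + vb ^+ q * gi 1%N)
    + vc * (vd ^+ q * gi 2%N + vb ^+ q * gi 0%N)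
    - vb * (vd ^+ q * gi 1%N + vc ^+ q * gi 0%N)).
Proof.
have [[e00 e01 e02 e03] [e10 e11 e12 e13] [e20 e21 e22 e23] [e30 e31 e32 e33]] := jac_rows g.
rewrite /jac /jacobian det4 e00 e01 e02 e03 e10 e11 e12 e13 e20 e21 e22 e23 e30 e31 e32 e33.
rewrite /=; ring.
Qed.

End Invariants.

Lemma mderiv_homog (n : nat) (R : comNzRingType) d (p : {mpoly R[n]}) i :
  p \is d.+1.-homog -> p^`M(i) \is d.-homog.
Proof.
move=> /dhomogP hp; apply/dhomogP => m; rewrite mcoeff_msupp mcoeff_deriv => H.
have /hp /= : (m + U_(i))%MM \in msupp p.
  by rewrite mcoeff_msupp; apply: contra_neq H => ->; rewrite mul0rn.
by rewrite mdegD mdeg1 addn1 => -[].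
Qed.

Lemma quadratic_extension (K : finFieldType) (delta : K) :
  irreducible_poly ('X^2 + delta%:P) ->
  exists (L : finFieldType) (iota : {rmorphism K -> L}) (w : L),
    [/\ w ^+ 2 = - iota delta, forall x, exists u v, x = iota u + iota v * w
      & #|L| = (#|K| ^ 2)%N].
Proof.
set h := 'X^2 + _ => hi.
have sh : size h = 3%N by rewrite size_addl size_polyXn // size_polyC; case: eqP.
have hm : h \is monic.
  by rewrite monicE lead_coefDl ?lead_coefXn // size_polyXn size_polyC; case: eqP.
have hI : monic_irreducible_poly h by split.
have hE : mk_monic h = h by rewrite /mk_monic sh hm.
pose f : {rmorphism {poly K} -> {poly %/ h}} := in_qpoly h.
have fh : f h = 0.
  by apply: val_inj; rewrite /= hE Pdiv.RingMonic.rmodpp.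
pose L : finFieldType := {poly %/ h with hI}.
exists L, (f \o polyC), (f 'X); split; last by rewrite card_qfpoly sh.
  apply/eqP; rewrite -addr_eq0 /= -rmorphXn /=.
  by have := fh; rewrite /h rmorphD /= => ->.
move=> x; pose p : {poly K} := val (x : {poly %/ h}); exists p`_0, p`_1.
have sp : (size p <= 2)%N by rewrite -ltnS; apply: leq_trans (size_mk_monic _) _; rewrite hE sh.
rewrite /= -rmorphM -rmorphD /=.
have -> : (p`_0)%:P + (p`_1)%:P * 'X = p.
  apply/polyP => i; rewrite coefD coefMX !coefC.
  by case: i => [|[|i]] /=; rewrite ?addr0 ?add0r // nth_default ?(leq_trans sp).
by apply: val_inj; symmetry; apply: in_qpoly_small; rewrite hE sh ltnS.
Qed.

Lemma exists_prim_root (L : finFieldType) : exists z : L, (#|L|.-1).-primitive_root z.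
Proof.
have c1 : (0 < #|L|.-1)%N.
  by rewrite -(cardC1 (0 : L)); apply/card_gt0P; exists 1; rewrite !inE oner_neq0.
have : has (#|L|.-1).-primitive_root (enum (predC1 (0 : L))).
  apply: has_prim_root => //.
  - apply/allP => x; rewrite mem_enum inE => x0; rewrite unity_rootE.
    have := expf_card x; rewrite -{1}[#|L|]prednK; last by apply: leq_trans c1 (leq_pred _).
    by rewrite exprS => E; apply/eqP/(mulfI x0); rewrite mulr1.
  - exact: enum_uniq.
  - by rewrite -cardE cardC1.
by case/hasP => z _ zp; exists z.
Qed.

Section Jacobian.
Variables (K : finFieldType) (l n : nat) (delta : K).
Hypothesis charl : l \in [pchar K].
Hypothesis cardK : #|K| = (l ^ n)%N.
Hypothesis n_gt0 : (0 < n)%N.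
Hypothesis two_neq0 : (2%:R : K) != 0.
Hypothesis irr : forall x : K, x ^+ 2 + delta != 0.
Local Notation S := {mpoly K[4]}.
Local Notation q := #|K|.
Local Notation tr := (inv_trace K).
Local Notation dt := (inv_det K).
Local Notation P1 := (inv_P1det K).
Implicit Types (p r g : S) (x y z t A B C k : K).

Lemma jac_sub (e f g h : S) r :
    sub e f g h tr = tr -> sub e f g h dt = dt -> sub e f g h P1 = P1 -> sub e f g h r = r ->
  jac r = sub e f g h (jac r) *
    \det (\matrix_(i < 4, j < 4) (tnth [tuple e; f; g; h] i)^`M(j)).
Proof.
move=> E1 E2 E3 E4; rewrite {1}/jac.
have -> : [tuple tr; dt; P1; r] =
    [tuple tnth [tuple tr; dt; P1; r] i \mPo [tuple e; f; g; h] | i < 4].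
  apply: eq_from_tnth => i; rewrite tnth_mktuple.
  by elim/ord4_ind: i; rewrite !(tnth_nth 0) /= inordK // [LHS]/=; symmetry.
exact: jacobian_comp.
Qed.

Lemma mderiv_linear p i : p \is 1.-homog -> exists x, p^`M(i) = x%:MP.
Proof. by move=> hp; apply/dhomog0_const/mderiv_homog. Qed.

Lemma det_linear (u : 4.-tuple S) : (forall i, tnth u i \is 1.-homog) ->
  exists x, \det (\matrix_(i < 4, j < 4) (tnth u i)^`M(j)) = x%:MP.
Proof.
move=> hu; pose M := \matrix_(i < 4, j < 4) ((tnth u i)^`M(j))@_0.
exists (\det M); rewrite -det_map_mx; congr (\det _); apply/matrixP => i j.
have [x Ex] := mderiv_linear j (hu i).
by rewrite !mxE Ex mcoeffC eqxx mulr1.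
Qed.

(** A conjugation is a linear substitution, so its Jacobian determinant is a constant, and the chain
    rule makes [jac r] a semi-invariant. *)
Lemma jac_inv r : r \in @conj_invariant K -> jac r \in @conj_invariant K.
Proof.
move=> /conj_invariantE ri; apply: (semi_invariant charl) => x y z t D.
have tri := (conj_invariantE _).1 (tr_inv K) _ _ _ _ D.
have dti := (conj_invariantE _).1 (dt_inv K) _ _ _ _ D.
have P1i := (conj_invariantE _).1 (P1_inv charl cardK two_neq0) _ _ _ _ D.
have := jac_sub tri dti P1i (ri _ _ _ _ D).
set u := [tuple _; _; _; _]; have [|c ->] := @det_linear u.
  elim/ord4_ind; rewrite (tnth_nth 0) /= inordK //=;
  by rewrite rpredD // mulrC cst_mul_homog // rpredB // cst_mul_homog // var_homog.
rewrite -/(cj x y z t (jac r)) mulrC => E; have [c0|c0] := eqVneq c 0.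
  exists 0; rewrite E c0 mpolyC0 !mul0r; exact: rmorph0.
by exists c^-1; rewrite [in RHS]E mulrA -mpolyCM mulVf // mpolyC1 mul1r.
Qed.

Lemma sw_jac r : sw r = r -> sw (jac r) = - jac r.
Proof.
move=> swr; have := jac_sub (sw_tr K) (sw_dt K) (sw_P1 K) swr.
rewrite -/(sw (jac r)) det4 !mxE !(tnth_nth 0) /= !inordK //= !mderiv_var.
have eqo i j : (i < 4)%N -> (j < 4)%N -> (inord i == inord j :> 'I_4) = (i == j).
  by move=> i4 j4; rewrite -val_eqE /= !inordK.
by rewrite !eqo //=; move: (sw (jac r)) => X ->; ring.
Qed.

Lemma jac_homog d r : r \is d.+1.-homog -> jac r \is (q + d.+1).-homog.
Proof.
move=> hr; have hd i := mderiv_homog i hr.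
have h1 (i j k : 'I_4) : ('X_i : S) * ('X_j ^+ q * r^`M(k)) \is (q + d.+1).-homog.
  rewrite addnS -addSn -[q.+1]add1n -addnA.
  apply: dhomogM; first exact: var_homog.
  apply: dhomogM => //; by have := dhomogMn q (var_homog K j); rewrite mul1n.
have h2 (i j k : 'I_4) : - ('X_i : S) * (- 'X_j ^+ q * r^`M(k)) \is (q + d.+1).-homog.
  by rewrite !mulNr mulrN opprK.
have h3 (i j k : 'I_4) : ('X_i : S) * (- 'X_j ^+ q * r^`M(k)) \is (q + d.+1).-homog.
  by rewrite mulNr mulrN rpredN.
have h4 (i j k : 'I_4) : - ('X_i : S) * ('X_j ^+ q * r^`M(k)) \is (q + d.+1).-homog.
  by rewrite mulNr rpredN.
rewrite (jacE charl cardK n_gt0) /= !(mulrDr, mulrBr, mulrN).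
by rewrite !(rpredD, rpredB, rpredN) ?h1 ?h2 ?h3 ?h4.
Qed.

End Jacobian.

(** * The quadratic extension and the point X0 *)

Section Point.
Variables (K : finFieldType) (l n : nat) (delta : K).
Hypothesis charl : l \in [pchar K].
Hypothesis cardK : #|K| = (l ^ n)%N.
Hypothesis n_gt0 : (0 < n)%N.
Hypothesis two_neq0 : (2%:R : K) != 0.
Hypothesis irr : forall x : K, x ^+ 2 + delta != 0.
Variables (L : finFieldType) (iota : {rmorphism K -> L}) (w : L).
Hypothesis w2 : w ^+ 2 = - iota delta.
Hypothesis Lgen : forall x, exists u v, x = iota u + iota v * w.
Hypothesis cardL : #|L| = (#|K| ^ 2)%N.
Local Notation S := {mpoly K[4]}.
Local Notation q := #|K|.
Local Notation dt := (inv_det K).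
Local Notation P1 := (inv_P1det K).
Implicit Types (p r g : S) (x y z t A B C k : K).

Local Notation m := #|@hsys K|.

Lemma cardK_m : q = (m.*2).+1.
Proof. exact: card_half two_neq0. Qed.

Lemma m_gt0 : (0 < m)%N.
Proof.
apply/card_gt0P; have [h|h] := boolP (hsys (1 : K)); first by exists 1.
by exists (-1); rewrite -topredE /= halfN ?oner_neq0.
Qed.

Lemma cardL_m : (#|L|.-1 = m * (q.+1).*2)%N.
Proof. by rewrite cardL cardK_m -!addnn; nia. Qed.

(** For a generator z of the multiplicative group of [L], of order q^2 - 1 = 2 m (q + 1), the power
    y = z^m has order 2 (q + 1). *)
Lemma torus_element : exists y : L, y ^+ q.+1 = -1 /\
  forall d, y ^+ (2 * d) = 1 -> (q.+1 %| d)%N.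
Proof.
have [z zp] := exists_prim_root L.
have zE d : z ^+ d = 1 -> (m * (q.+1).*2 %| d)%N.
  by rewrite -cardL_m (prim_order_dvd zp) => ->.
exists (z ^+ m); split=> [|d].
  rewrite -exprM; have : (z ^+ (m * q.+1)) ^+ 2 == 1.
    by rewrite -exprM -mulnA muln2 -cardL_m (prim_expr_order zp).
  rewrite -subr_eq0 subr_sqr_1 mulf_eq0 subr_eq0 addr_eq0 => /orP[|/eqP//].
  move=> /eqP/zE; rewrite dvdn_pmul2l ?m_gt0 // => /dvdn_leq; rewrite -addnn; lia.
rewrite -exprM => /zE; rewrite dvdn_pmul2l ?m_gt0 // -muln2 mulnC.
by rewrite dvdn_pmul2l.
Qed.

Lemma w_neq0 : w != 0.
Proof.
apply: contra_eq_neq w2 => ->; rewrite expr0n eq_sym oppr_eq0 fmorph_eq0.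
exact: delta_neq0 irr.
Qed.

Lemma w_not_in_K u v : iota u + iota v * w = 0 -> u = 0 /\ v = 0.
Proof.
move=> E; have v0 : v = 0.
  apply/eqP; apply: contraT => v0; have := irr (u / v).
  rewrite -(fmorph_eq0 iota) rmorphD rmorphXn rmorphM fmorphV /=.
  have -> : iota u = - (iota v * w) by apply/eqP; rewrite -addr_eq0 E.
  by rewrite mulNr mulrAC mulfV ?fmorph_eq0 // mul1r sqrrN w2 addNr eqxx.
by move/eqP: E; rewrite v0 rmorph0 mul0r addr0 fmorph_eq0 => /eqP.
Qed.

(** Since w^2 is in K, w^q is w or -w; in the first case Frobenius would fix all of [L], against the
    order q^2 - 1 of a generator. *)
Lemma w_frob : w ^+ q = - w.
Proof.
have : (w ^+ q) ^+ 2 == w ^+ 2.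
  by rewrite exprAC w2 (frobN two_neq0) (frobC iota).
rewrite eqf_sqr => /orP[/eqP E|/eqP//].
have [z zp] := exists_prim_root L.
have [u [v Ez]] := Lgen z.
have zq : z ^+ q = z.
  by rewrite {1}Ez (frobD charl cardK iota) frobM !(frobC iota) E.
have z0 : z != 0.
  apply/eqP => z0; have := prim_expr_order zp; rewrite z0 expr0n cardL_m.
  have := m_gt0; case: (m) => // k _; rewrite doubleS /= => /eqP; by rewrite eq_sym oner_eq0.
have : z ^+ q.-1 = 1.
  apply: (mulfI z0); rewrite -exprS prednK ?mulr1 // cardK_m //.
move/eqP; rewrite -(prim_order_dvd zp) cardL_m cardK_m /=.
move/dvdn_leq; rewrite double_gt0 => /(_ m_gt0); have := m_gt0; rewrite -!addnn; nia.
Qed.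

Lemma frob_fixed (x : L) : x ^+ q = x -> exists u, x = iota u.
Proof.
have [u [v ->]] := Lgen x; rewrite (frobD charl cardK iota) frobM !(frobC iota) w_frob.
move=> E; exists u; have : iota 0 + iota (2%:R * v) * w = 0.
  rewrite rmorph0 rmorphM rmorph_nat; move/eqP: E; rewrite -subr_eq0 => /eqP E.
  transitivity (- (iota u + iota v * - w - (iota u + iota v * w))); first by ring.
  by rewrite E oppr0.
move/w_not_in_K => [_ /eqP]; rewrite mulf_eq0 (negPf two_neq0) => /eqP->.
by rewrite rmorph0 mul0r addr0.
Qed.

(* Evaluation at X0 = [w, delta; 1, -w], where trace and det vanish and P^1(det) does
   not. *)
Definition eval_pt : S -> L := ev iota w (iota delta) 1 (- w).
HB.instance Definition _ := GRing.RMorphism.on eval_pt.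

Lemma ev0_dt : eval_pt dt = 0.
Proof. by rewrite /eval_pt ev_dt mulrN -expr2 w2 opprK mulr1 subrr. Qed.

Lemma ev0_P1 : eval_pt P1 = iota (- 4%:R * delta).
Proof.
rewrite /eval_pt ev_P1 (frobN two_neq0) w_frob (frobC iota) expr1n rmorphM rmorphN rmorph_nat.
transitivity (w ^+ 2 + w ^+ 2 - iota delta - iota delta); first by ring.
by rewrite w2; ring.
Qed.

Lemma ev0_P1_neq0 : - 4%:R * delta != 0.
Proof.
have -> : - 4%:R * delta = - (2%:R * (2%:R * delta)) by ring.
by rewrite oppr_eq0 !mulf_neq0 ?(delta_neq0 irr).
Qed.

(** The value at X0 is (B delta + C) + 2 A w. If it vanishes, then A = 0 and C = -B delta, and the
    norm gives B^2 = 1. *)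
Lemma ev0_lft N : N \in ells delta -> lft N <> lf 0 1 (- delta) -> lft N <> - lf 0 1 (- delta) ->
  eval_pt (lft N) != 0.
Proof.
case: N => [[A B] C]; rewrite mem_ells => /andP[hB /eqP Nk] ne1 ne2.
apply/eqP; rewrite /eval_pt /lft ev_lf => E.
have [|E1 E2] := @w_not_in_K (B * delta + C) (2%:R * A).
  by rewrite -[RHS]E rmorphD !rmorphM rmorph_nat; ring.
have A0 : A = 0 by move/eqP: E2; rewrite mulf_eq0 (negPf two_neq0) => /eqP.
have EC : C = - (B * delta) by apply/eqP; rewrite -addr_eq0 addrC E1.
move: Nk; rewrite /nrm A0 EC expr0n /= => Nk.
have : B ^+ 2 == 1.
  by apply/eqP/(mulIf (delta_neq0 irr)); rewrite mul1r -[RHS]Nk; ring.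
rewrite -subr_eq0 subr_sqr_1 mulf_eq0 subr_eq0 addr_eq0 => /orP[]/eqP EB.
  by apply: ne1; rewrite /lft /= A0 EC EB mul1r.
by apply: ne2; rewrite -lfN /lft /= A0 EC EB oppr0 mulN1r !opprK.
Qed.

(** Exactly one factor of [g0] vanishes at X0, so the gradient of the product there is a nonzero
    multiple of (0, 1, -delta, 0), the gradient of that factor up to sign. The determinant at X0 is
    then a nonzero multiple of 8 delta w. *)
Lemma jac_neq0 k : k != 0 -> jac (k%:MP * g0 delta) != 0.
Proof.
move=> k0; pose N0 : K * K * K := (0, 1, - delta).
set L0 := lf 0 1 (- delta).
have [N Ns eN] : exists2 N, N \in ells delta & lft N = L0 \/ lft N = - L0.
  have [||N1|N1] := @ells_complete K two_neq0 delta N0.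
  - exact: oner_neq0.
  - by rewrite /nrmt /nrm /=; ring.
  - by exists N0 => //; left.
  - by exists (oppt N0) => //; right; rewrite lftN.
have lft_inj N1 N2 : lft N1 = lft N2 -> N1 = N2.
  by case: N1 N2 => [[? ?] ?] [[? ?] ?] /lf_inj /= [-> -> ->].
pose R := \prod_(N' <- rem N (ells delta)) lft N'.
have R0 : eval_pt R != 0.
  rewrite rmorph_prod prodf_seq_neq0; apply/allP => N'.
  rewrite mem_rem_uniq ?uniq_ells // inE => /andP[ne N's] /=.
  have ne2 : lft N' != - lft N.
    rewrite -lftN; apply: contraNneq (opp_ells two_neq0 Ns) => /lft_inj <-.
    by [].
  have ne1 : lft N' != lft N by apply: contra_neq ne => /lft_inj.
  by apply: ev0_lft => //; apply/eqP; case: eN ne1 ne2 => ->; rewrite ?opprK.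
have [c c0 Eg] : exists2 c : K, c != 0 & k%:MP * g0 delta = L0 * (c%:MP * R).
  rewrite /g0 (big_rem _ Ns) /= -/R; case: eN => ->.
    by exists k => //; ring.
  by exists (- k); rewrite ?oppr_eq0 // mpolyCN; ring.
have evL0 : eval_pt L0 = 0.
  by rewrite /L0 /eval_pt ev_lf rmorph0 rmorph1 rmorphN; ring.
have dE i : eval_pt ((k%:MP * g0 delta)^`M(i)) = eval_pt (L0^`M(i)) * (iota c * eval_pt R).
  by rewrite Eg mderivM rmorphD !rmorphM /= evL0 mul0r addr0 /eval_pt ev_C.
have eqo i j : (i < 4)%N -> (j < 4)%N -> (inord i == inord j :> 'I_4) = (i == j).
  by move=> i4 j4; rewrite -val_eqE /= !inordK.
have dL i : L0^`M(i) = (i == inord 1)%:R - delta%:MP * (i == inord 2)%:R.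
  rewrite /L0 /lf mpolyC0 mpolyC1 !mul0r add0r subr0 mul1r mpolyCN mulNr.
  rewrite mderivB mderivM !mderivC mul0r add0r !mderiv_var.
  by rewrite ![_ == i]eq_sym.
have H : eval_pt (jac (k%:MP * g0 delta)) = iota (8%:R * delta * c) * w * eval_pt R.
  rewrite (jacE charl cardK n_gt0) /=.
  move: (dE (inord 0)) (dE (inord 1)) (dE (inord 2)) (dE (inord 3)).
  move: (_^`M(inord 0)) (_^`M(inord 1)) (_^`M(inord 2)) (_^`M(inord 3)) => G0 G1 G2 G3.
  rewrite !dL !eqo //= !mulr0 !mulr1 !subr0 sub0r rmorphN rmorph1 /= /eval_pt ?ev_C ?ev_0 ?ev_1.
  move=> E0 E1 E2 E3; rewrite !evE E0 E1 E2 E3.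
  rewrite (frobN two_neq0) w_frob (frobC iota) expr1n !rmorphM rmorph_nat ?rmorph0; ring.
have : iota (8%:R * delta * c) * w * eval_pt R != 0.
  have -> : 8%:R = 2%:R * (2%:R * 2%:R) :> K by ring.
  by rewrite !mulf_neq0 ?fmorph_eq0 ?mulf_neq0 ?w_neq0 ?(delta_neq0 irr).
by apply: contra_neq => E; rewrite -H E; apply: rmorph0.
Qed.

Lemma ev_scale d (x : L) (a b c e : L) p : p \is d.-homog ->
  ev iota (x * a) (x * b) (x * c) (x * e) p = x ^+ d * ev iota a b c e p.
Proof.
move=> /dhomogP hp; rewrite /mmap mulr_sumr; rewrite !big_seq; apply: eq_bigr => m' /hp <-.
rewrite mulrCA; congr (_ * _); rewrite -[X in x ^+ X]/(mdeg m') mdegE expr_sum /mmap1 -big_split /=.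
apply: eq_bigr => i _; rewrite -exprMn; congr (_ ^+ _).
by elim/ord4_ind: i; rewrite !(tnth_nth 0) /= inordK.
Qed.

Lemma ev_frob (a b c e : L) p :
  (ev iota a b c e p) ^+ q = ev iota (a ^+ q) (b ^+ q) (c ^+ q) (e ^+ q) p.
Proof.
elim/mpoly_alg_ind: p => [x|i|p r IHp IHr|p r IHp IHr].
- by rewrite !ev_C (frobC iota).
- by rewrite !mmapX !mmap1U; elim/ord4_ind: i; rewrite !(tnth_nth 0) /= inordK.
- by rewrite !ev_D (frobD charl cardK iota) IHp IHr.
- by rewrite !ev_M exprMn IHp IHr.
Qed.

End Point.

Lemma rmorph_quotient (R : idomainType) (f : {rmorphism R -> R}) (r a : R) :
  a != 0 -> f a = a -> f (r * a) = r * a -> f r = r.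
Proof. by move=> a0 fa; rewrite rmorphM fa => /(mulIf a0). Qed.

(** * Generation of the symmetric invariants *)

Section Generation.
Variables (K : finFieldType) (l n : nat) (delta : K).
Hypothesis charl : l \in [pchar K].
Hypothesis cardK : #|K| = (l ^ n)%N.
Hypothesis n_gt0 : (0 < n)%N.
Hypothesis two_neq0 : (2%:R : K) != 0.
Hypothesis irr : forall x : K, x ^+ 2 + delta != 0.
Variables (L : finFieldType) (iota : {rmorphism K -> L}) (w : L).
Hypothesis w2 : w ^+ 2 = - iota delta.
Hypothesis Lgen : forall x, exists u v, x = iota u + iota v * w.
Hypothesis cardL : #|L| = (#|K| ^ 2)%N.
Local Notation S := {mpoly K[4]}.
Local Notation q := #|K|.
Local Notation va := (va K).
Local Notation vb := (vb K).
Local Notation vc := (vc K).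
Local Notation vd := (vd K).
Local Notation tr := (inv_trace K).
Local Notation dt := (inv_det K).
Local Notation P1 := (inv_P1det K).
Local Notation m := #|@hsys K|.
Local Notation ev0 := (eval_pt delta iota w).
Implicit Types (p r g : S) (x y z t A B C k u v : K).

Definition xl : S := (2%:R^-1)%:MP * (va - vd).
Definition yl : S := (2%:R^-1)%:MP * ((delta^-1)%:MP * vb + vc).

(* E3 projects X to its traceless part, and E2 further to the plane orthogonal
   to the matrix [0, -delta; 1, 0]. *)
Definition E3 : S -> S := sub xl vb vc (- xl).
Definition E2 : S -> S := sub xl (delta%:MP * yl) yl (- xl).
HB.instance Definition _ := GRing.RMorphism.on E3.
HB.instance Definition _ := GRing.RMorphism.on E2.

Let hlf (X Y : S) : X = Y + Y -> (2%:R^-1)%:MP * X = Y.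
Proof.
move=> ->; rewrite -mulr2n -[Y *+ 2]mulr_natl mulrA -mpolyC_nat -mpolyCM mulVf //.
by rewrite mpolyC1 mul1r.
Qed.
Let hlfN (X Y : S) : X = - (Y + Y) -> - ((2%:R^-1)%:MP * X) = Y.
Proof. by move=> E; rewrite (@hlf X (- Y)) ?opprK // E opprD. Qed.
Let hlfd (X Y : S) : delta%:MP * X = Y + Y -> delta%:MP * ((2%:R^-1)%:MP * X) = Y.
Proof. by move=> E; rewrite mulrCA; apply: hlf. Qed.
Let idE : exists2 i : S, (delta^-1)%:MP = i & delta%:MP * i = 1.
Proof. by exists (delta^-1)%:MP; rewrite // -mpolyCM mulfV ?mpolyC1 ?(delta_neq0 irr). Qed.

Let vaE : va = vd + xl + xl.
Proof.
rewrite -addrA; apply/eqP; rewrite addrC -subr_eq; apply/eqP.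
have : xl = xl by []; rewrite {1}/xl => <-.
by rewrite -mulrDl -mpolyCD -[X in X + X]mulr1 -mulrDr mulVf // mpolyC1 mul1r.
Qed.

Let beta : S := (delta^-1)%:MP * vb.
Let vbE : vb = delta%:MP * beta.
Proof. by rewrite /beta mulrA -mpolyCM mulfV ?(delta_neq0 irr) // mpolyC1 mul1r. Qed.
Let vcE : vc = yl + yl - beta.
Proof.
rewrite /yl -mulrDl -mpolyCD -[X in X + X]mulr1 -mulrDr mulVf // mpolyC1 mul1r.
by rewrite /beta [_ + vc]addrC addrK.
Qed.

Lemma xl_homog : xl \is 1.-homog.
Proof. by rewrite cst_mul_homog // rpredB // var_homog. Qed.

Lemma yl_homog : yl \is 1.-homog.
Proof. by rewrite cst_mul_homog // rpredD ?cst_mul_homog ?var_homog. Qed.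

Lemma E3_homog d p : p \is d.-homog -> E3 p \is d.-homog.
Proof. by apply: sub_homog; rewrite ?rpredN ?xl_homog ?var_homog. Qed.

Lemma E2_homog d p : p \is d.-homog -> E2 p \is d.-homog.
Proof.
have hx := xl_homog; have hy := yl_homog.
by apply: sub_homog; rewrite ?rpredN // mul_mpolyC rpredZ.
Qed.

Lemma E3_xl : E3 xl = xl.
Proof. by rewrite /E3 {4}/xl !evE /=; apply: hlf; rewrite opprK. Qed.

Lemma E2_xl : E2 xl = xl.
Proof. by rewrite /E2 {3}/xl !evE /=; apply: hlf; rewrite opprK. Qed.

Lemma E2_yl : E2 yl = yl.
Proof.
rewrite /E2 {3}/yl !evE /=; apply: hlf; have [i -> Hi] := idE.
by ring: Hi.
Qed.

Lemma E3_id p : E3 (E3 p) = E3 p.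
Proof.
rewrite /E3 ev_sub; apply: ev_eq; rewrite ?ev_N;
  [exact: E3_xl|exact: ev_vb|exact: ev_vc|by congr (- _); apply: E3_xl].
Qed.

Lemma E2_id p : E2 (E2 p) = E2 p.
Proof.
rewrite /E2 ev_sub; apply: ev_eq.
- exact: E2_xl.
- by rewrite ev_M ev_C; congr (_ * _); apply: E2_yl.
- exact: E2_yl.
- by rewrite ev_N; congr (- _); apply: E2_xl.
Qed.

Lemma sw_E3 p : sw (E3 p) = E3 (sw p).
Proof. by rewrite /sw /E3 !ev_sub; apply: ev_eq; rewrite /xl !evE; ring. Qed.

Lemma sw_E2 p : sw (E2 p) = E2 (sw p).
Proof. by rewrite /sw /E2 !ev_sub; apply: ev_eq; rewrite /xl /yl !evE; ring. Qed.

Lemma cj_E3 x y z t p : x * t - y * z = 1 -> cj x y z t (E3 p) = E3 (cj x y z t p).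
Proof.
move=> D; have {}D : x%:MP * t%:MP = 1 + y%:MP * z%:MP :> S.
  by rewrite -!mpolyCM -mpolyC1 -mpolyCD -D subrK.
rewrite /cj /E3 !ev_sub; apply: ev_eq; rewrite ?[in LHS]/xl !evE /= ?vaE.
- by apply: hlf; ring: D.
- by ring: D.
- by ring: D.
- by apply: hlfN; ring: D.
Qed.

(* An isometry of the plane of [E2], for which X0 is an eigenvector: when
   u^2 + delta v^2 = -1 it gives elements of the stabilizer of the plane in the group
   generated by the action and [sw]. *)
Definition T u v : S -> S := @sw K \o cj u (- (delta * v)) (- v) (- u).
HB.instance Definition _ u v := GRing.RMorphism.on (T u v).

Lemma T_sub u v p (U : S := u%:MP) (V : S := v%:MP) (d : S := delta%:MP) :
  T u v p = sub ((d * V * vc - U * vd) * U - (d * V * va - U * vb) * V)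
                (- (d * V * vc - U * vd) * (d * V) - (d * V * va - U * vb) * U)
                ((U * vc + V * vd) * U - (U * va + V * vb) * V)
                (- (U * vc + V * vd) * (d * V) - (U * va + V * vb) * U) p.
Proof.
rewrite /T [LHS]/= /sw /cj ev_sub /U /V /d.
by apply: ev_eq; rewrite !evE /= !(mpolyCN, mpolyCM); ring.
Qed.

Lemma T_E2 u v p : u ^+ 2 + delta * v ^+ 2 = -1 -> T u v (E2 p) = E2 (T u v p).
Proof.
move=> D; have {}D : u%:MP ^+ 2 = -1 - delta%:MP * v%:MP ^+ 2 :> S.
  by rewrite -!rmorphXn /= -mpolyC1 -mpolyCN -mpolyCM -mpolyCB -D addrK.
rewrite !T_sub /E2 !ev_sub; have [i Ei Hi] := idE; apply: ev_eq.
- rewrite [in LHS]/xl !evE /= vaE vbE vcE; apply: hlf; ring: D.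
- rewrite ev_M [in LHS]/yl !evE /= Ei vaE vbE vcE; apply: hlfd; ring: D Hi.
- rewrite [in LHS]/yl !evE /= Ei vaE vbE vcE; apply: hlf; ring: D Hi.
- rewrite ev_N [in LHS]/xl !evE /= vaE vbE vcE; apply: hlfN; ring: D.
Qed.

Lemma ev0_xl : ev0 xl = w.
Proof.
rewrite /eval_pt /xl !evE opprK -mulr2n -[w *+ 2]mulr_natl mulrA -(rmorph_nat iota) -rmorphM.
by rewrite mulVf // rmorph1 mul1r.
Qed.

Lemma ev0_yl : ev0 yl = 1.
Proof.
rewrite /eval_pt /yl !evE -rmorphM mulVf ?(delta_neq0 irr) // rmorph1 -[1 + 1]/(2%:R).
by rewrite -(rmorph_nat iota) -rmorphM mulVf // rmorph1.
Qed.

Lemma ev0_E2 p : ev0 (E2 p) = ev0 p.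
Proof.
rewrite /eval_pt /E2 ev_sub; apply: ev_eq.
- exact: ev0_xl.
- by rewrite ev_M ev_C -[RHS]mulr1; congr (_ * _); apply: ev0_yl.
- exact: ev0_yl.
- by rewrite ev_N; congr (- _); apply: ev0_xl.
Qed.

(** Frobenius sends w to -w, so it moves X0 to its image under the exchange of a and d. *)
Lemma ev0_sw p : ev0 (sw p) = (ev0 p) ^+ q.
Proof.
rewrite /eval_pt (ev_frob charl cardK) ev_sub !evE (frobN two_neq0).
by rewrite (w_frob charl cardK n_gt0 two_neq0 w2 Lgen cardL) opprK (frobC iota) expr1n.
Qed.

Lemma ev0_T u v d p : p \is d.-homog ->
  ev0 (T u v p) = ((iota u - iota v * w) ^+ 2) ^+ d * ev0 p.
Proof.
move=> hp; rewrite /eval_pt -(ev_scale _ _ _ _ _ _ hp) T_sub ev_sub.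
by apply: ev_eq; rewrite !evE /=; ring: w2.
Qed.

Definition normform : S := xl ^+ 2 + delta%:MP * yl ^+ 2.

Lemma E2_dt : E2 dt = - normform.
Proof. by rewrite /E2 ev_dt /normform; ring. Qed.

Lemma E2_normform : E2 normform = normform.
Proof. by rewrite -[normform]opprK -E2_dt rmorphN /= E2_id. Qed.

Lemma normform_neq0 : normform != 0.
Proof.
apply/eqP => E; have /eqP := congr1 (ev idfun 2%:R 0 0 0) E.
rewrite /normform /xl /yl !evE /=.
by rewrite subr0 mulVf // !(mulr0, addr0) expr1n expr0n /= mulr0 addr0 oner_eq0.
Qed.

(** Modulo the norm form, xl^2 = -delta yl^2, which removes all powers of [xl] above the first. *)
Lemma plane_residue_mono d (mm : 'X_{1..4}) : mdeg mm = d.+1 -> exists x y (z : S),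
  E2 'X_[mm] = z * normform + (x%:MP * yl + y%:MP * xl) * yl ^+ d.
Proof.
have var i : exists x y, E2 'X_i = x%:MP * yl + y%:MP * xl.
  elim/ord4_ind: i.
  - by exists 0, 1; rewrite /E2 ev_va mpolyC0 mpolyC1; ring.
  - by exists delta, 0; rewrite /E2 ev_vb mpolyC0; ring.
  - by exists 1, 0; rewrite /E2 ev_vc mpolyC0 mpolyC1; ring.
  - by exists 0, (-1); rewrite /E2 ev_vd mpolyC0 mpolyCN mpolyC1; ring.
elim: d mm => [|d IHd] mm dm.
  have /eqP/mdeg1P[i /eqP ->] := dm; have [x [y ->]] := var i.
  by exists x, y, 0; ring.
have [i mi] : exists i, mm i != 0%N.
  apply: NNPP => H; have : mdeg mm = 0%N.
    rewrite mdegE big1 // => i _; apply/eqP; apply: NNPP => /negP mi.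
    by apply: H; exists i.
  by rewrite dm.
have Em : (mm - U_(i) + U_(i))%MM = mm by rewrite submK // lep1mP.
have [|x [y [z Ez]]] := IHd (mm - U_(i))%MM.
  by have := congr1 (@mdeg 4) Em; rewrite mdegD mdeg1 dm addn1 => -[].
have [x' [y' Ei]] := var i.
rewrite -Em mpolyXD rmorphM /= Ez Ei.
exists (x * x' - delta * y * y'), (x * y' + y * x').
exists (z * (x'%:MP * yl + y'%:MP * xl) + y%:MP * y'%:MP * yl ^+ d).
by rewrite /normform !(mpolyCB, mpolyCD, mpolyCM) [yl ^+ d.+1]exprS; ring.
Qed.

Lemma plane_residue d p : p \is d.+1.-homog -> exists x y (z : S),
  E2 p = z * normform + (x%:MP * yl + y%:MP * xl) * yl ^+ d.
Proof.
move=> /dhomogP hp; rewrite [p]mpolyE rmorph_sum big_seq /=.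
elim/big_ind: _ => [|r s [x [y [z ->]]] [x' [y' [z' ->]]]|mm /hp /= dm].
- by exists 0, 0, 0; rewrite mpolyC0; ring.
- by exists (x + x'), (y + y'), (z + z'); rewrite !mpolyCD; ring.
have [x [y [z E]]] := plane_residue_mono dm.
exists (p@_mm * x), (p@_mm * y), ((p@_mm)%:MP * z).
by rewrite -mul_mpolyC rmorphM /= E /E2 ev_C /= !mpolyCM; ring.
Qed.

(** At X0, [xl] is w and [yl] is 1, so the residue modulo the norm form takes the value x + y w; as
    w is not in K, its vanishing gives x = y = 0. *)
Lemma plane_vanish d p : p \is d.-homog -> E2 p = p -> ev0 p = 0 ->
  exists r, p = r * E2 dt /\ E2 r = r.
Proof.
move=> hp Ep p0; case: d hp => [|d] hp.
  have [x Ex] := dhomog0_const hp; exists 0; rewrite rmorph0 mul0r; split=> //.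
  move/eqP: p0; rewrite Ex /eval_pt ev_C fmorph_eq0 => /eqP ->.
  by rewrite mpolyC0.
have [x [y [z E]]] := plane_residue hp.
have En : ev0 normform = 0.
  by rewrite -[normform]opprK -E2_dt rmorphN /= ev0_E2 ev0_dt // oppr0.
have [x0 y0] : x = 0 /\ y = 0.
  apply: (w_not_in_K irr w2); rewrite -p0 -Ep E.
  move: ev0_xl ev0_yl En; move: xl yl normform => X Y N EX EY EN.
  rewrite rmorphD !rmorphM /= EN mulr0 add0r rmorphXn rmorphD !rmorphM /= EX EY.
  by rewrite expr1n !mulr1 /eval_pt !ev_C.
have Ep2 : p = E2 z * normform.
  by rewrite -{1}Ep -E2_id E x0 y0 mpolyC0 !mul0r addr0 mul0r addr0 rmorphM /= E2_normform.
exists (- E2 z); rewrite E2_dt {1}Ep2 mulNr mulrN opprK; split=> //.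
by rewrite rmorphN /= E2_id.
Qed.

(** The symmetry of an invariant that is retained on the plane. It is stable under differences and
    exact quotients, as the descent on the degree requires. *)
Definition planar p : Prop := [/\ E2 p = p, sw p = p
  & forall u v, u ^+ 2 + delta * v ^+ 2 = -1 -> T u v p = p].

Lemma planar_E2 p : p \in @conj_invariant K -> sw p = p -> planar (E2 p).
Proof.
move=> /conj_invariantE pinv swp; split; first exact: E2_id.
  by rewrite sw_E2 swp.
move=> u v D; rewrite T_E2 // /T /= pinv ?swp //.
by rewrite -[RHS]opprK -D; ring.
Qed.

Lemma planarB p r : planar p -> planar r -> planar (p - r).
Proof.
move=> [Ep swp Tp] [Er swr Tr]; split=> [||u v D]; rewrite rmorphB /=; congr (_ - _) => //.
  exact: Tp.
exact: Tr.
Qed.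

Lemma planar_quotient p r : r != 0 -> planar r -> planar (p * r) -> planar p.
Proof.
move=> r0 [Er swr Tr] [Epr swpr Tpr]; split.
- exact: rmorph_quotient r0 Er Epr.
- exact: rmorph_quotient r0 swr swpr.
- by move=> u v D; apply: rmorph_quotient r0 (Tr u v D) (Tpr u v D).
Qed.

(* The elements u + v w of norm -1 contain one of order 2 (q + 1), which forces
   q + 1 to divide d. *)
Lemma planar_degree d p : p \is d.-homog -> planar p -> ev0 p != 0 ->
  (q.+1 %| d)%N /\ exists x, ev0 p = iota x.
Proof.
move=> hp [_ swp Tp] p0; split; last first.
  apply: (frob_fixed charl cardK n_gt0 two_neq0 irr w2 Lgen cardL).
  by rewrite -ev0_sw swp.
have [y [yq yd]] := torus_element charl cardK n_gt0 two_neq0 cardL.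
have [u [v Ey]] := Lgen y.
have Eyq : y ^+ q = iota u - iota v * w.
  rewrite Ey (frobD charl cardK iota) frobM !(frobC iota).
  by rewrite (w_frob charl cardK n_gt0 two_neq0 w2 Lgen cardL) mulrN.
have D : u ^+ 2 + delta * v ^+ 2 = -1.
  apply: (fmorph_inj iota); rewrite rmorphN rmorph1 -yq [y ^+ q.+1]exprS Eyq Ey.
  by rewrite rmorphD !rmorphXn rmorphM rmorphXn /=; ring: w2.
apply: yd; have := ev0_T u v hp; rewrite Tp // -{1}[ev0 p]mul1r => /(mulIf p0).
rewrite -Eyq => H.
have : (y ^+ (q * 2 * d)) * y ^+ (2 * d) = 1.
  by rewrite -exprD -mulnA -mulSnr exprM yq exprM sqrrN !expr1n.
by rewrite !exprM -H mul1r.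
Qed.

Variables (g : S) (dg : nat).
Hypothesis hg : g \is dg.-homog.

Definition generators : 'I_4 -> S := tnth [tuple tr; dt; P1; g].
Definition gen_degs : 'I_4 -> nat := tnth [tuple 1%N; 2%N; q.+1; dg].
Local Notation msub := (mmap (@mpolyC 4 K) generators).

Lemma gens_homog i : generators i \is (gen_degs i).-homog.
Proof.
rewrite /generators /gen_degs; elim/ord4_ind: i; rewrite !(tnth_nth 0) ?(tnth_nth 0%N) /= inordK //=.
- exact: tr_homog.
- exact: dt_homog.
- exact: P1_homog.
Qed.

Lemma msubX i : msub 'X_i = nth 0 [:: tr; dt; P1; g] i.
Proof. by rewrite mmapX mmap1U /generators (tnth_nth 0). Qed.

Lemma msub_homog d P : P \is d.-homog for (wdeg gen_degs) -> msub P \is d.-homog.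
Proof. exact: (mmap_homog gens_homog). Qed.

Lemma var_wdeg i : ('X_i : S) \is (gen_degs i).-homog for (wdeg gen_degs).
Proof. by rewrite dhomogX /= wdeg1. Qed.

Lemma plane_generation d p : p \is d.-homog -> planar p ->
  exists P : S, P \is d.-homog for (wdeg gen_degs) /\ p = E2 (msub P).
Proof.
elim/ltn_ind: d p => d IHd p hp plp.
have pldt : planar (E2 dt) by apply: planar_E2; [exact: dt_inv|exact: sw_dt].
have dt0 : E2 dt != 0 by rewrite E2_dt oppr_eq0 normform_neq0.
have vanish r : r \is d.-homog -> planar r -> ev0 r = 0 ->
    exists P : S, P \is d.-homog for (wdeg gen_degs) /\ r = E2 (msub P).
  move=> hr plr r0; have [Er _ _] := plr.
  have [->|rn0] := eqVneq r 0; first by exists 0; rewrite rpred0 !rmorph0.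
  have [s [Es E2s]] := plane_vanish hr Er r0.
  rewrite Es in hr plr rn0 *.
  have [d2 hs] := dhomog_divides hr (E2_homog (dt_homog K)) rn0.
  have pls := planar_quotient dt0 pldt plr.
  have [|P [hP Ps]] := IHd (d - 2)%N _ s hs pls.
    by rewrite ltn_subrL (leq_trans _ d2).
  exists (P * 'X_(inord 1)); split.
    rewrite -(subnK d2); apply: dhomogM hP _.
    by have := var_wdeg (inord 1); rewrite /gen_degs (tnth_nth 0%N) /= inordK.
  by rewrite !rmorphM /= msubX inordK //= -Ps.
have [p0|p0] := eqVneq (ev0 p) 0; first exact: vanish.
have [/dvdnP[k Ek] [x Ex]] := planar_degree hp plp p0.
pose e := - 4%:R * delta : K.
have e0 : e != 0 by apply: ev0_P1_neq0.
have eP1 : ev0 P1 = iota e by rewrite /e (ev0_P1 charl cardK n_gt0 two_neq0 w2 Lgen cardL).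
(* [e] is the value of P1 at X0, so the monomial is made to agree with [p] there; its degree k (q +
   1) is that of [p]. *)
pose M : S := (x / e ^+ k)%:MP * 'X_(inord 2) ^+ k.
have hM : M \is d.-homog for (wdeg gen_degs).
  rewrite /M mul_mpolyC rpredZ // Ek mulnC; apply: dhomogMn.
  by have := var_wdeg (inord 2); rewrite /gen_degs (tnth_nth 0%N) /= inordK.
have EM : msub M = (x / e ^+ k)%:MP * P1 ^+ k.
  by rewrite rmorphM rmorphXn /= mmapC msubX inordK.
have plM : planar (E2 (msub M)).
  apply: planar_E2; rewrite EM.
    by rewrite mul_mpolyC rpredZ // rpredX // (P1_inv charl cardK two_neq0).
  by rewrite rmorphM rmorphXn /= sw_P1 /sw ev_C.
have [|||P [hP EP]] := vanish (p - E2 (msub M)).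
- by rewrite rpredB // E2_homog // msub_homog.
- exact: planarB.
- rewrite rmorphB /= ev0_E2 EM Ex; apply/eqP; rewrite subr_eq0; apply/eqP.
  rewrite /eval_pt ev_M ev_X ev_C -[ev _ _ _ _ _ P1]/(ev0 P1) eP1 -rmorphXn -rmorphM /=.
  by rewrite divfK ?expf_neq0.
exists (P + M); split; first by rewrite rpredD.
by rewrite !rmorphD /= -EP subrK.
Qed.

Lemma E3_tr : E3 tr = 0.
Proof. by rewrite /E3 ev_tr subrr. Qed.

Lemma E3_g0 : E3 (g0 delta) = g0 delta.
Proof.
rewrite rmorph_prod; apply: eq_bigr => N _ /=; rewrite /lft /E3 ev_lf /lf.
by move: (N.1.1) (N.1.2) (N.2) => A B C; rewrite [in RHS]vaE; ring.
Qed.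

Lemma divides_E3 p : E2 p = 0 -> divides (lf 0 1 (- delta)) (E3 p).
Proof.
move=> E2p; rewrite -[E3 p]subr0 -E2p; apply: mmap_congr => i.
have EL : lf 0 1 (- delta) = vb - delta%:MP * vc.
  by rewrite /lf mpolyC0 mpolyC1 mpolyCN; ring.
rewrite EL; have [j Ej Hj] := idE.
elim/ord4_ind: i; rewrite !(tnth_nth 0) /= !inordK //=.
- by rewrite subrr; apply: divides0.
- exists (2%:R^-1)%:MP; symmetry; apply: hlf; rewrite vbE vcE; ring.
- exists (- ((2%:R^-1)%:MP * j)); rewrite mulNr -mulrA; symmetry.
  by apply: hlfN; rewrite vbE vcE; ring: Hj.
- by rewrite subrr; apply: divides0.
Qed.

Lemma divides_tr p : E3 p = 0 -> divides tr p.
Proof.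
move=> E3p; rewrite -[p]subr0 -E3p -{1}[p]sub_id; apply: mmap_congr => i.
elim/ord4_ind: i; rewrite !(tnth_nth 0) /= !inordK //=.
- exists (2%:R^-1)%:MP; symmetry; apply: hlf; rewrite /inv_trace vaE; ring.
- by rewrite subrr; apply: divides0.
- by rewrite subrr; apply: divides0.
- exists (2%:R^-1)%:MP; symmetry; apply: hlf; rewrite /inv_trace vaE; ring.
Qed.

Hypothesis gE : exists2 c : K, c != 0 & g = c%:MP * g0 delta.

Lemma conj_invariant_quotient p r : r != 0 -> r \in @conj_invariant K ->
  p * r \in @conj_invariant K -> p \in @conj_invariant K.
Proof.
move=> r0 /conj_invariantE ri /conj_invariantE pri; apply/conj_invariantE => x y z t D.
exact: rmorph_quotient r0 (ri _ _ _ _ D) (pri _ _ _ _ D).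
Qed.

Lemma tr_neq0 : tr != 0.
Proof.
apply/eqP => /(congr1 (ev idfun 1 0 0 0)) /eqP.
by rewrite ev_tr addr0 rmorph0 oner_eq0.
Qed.

Lemma g_inv : g \in @conj_invariant K.
Proof.
by have [c _ ->] := gE; rewrite mul_mpolyC rpredZ // (g0_inv charl two_neq0).
Qed.

Lemma sw_g : sw g = g.
Proof. by have [c _ ->] := gE; rewrite rmorphM /= sw_g0 /sw ev_C. Qed.

Lemma gens_inv i : generators i \in @conj_invariant K.
Proof.
rewrite /generators; elim/ord4_ind: i; rewrite (tnth_nth 0) /= inordK //=.
- exact: tr_inv.
- exact: dt_inv.
- exact: (P1_inv charl cardK two_neq0).
- exact: g_inv.
Qed.

Lemma sw_gens i : sw (generators i) = generators i.
Proof.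
rewrite /generators; elim/ord4_ind: i; rewrite (tnth_nth 0) /= inordK //=.
- exact: sw_tr.
- exact: sw_dt.
- exact: sw_P1.
- exact: sw_g.
Qed.

Lemma msub_inv P : msub P \in @conj_invariant K.
Proof.
apply: rpred_sum => m' _; rewrite mul_mpolyC rpredZ // /mmap1.
by apply: rpred_prod => i _; rewrite rpredX ?gens_inv.
Qed.

Lemma sw_msub P : sw (msub P) = msub P.
Proof.
rewrite (rmorph_mmap (iota' := @mpolyC 4 K)); last by move=> x; apply: mmapC.
by apply: eq_mmap => i; apply: sw_gens.
Qed.

Lemma degg0_gt0 : (0 < q * m)%N.
Proof. by rewrite muln_gt0 m_gt0 // andbT cardK_m. Qed.

Lemma dgE : dg = (q * m)%N.
Proof.
have [c c0 Eg] := gE; apply: (@dhomog_uniq 4 K mdeg g).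
- by rewrite Eg mulf_neq0 ?mpolyC_eq0 // g0_neq0.
- exact: hg.
- by rewrite Eg cst_mul_homog // g0_homog.
Qed.

(* Restrict to the plane of [E2], then to the traceless matrices, then to everything:
   each restriction is a polynomial in the generators modulo a multiple of the next
   one, g or the trace, whose cofactor is again symmetric. *)
Lemma symmetric_generation d p : p \is d.-homog -> p \in @conj_invariant K -> sw p = p ->
  exists2 P : S, P \is d.-homog for (wdeg gen_degs) & p = msub P.
Proof.
elim/ltn_ind: d p => d IHd p hp pi swp.
have [c c0 Eg] := gE.
have g00 : g0 delta != 0 by apply: g0_neq0.
have [P2 [hP2 EP2]] := plane_generation (E2_homog hp) (planar_E2 pi swp).
have [p1 Ep1] : exists p1, p1 = p - msub P2 by eexists.
have hp1 : p1 \is d.-homog by rewrite Ep1 rpredB // msub_homog.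
have p1i : p1 \in @conj_invariant K by rewrite Ep1; apply: rpredB pi (msub_inv P2).
have swp1 : sw p1 = p1 by rewrite Ep1 rmorphB /= swp sw_msub.
have E2p1 : E2 p1 = 0 by rewrite Ep1 rmorphB /= EP2 subrr.
have E3p1i : E3 p1 \in @conj_invariant K.
  apply/conj_invariantE => x y z t D; rewrite cj_E3 //.
  by move/conj_invariantE: p1i => ->.
have [P3 hP3 EP3] : exists2 P3 : S, P3 \is d.-homog for (wdeg gen_degs) & E3 p1 = E3 (msub P3).
  have [z0|E3p10] := eqVneq (E3 p1) 0; first by exists 0; rewrite ?rpred0 ?rmorph0.
  have [r Er] := inv_g0_divides charl two_neq0 irr E3p1i (divides_E3 E2p1).
  have hE := E3_homog hp1; rewrite Er in hE E3p10 E3p1i.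
  have [ed hr] := dhomog_divides hE (g0_homog delta) E3p10.
  have r_i := conj_invariant_quotient g00 (g0_inv charl two_neq0 irr) E3p1i.
  have swr : sw r = r.
    have H : sw (r * g0 delta) = r * g0 delta by rewrite -Er sw_E3 swp1.
    exact: rmorph_quotient g00 (sw_g0 _) H.
  have E3r : E3 r = r.
    have H : E3 (r * g0 delta) = r * g0 delta by rewrite -Er E3_id.
    exact: rmorph_quotient g00 E3_g0 H.
  have [|P hP EP] := IHd (d - q * m)%N _ r hr r_i swr.
    by rewrite ltn_subrL degg0_gt0 (leq_trans _ ed) // degg0_gt0.
  exists (P * ((c^-1)%:MP * 'X_(inord 3))).
    rewrite -(subnK ed); apply: dhomogM hP _; rewrite mul_mpolyC rpredZ //.
    by rewrite -dgE; have := var_wdeg (inord 3); rewrite /gen_degs (tnth_nth 0%N) /= inordK.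
  have EM : msub ((c^-1)%:MP * 'X_(inord 3)) = g0 delta.
    by rewrite rmorphM /= mmapC msubX inordK //= Eg mulrA -mpolyCM mulVf // mpolyC1 mul1r.
  by rewrite Er [msub _]rmorphM /= EM -EP rmorphM /= E3r E3_g0.
have [p2 Ep2] : exists p2, p2 = p1 - msub P3 by eexists.
have p2i : p2 \in @conj_invariant K by rewrite Ep2; apply: rpredB p1i (msub_inv P3).
have hp2 : p2 \is d.-homog by rewrite Ep2 rpredB // msub_homog.
have swp2 : sw p2 = p2 by rewrite Ep2 rmorphB /= swp1 sw_msub.
have [P4 hP4 EP4] : exists2 P4 : S, P4 \is d.-homog for (wdeg gen_degs) & p2 = msub P4.
  have [z0|p20] := eqVneq p2 0; first by exists 0; rewrite ?rpred0 ?rmorph0.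
  have [r Er] : divides tr p2 by apply: divides_tr; rewrite Ep2 rmorphB /= EP3 subrr.
  rewrite Er in hp2 p20 p2i swp2; rewrite Er.
  have [ed hr] := dhomog_divides hp2 (tr_homog K) p20.
  have r_i := conj_invariant_quotient tr_neq0 (tr_inv K) p2i.
  have swr : sw r = r by apply: rmorph_quotient tr_neq0 (sw_tr K) swp2.
  have [|P hP EP] := IHd (d - 1)%N _ r hr r_i swr.
    by rewrite ltn_subrL (leq_trans _ ed).
  exists (P * 'X_(inord 0)); last by rewrite rmorphM /= msubX inordK //= -EP.
  rewrite -(subnK ed); apply: dhomogM hP _.
  by have := var_wdeg (inord 0); rewrite /gen_degs (tnth_nth 0%N) /= inordK.
exists (P2 + P3 + P4); first by rewrite !rpredD.
by rewrite !rmorphD /= -EP4 Ep2 Ep1; ring.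
Qed.

End Generation.

(** * The free module S^H + h S^H *)

Section Structure.
Variables (K : finFieldType) (l n : nat) (delta : K).
Hypothesis charl : l \in [pchar K].
Hypothesis cardK : #|K| = (l ^ n)%N.
Hypothesis n_gt0 : (0 < n)%N.
Hypothesis two_neq0 : (2%:R : K) != 0.
Hypothesis irr : forall x : K, x ^+ 2 + delta != 0.
Variables (L : finFieldType) (iota : {rmorphism K -> L}) (w : L).
Hypothesis w2 : w ^+ 2 = - iota delta.
Hypothesis Lgen : forall x, exists u v, x = iota u + iota v * w.
Hypothesis cardL : #|L| = (#|K| ^ 2)%N.
Local Notation S := {mpoly K[4]}.
Local Notation q := #|K|.
Local Notation tr := (inv_trace K).
Local Notation dt := (inv_det K).
Local Notation P1 := (inv_P1det K).
Local Notation m := #|@hsys K|.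
Local Notation ev0 := (eval_pt delta iota w).
Variables (g : S).
Hypothesis g_sqrt : g ^+ 2 = f4 delta.
Local Notation dg := (q * m)%N.
Local Notation dh := (q + q * m)%N.
Implicit Types (p r : S) (x y z t A B C k u v : K).

Let gE : exists2 c : K, c != 0 & g = c%:MP * g0 delta.
Proof. exact: f4_sqrtE. Qed.

Let hg : g \is dg.-homog.
Proof. by have [c _ ->] := gE; rewrite cst_mul_homog // g0_homog. Qed.

Local Notation gens := (generators g).
Local Notation degs := (gen_degs K dg).
Local Notation msub := (mmap (@mpolyC 4 K) gens).

(** Restriction to the line spanned by X0, where det vanishes and P1 becomes a nonzero multiple of
    'X^(q + 1). *)
Definition evt : S -> {poly L} := ev (polyC \o iota) (w *: 'X) (iota delta *: 'X) 'X (- w *: 'X).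
HB.instance Definition _ := GRing.RMorphism.on evt.

Lemma evt_homog d p : p \is d.-homog -> evt p = (ev0 p)%:P * 'X^d.
Proof.
move=> /dhomogP hp; rewrite {1}/evt /eval_pt /mmap rmorph_sum mulr_suml !big_seq /=.
apply: eq_bigr => m' /hp <-; rewrite rmorphM -mulrA; congr (_ * _).
rewrite -[X in 'X^X]/(mdeg m') mdegE expr_sum /mmap1 rmorph_prod -big_split /=.
apply: eq_bigr => i _; rewrite rmorphXn -exprMn; congr (_ ^+ _).
by elim/ord4_ind: i; rewrite !(tnth_nth 0) /= inordK //= -?mul_polyC ?mul1r.
Qed.

Lemma E2_E3 p : E2 delta (E3 p) = E2 delta p.
Proof.
rewrite /E2 /E3 ev_sub; apply: ev_eq.
- exact: (E2_xl delta two_neq0).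
- exact: ev_vb.
- exact: ev_vc.
- by rewrite ev_N; congr (- _); apply: (E2_xl delta two_neq0).
Qed.

Lemma E2_g0 : E2 delta (g0 delta) = 0.
Proof.
have [|z ->] := @lft_divides_g0 K delta two_neq0 irr (0, 1, - delta).
  by rewrite /nrmt /nrm /=; ring.
rewrite rmorphM /= [X in _ * X](_ : _ = 0) ?mulr0 //.
by rewrite /lft /E2 ev_lf /= rmorph0 rmorph1 rmorphN /=; ring.
Qed.

(** A chain of restrictions, each killing one more generator that was still nonzero: the trace on
    the traceless matrices, g on the plane, det on the line through X0, and P1 at the origin. *)
Lemma gens_alg_indep P : msub P = 0 -> P = 0.
Proof.
have dt0 : E2 delta (E3 dt) != 0.
  rewrite E2_E3 E2_dt oppr_eq0; exact: normform_neq0.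
suff H : alg_indep (@mpolyC 4 K) xpredT gens by move=> EP; apply: H.
pose J2 : pred 'I_4 := pred1 (inord 2).
pose J12 : pred 'I_4 := pred2 (inord 1) (inord 2).
pose J123 : pred 'I_4 := [pred i | i != inord 0].
have gi (j : nat) : (j < 4)%N -> gens (inord j) = nth 0 [:: tr; dt; P1; g] j.
  by move=> k4; rewrite /generators (tnth_nth 0) inordK.
apply: (alg_indep_step (rho := @E3 K) (iota' := @mpolyC 4 K) (j := inord 0) (J := J123)).
- by move=> x; apply: mmapC.
- by rewrite gi //= E3_tr.
- by rewrite gi //= tr_neq0.
- by move=> i _; have [->|ne] := eqVneq i (inord 0); [right|left].
apply: (alg_indep_step (rho := @E2 K delta) (iota' := @mpolyC 4 K) (j := inord 3) (J := J12)).
- by move=> x; apply: mmapC.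
- have [c _ Eg] := gE; rewrite gi //= Eg !rmorphM /= (E3_g0 delta two_neq0) E2_g0 mulr0 //.
- have [c c0 Eg] := gE; rewrite gi //= Eg rmorphM /= (E3_g0 delta two_neq0) /E3 ev_C.
  by rewrite mulf_neq0 ?mpolyC_eq0 // (g0_neq0 irr).
- by elim/ord4_ind; rewrite /J123 /J12 /= ?eqxx ?orbT; auto.
apply: (alg_indep_step (rho := evt) (iota' := polyC \o iota) (j := inord 1) (J := J2)).
- by move=> x; apply: mmapC.
- rewrite gi //= E2_E3 (evt_homog (E2_homog delta (dt_homog K))).
  by rewrite ev0_E2 // ev0_dt // mul0r.
- by rewrite gi.
- by move=> i /orP[/eqP->|]; [right|left].
apply: (alg_indep_step (rho := horner_eval (0 : L)) (iota' := iota) (j := inord 2) (J := pred0)).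
- by move=> x; rewrite /= /horner_eval hornerC.
- rewrite gi //= E2_E3 (evt_homog (E2_homog delta (P1_homog K))).
  by rewrite /horner_eval hornerM hornerXn exprS mul0r mulr0.
- rewrite gi //= E2_E3 (evt_homog (E2_homog delta (P1_homog K))) ev0_E2 //.
  rewrite (ev0_P1 charl cardK n_gt0 two_neq0 w2 Lgen cardL).
  rewrite mulf_neq0 ?polyC_eq0 ?fmorph_eq0 ?ev0_P1_neq0 //.
  by rewrite -size_poly_eq0 size_polyXn.
- by move=> i /eqP ->; right.
exact: alg_indep0.
Qed.

Lemma cj_sw x y z t p : cj x y z t (sw p) = sw (cj x (- y) (- z) t p).
Proof.
by rewrite /cj /sw !ev_sub; apply: ev_eq; rewrite !evE /= !mpolyCN; ring.
Qed.

Lemma sw_inv p : p \in @conj_invariant K -> sw p \in @conj_invariant K.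
Proof.
move=> /conj_invariantE pinv; apply/conj_invariantE => x y z t D.
by rewrite cj_sw pinv // -D; ring.
Qed.

Lemma sw_sw p : sw (sw p) = p.
Proof. by rewrite /sw ev_sub !evE sub_id. Qed.

Definition jacg : S := jac g.

Lemma jacg_inv : jacg \in @conj_invariant K.
Proof.
apply: (jac_inv charl cardK two_neq0).
by have [c _ ->] := gE; rewrite mul_mpolyC rpredZ // (g0_inv charl two_neq0 irr).
Qed.

Lemma sw_jacg : sw jacg = - jacg.
Proof. by apply: sw_jac; apply: sw_g gE. Qed.

Lemma jacg_neq0 : jacg != 0.
Proof.
rewrite /jacg; have [c c0 ->] := gE.
exact: (jac_neq0 charl cardK n_gt0 two_neq0 irr w2 Lgen cardL c0).
Qed.

Lemma jacg_homog : jacg \is dh.-homog.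
Proof.
have d0 : (0 < dg)%N by apply: (degg0_gt0 two_neq0).
by rewrite -(prednK d0); apply: (jac_homog charl cardK n_gt0); rewrite prednK.
Qed.

Lemma jacgE : exists2 c : K, c != 0 & jacg = c%:MP * D0 K.
Proof.
have [r Er] := anti_divides two_neq0 jacg_inv sw_jacg.
have := jacg_homog; have := jacg_neq0; rewrite Er addnC => r0 hr.
have [_] := dhomog_divides hr (D0_homog K) r0.
rewrite subnn => /dhomog0_const[c Ec]; exists c; last by rewrite Ec.
by apply: contraNneq r0 => c0; rewrite Ec c0 mpolyC0 mul0r.
Qed.

Lemma anti_jacg_divides p : p \in @conj_invariant K -> sw p = - p -> divides jacg p.
Proof.
move=> pinv ap; have [r ->] := anti_divides two_neq0 pinv ap.
have [c c0 ->] := jacgE; exists ((c^-1)%:MP * r).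
by rewrite mulrACA -mpolyCM mulVf // mpolyC1 mul1r.
Qed.

(** As 2 is invertible, [p] is the sum of a symmetric and an anti-symmetric invariant. The
    disjunction guards the truncated subtraction [d - dh]: below degree [dh] the coefficient of h is
    zero and not an arbitrary constant. *)
Lemma invariant_generation d p : p \is d.-homog -> p \in @conj_invariant K ->
  exists U V : S, [/\ U \is d.-homog for (wdeg degs), V = 0 \/ (dh <= d)%N,
    V \is (d - dh).-homog for (wdeg degs) & p = msub U + msub V * jacg].
Proof.
move=> hp pinv; pose h2 : S := (2%:R^-1)%:MP.
have hsw := sw_homog hp; have swi := sw_inv pinv.
have h2C : sw h2 = h2 by apply: mmapC.
have [U hU EU] : exists2 U : S, U \is d.-homog for (wdeg degs) & h2 * (p + sw p) = msub U.
  apply: (symmetric_generation charl cardK n_gt0 two_neq0 irr w2 Lgen cardL hg gE).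
  - by rewrite cst_mul_homog // rpredD.
  - by rewrite mul_mpolyC; apply/rpredZ/rpredD.
  - by rewrite rmorphM rmorphD /= h2C sw_sw addrC.
have am : sw (h2 * (p - sw p)) = - (h2 * (p - sw p)).
  by rewrite rmorphM rmorphB /= h2C sw_sw; ring.
have ai : h2 * (p - sw p) \in @conj_invariant K.
  by rewrite mul_mpolyC; apply/rpredZ/rpredB.
have ah : h2 * (p - sw p) \is d.-homog by rewrite cst_mul_homog // rpredB.
have EP : p = h2 * (p + sw p) + h2 * (p - sw p).
  rewrite -mulrDr addrACA addrN addr0 -mulr2n -[p *+ 2]mulr_natl mulrA -mpolyC_nat -mpolyCM.
  by rewrite mulVf // mpolyC1 mul1r.
have [r Er] := anti_jacg_divides ai am.
have [r0|r0] := eqVneq r 0.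
  exists U, 0; rewrite rpred0 rmorph0 mul0r addr0 {1}EP Er r0 mul0r addr0.
  by split=> //; left.
have rj0 : r * jacg != 0 by rewrite mulf_neq0 // jacg_neq0.
rewrite Er in ai ah am.
have [dd hr] := dhomog_divides ah jacg_homog rj0.
have ri := conj_invariant_quotient jacg_neq0 jacg_inv ai.
have swr : sw r = r.
  apply: (mulIf jacg_neq0); apply: oppr_inj.
  by rewrite -am rmorphM /= sw_jacg mulrN.
have [V hV EV] := symmetric_generation charl cardK n_gt0 two_neq0 irr w2 Lgen cardL hg gE hr ri swr.
exists U, V; split=> //; first by right.
by rewrite {1}EP Er EU EV.
Qed.

(** [sw] fixes the first term and negates the second, so both are zero. *)
Lemma generation_unique U V : msub U + msub V * jacg = 0 -> U = 0 /\ V = 0.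
Proof.
move=> E; have := congr1 (@sw K) E.
rewrite rmorphD rmorphM rmorph0 /= !(sw_msub gE) sw_jacg mulrN => E'.
have two0 : 2%:R != 0 :> S by rewrite -mpolyC_nat mpolyC_eq0.
have U0 : msub U = 0.
  apply: (mulfI two0); rewrite mulr0 -[RHS]addr0 -{1}E -E'; ring.
split; first exact: gens_alg_indep.
apply: gens_alg_indep; apply: (mulIf jacg_neq0); rewrite mul0r.
by rewrite -[LHS]add0r -{1}U0.
Qed.

(** The square of an anti-symmetric invariant is symmetric; this gives the defining equation of the
    hypersurface. *)
Lemma jacg_square : exists2 Phi : S, Phi \is (dh + dh).-homog for (wdeg degs)
  & jacg ^+ 2 = msub Phi.
Proof.
apply: (symmetric_generation charl cardK n_gt0 two_neq0 irr w2 Lgen cardL hg gE).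
- by rewrite expr2 dhomogM // jacg_homog.
- by rewrite rpredX // jacg_inv.
- by rewrite rmorphXn /= sw_jacg sqrrN.
Qed.

End Structure.

(** * Failure of F-regularity *)

Section JacobianIdeal.
Variables (K : finFieldType) (l n : nat).
Hypothesis charl : l \in [pchar K].
Hypothesis cardK : #|K| = (l ^ n)%N.
Hypothesis n_gt0 : (0 < n)%N.
Local Notation S := {mpoly K[4]}.
Local Notation q := #|K|.
Local Notation va := (va K).
Local Notation vb := (vb K).
Local Notation vc := (vc K).
Local Notation vd := (vd K).
Local Notation tr := (inv_trace K).
Local Notation dt := (inv_det K).
Local Notation P1 := (inv_P1det K).
Implicit Types (p r : S).

Definition in_ideal p : Prop := exists s1 s2 s3, p = s1 * tr + s2 * dt + s3 * P1.

Lemma in_idealD p r : in_ideal p -> in_ideal r -> in_ideal (p + r).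
Proof.
move=> [s1 [s2 [s3 ->]]] [t1 [t2 [t3 ->]]].
by exists (s1 + t1), (s2 + t2), (s3 + t3); ring.
Qed.

Lemma in_idealM p r : in_ideal r -> in_ideal (p * r).
Proof. by move=> [s1 [s2 [s3 ->]]]; exists (p * s1), (p * s2), (p * s3); ring. Qed.

Lemma in_ideal0 : in_ideal 0.
Proof. by exists 0, 0, 0; ring. Qed.

Lemma in_ideal_sum (I : Type) (s : seq I) (Q : pred I) (F : I -> S) :
  (forall i, Q i -> in_ideal (F i)) -> in_ideal (\sum_(i <- s | Q i) F i).
Proof. by move=> H; elim/big_ind: _ => //; [exact: in_ideal0|exact: in_idealD]. Qed.

(** The cofactors of the row of derivatives of [g] in the Jacobian matrix. *)
Definition jac_cofactor : 'I_4 -> S := tnth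
  [tuple vb * vc ^+ q - vc * vb ^+ q;
         va * vb ^+ q - vb * va ^+ q + vb * vd ^+ q - vd * vb ^+ q;
         vc * va ^+ q - va * vc ^+ q + vd * vc ^+ q - vc * vd ^+ q;
         vc * vb ^+ q - vb * vc ^+ q].

Lemma jac_cofactorE g : jac g = \sum_i g^`M(i) * jac_cofactor i.
Proof.
rewrite (jacE charl cardK n_gt0) sum_ord4 /jac_cofactor !(tnth_nth 0) /= !inordK //=.
move: (va ^+ q) (vb ^+ q) (vc ^+ q) (vd ^+ q) => aq bq cq dq; ring.
Qed.

Lemma in_idealN p : in_ideal p -> in_ideal (- p).
Proof. by rewrite -mulN1r; apply: in_idealM. Qed.

(* By Cramer's rule, since the first three rows of the Jacobian matrix map the
   vector (a, b, c, d) to tr, 2 det and P1. *)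
Lemma jac_cofactor_ideal i j :
  in_ideal ('X_j * jac_cofactor i - 'X_i * jac_cofactor j).
Proof.
have anti (k k' : 'I_4) : in_ideal ('X_k' * jac_cofactor k - 'X_k * jac_cofactor k') ->
    in_ideal ('X_k * jac_cofactor k' - 'X_k' * jac_cofactor k).
  by move=> /in_idealN; rewrite opprB.
have same k : in_ideal ('X_k * jac_cofactor k - 'X_k * jac_cofactor k).
  by rewrite subrr; apply: in_ideal0.
have c01 : in_ideal (vb * jac_cofactor (inord 0) - va * jac_cofactor (inord 1)).
  exists (vb * va ^+ q - va * vb ^+ q), (2%:R * vb ^+ q), (- vb).
  rewrite /jac_cofactor !(tnth_nth 0) /= !inordK //= /inv_P1det /inv_trace /inv_det /=.
  move: (va ^+ q) (vb ^+ q) (vc ^+ q) (vd ^+ q) => aq bq cq dq; ring.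
have c02 : in_ideal (vc * jac_cofactor (inord 0) - va * jac_cofactor (inord 2)).
  exists (va * vc ^+ q - vc * va ^+ q), (- 2%:R * vc ^+ q), vc.
  rewrite /jac_cofactor !(tnth_nth 0) /= !inordK //= /inv_P1det /inv_trace /inv_det /=.
  move: (va ^+ q) (vb ^+ q) (vc ^+ q) (vd ^+ q) => aq bq cq dq; ring.
have c03 : in_ideal (vd * jac_cofactor (inord 0) - va * jac_cofactor (inord 3)).
  exists (vb * vc ^+ q - vc * vb ^+ q), 0, 0.
  rewrite /jac_cofactor !(tnth_nth 0) /= !inordK //= /inv_P1det /inv_trace /inv_det /=.
  move: (va ^+ q) (vb ^+ q) (vc ^+ q) (vd ^+ q) => aq bq cq dq; ring.
have c12 : in_ideal (vc * jac_cofactor (inord 1) - vb * jac_cofactor (inord 2)).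
  exists (va * vd ^+ q - vd * va ^+ q), (2%:R * (va ^+ q - vd ^+ q)), (vd - va).
  rewrite /jac_cofactor !(tnth_nth 0) /= !inordK //= /inv_P1det /inv_trace /inv_det /=.
  move: (va ^+ q) (vb ^+ q) (vc ^+ q) (vd ^+ q) => aq bq cq dq; ring.
have c13 : in_ideal (vd * jac_cofactor (inord 1) - vb * jac_cofactor (inord 3)).
  exists (vb * vd ^+ q - vd * vb ^+ q), (2%:R * vb ^+ q), (- vb).
  rewrite /jac_cofactor !(tnth_nth 0) /= !inordK //= /inv_P1det /inv_trace /inv_det /=.
  move: (va ^+ q) (vb ^+ q) (vc ^+ q) (vd ^+ q) => aq bq cq dq; ring.
have c23 : in_ideal (vd * jac_cofactor (inord 2) - vc * jac_cofactor (inord 3)).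
  exists (vd * vc ^+ q - vc * vd ^+ q), (- 2%:R * vc ^+ q), vc.
  rewrite /jac_cofactor !(tnth_nth 0) /= !inordK //= /inv_P1det /inv_trace /inv_det /=.
  move: (va ^+ q) (vb ^+ q) (vc ^+ q) (vd ^+ q) => aq bq cq dq; ring.
by elim/ord4_ind: i; elim/ord4_ind: j; (apply: same || assumption || (apply: anti; assumption)).
Qed.

(* When the degree of the monomial is zero in K, the coefficients m i sum to 0, so its
   gradient is a combination of the vectors x_k e_i - x_i e_k. *)
Lemma jac_mono_ideal (mm : 'X_{1..4}) : (mdeg mm)%:R = 0 :> K -> in_ideal (jac 'X_[mm]).
Proof.
move=> dm; rewrite jac_cofactorE.
have [-> | /eqP m0] := eqVneq mm 0%MM.
  rewrite big1; first exact: in_ideal0.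
  by move=> i _; rewrite mpolyX0 -mpolyC1 mderivC mul0r.
have [k mk] : exists k, mm k != 0%N.
  apply: NNPP => H; apply: m0; apply/mnmP => i; rewrite mnm0E; apply/eqP.
  by apply: NNPP => /negP mi; apply: H; exists i.
have sum0 : \sum_i (mm i)%:R = 0 :> S.
  by rewrite -natr_sum -mdegE -mpolyC_nat dm mpolyC0.
have -> : \sum_i ('X_[mm] : S)^`M(i) * jac_cofactor i =
    \sum_i (mm i)%:R * ('X_[mm - U_(i)] * jac_cofactor i - 'X_[mm - U_(k)] * jac_cofactor k).
  under [RHS]eq_bigr do rewrite mulrBr.
  rewrite sumrB -mulr_suml sum0 mul0r subr0; apply: eq_bigr => i _.
  by rewrite mderivX -mul_mpolyC mpolyC_nat mulrA.
apply: in_ideal_sum => i _.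
have [-> | mi] := eqVneq (mm i) 0%N; first by rewrite mul0r; apply: in_ideal0.
apply: in_idealM; have [->|ik] := eqVneq i k; first by rewrite subrr; apply: in_ideal0.
(* Both terms have the common factor 'X_[mm - U_(i) - U_(k)], which leaves x_k J_i - x_i J_k for the
   cofactors J. *)
have e1 : (mm - U_(i) = (mm - U_(i) - U_(k)) + U_(k))%MM.
  by rewrite submK // lep1mP mnmBE mnm1E (negPf ik) subn0.
have e2 : (mm - U_(k) = (mm - U_(i) - U_(k)) + U_(i))%MM.
  rewrite submDA [(U_(i) + _)%MM]addmC -submDA submK //.
  by rewrite lep1mP mnmBE mnm1E [k == i]eq_sym (negPf ik) subn0.
rewrite e1 e2 -e1 [in 'X_[mm - U_(i)]]e1 !mpolyXD -!mulrA -mulrBr.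
by apply: in_idealM; apply: jac_cofactor_ideal.
Qed.

Lemma jac_ideal d g : g \is d.-homog -> d%:R = 0 :> K -> in_ideal (jac g).
Proof.
move=> /dhomogP hg d0; rewrite [g]mpolyE.
have jacD p r : jac (p + r) = jac p + jac r.
  by rewrite !jac_cofactorE -big_split; apply: eq_bigr => i _; rewrite mderivD mulrDl.
have jacZ c p : jac (c *: p) = c%:MP * jac p.
  rewrite !jac_cofactorE mulr_sumr; apply: eq_bigr => i _.
  by rewrite mderivZ -mul_mpolyC mulrA.
have jac0 : jac 0 = 0 :> S.
  by rewrite jac_cofactorE big1 // => i _; rewrite mderiv0 mul0r.
rewrite big_seq; elim/big_ind: _ => [|p r hp hr|mm /hg /= dm].
- by rewrite jac0; apply: in_ideal0.
- by rewrite jacD; apply: in_idealD.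
- by rewrite jacZ; apply/in_idealM/jac_mono_ideal; rewrite dm.
Qed.

End JacobianIdeal.

(** * The transfer from S to S^G *)

Section Trace.
Variables (T : finType) (R : idomainType) (F : T -> {rmorphism R -> R}).

(* Dedekind's argument: a relation is shortened by comparing its twist by x with its
   multiple by F j x. *)
Lemma dedekind (i0 : T) (js : seq T) (c : T -> R) :
  (forall j, j \in js -> exists x, F j x != F i0 x) ->
  (forall x, c i0 * F i0 x + \sum_(j <- js) c j * F j x = 0) -> c i0 = 0.
Proof.
elim: js c => [|j js IHjs] c dj rel.
  by have := rel 1; rewrite big_nil addr0 rmorph1 mulr1.
have [y ny] := dj j (mem_head _ _).
have /eqP : c i0 * (F i0 y - F j y) = 0.
  apply: (IHjs (fun i => c i * (F i y - F j y))) => [j' j's|x].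
    by apply: dj; rewrite inE j's orbT.
  transitivity ((c i0 * F i0 (y * x) + \sum_(j <- j :: js) c j * F j (y * x)) -
    F j y * (c i0 * F i0 x + \sum_(j <- j :: js) c j * F j x)); last first.
    by rewrite !rel mulr0 subr0.
  rewrite !big_cons !rmorphM.
  have -> : \sum_(i <- js) c i * F i (y * x) = \sum_(i <- js) c i * F i y * F i x.
    by apply: eq_bigr => i _; rewrite rmorphM mulrA.
  have -> : \sum_(i <- js) c i * (F i y - F j y) * F i x =
      \sum_(i <- js) c i * F i y * F i x - F j y * \sum_(i <- js) c i * F i x.
    by rewrite mulr_sumr -sumrB; apply: eq_bigr => i _; ring.
  ring.
by rewrite mulf_eq0 subr_eq0 [F i0 y == _]eq_sym (negPf ny) orbF => /eqP.
Qed.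

End Trace.

Section GroupTrace.
Variable K : finFieldType.
Hypothesis two_neq0 : (2%:R : K) != 0.
Local Notation S := {mpoly K[4]}.
Local Notation va := (va K).
Local Notation vb := (vb K).
Implicit Types (p r : S) (s t : 'M[K]_2).

Definition cjm s : S -> S := cj (s 0 0) (s 0 1) (s 1 0) (s 1 1).
HB.instance Definition _ s := GRing.RMorphism.on (cjm s).

Lemma cjm_comp s t p : cjm s (cjm t p) = cjm (s *m t) p.
Proof. by rewrite /cjm cj_comp !mulmx2E. Qed.

Lemma cjm_id p : cjm 1%:M p = p.
Proof. by rewrite /cjm !mxE /= cj_id. Qed.

Lemma cjm_fixed s : (forall p, cjm s p = p) -> \det s = 1 -> s = 1%:M \/ s = - 1%:M.
Proof.
move=> H ds; have Ea := H va; have Eb := H vb.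
rewrite /cjm /cj ev_va ev_vb in Ea Eb.
have := congr1 (ev idfun 1 0 0 0) Ea; rewrite !evE /= => E1.
have := congr1 (ev idfun 0 1 0 0) Ea; rewrite !evE /= => E2.
have := congr1 (ev idfun 0 0 1 0) Ea; rewrite !evE /= => E3.
have := congr1 (ev idfun 0 1 0 0) Eb; rewrite !evE /= => E4.
have {}E1 : s 1 1 * s 0 0 = 1 by rewrite -[RHS]E1; ring.
have {}E2 : s 1 1 * s 1 0 = 0 by rewrite -[RHS]E2; ring.
have {}E3 : s 0 1 * s 0 0 = 0 by rewrite -[RHS]oppr0 -[in RHS]E3; ring.
have {}E4 : s 1 1 ^+ 2 == 1 by rewrite -[in eqbRHS]E4; apply/eqP; ring.
have x0 : s 0 0 != 0 by apply: contra_eq_neq E1 => ->; rewrite mulr0 eq_sym oner_neq0.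
have t0 : s 1 1 != 0 by apply: contra_eq_neq E1 => ->; rewrite mul0r eq_sym oner_neq0.
have z0 : s 1 0 = 0 by apply: (mulfI t0); rewrite E2 mulr0.
have y0 : s 0 1 = 0 by apply: (mulIf x0); rewrite E3 mul0r.
move: E4; rewrite -subr_eq0 subr_sqr_1 mulf_eq0 subr_eq0 addr_eq0 => /orP[]/eqP Et;
  [left|right]; apply: mx2_eq; rewrite !mxE /= ?oppr0 ?z0 ?y0 ?Et //.
  by rewrite -E1 Et mul1r.
by rewrite -E1 Et mulN1r opprK.
Qed.

Lemma cjm_opp1 p : cjm (- 1%:M) p = p.
Proof.
rewrite -[RHS]cj_id /cjm !mxE /= !mulr1n !mulr0n oppr0 /cj.
by apply: ev_eq; rewrite !(mpolyCN, mpolyC1, mpolyC0); ring.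
Qed.

Definition group_trace p : S := \sum_(s in SL2 K) cjm s p.

Lemma group_trace_inv p : group_trace p \in @conj_invariant K.
Proof.
apply/conj_invariantP => s sG; have /eqP ds : \det s == 1 by rewrite inE in sG.
have su : s \in unitmx by rewrite unitmxE ds unitr1.
rewrite conj_actE // -/(cjm s _) rmorph_sum [RHS](reindex_onto (mulmx s) (mulmx (invmx s))) /=.
  apply: eq_big => t; last by rewrite cjm_comp.
  by rewrite !inE det_mulmx ds mul1r mulKmx // eqxx andbT.
by move=> t _; rewrite mulKVmx.
Qed.

Lemma group_traceMr p r : r \in @conj_invariant K -> group_trace (p * r) = group_trace p * r.
Proof.
move=> /conj_invariantP ri; rewrite /group_trace mulr_suml; apply: eq_bigr => s sG.
rewrite rmorphM /=; congr (_ * _); rewrite -[RHS](ri s sG) conj_actE //.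
by move: sG; rewrite inE => /eqP.
Qed.

Lemma group_traceD p r : group_trace (p + r) = group_trace p + group_trace r.
Proof. by rewrite /group_trace -big_split; apply: eq_bigr => s _; rewrite rmorphD. Qed.

Lemma group_trace_neq0 : exists b, group_trace b != 0.
Proof.
apply: NNPP => H; have {}H b : group_trace b = 0.
  by apply/eqP; apply: NNPP => /negP nb; apply: H; exists b.
pose A := [pred s | (s \in SL2 K) && (s != 1%:M) && (s != - 1%:M)].
have d1 : \det (- 1%:M : 'M[K]_2) = 1.
  by rewrite det2 !mxE /= !mulr1n !mulr0n; ring.
have n1 : - 1%:M != 1%:M :> 'M[K]_2.
  apply/eqP => /matrixP/(_ 0 0)/eqP; rewrite !mxE /= mulr1n.
  by rewrite (negPf (oppr_neq two_neq0 (oner_neq0 K))).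
pose F s : {rmorphism S -> S} := cjm s.
(* Both 1 and -1 act trivially, so in the relation saying that the transfer vanishes the identity
   has coefficient 2. Every other element of the group moves some polynomial, and Dedekind's
   argument gives 2 = 0. *)
pose c s : S := if s == 1%:M then 2%:R else 1.
have /eqP : c 1%:M = 0.
  apply: (@dedekind _ S F 1%:M (enum A)) => [s|p]; rewrite /F /c /=.
    rewrite mem_enum inE => /andP[/andP[sG s1] sN1]; apply: NNPP => nx.
    have sf p : cjm s p = p.
      by apply/eqP; apply: NNPP => /negP ne; apply: nx; exists p; rewrite /= cjm_id.
    have ds : \det s = 1 by move: sG; rewrite inE => /eqP.
    by have [E|E] := cjm_fixed sf ds; [rewrite E eqxx in s1|rewrite E eqxx in sN1].
  rewrite eqxx big_enum_cond /= cjm_id -[RHS](H p) /group_trace.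
  rewrite [RHS](bigD1 1%:M) ?inE ?det1 ?eqxx //=.
  rewrite [X in _ = _ + X](bigD1 (- 1%:M)) ?inE ?d1 ?eqxx //=.
  rewrite cjm_id cjm_opp1 addrA; congr (_ + _); first by ring.
  apply: eq_big => s; first by rewrite !inE ?andbT.
  by rewrite !inE andbT => /andP[/andP[_ /negPf ->] _]; rewrite mul1r.
by rewrite /c eqxx -mpolyC_nat mpolyC_eq0 (negPf two_neq0).
Qed.

End GroupTrace.

Lemma ideal_gen0 (R : comNzRingType) (X : R -> Prop) : ideal_gen X 0.
Proof.
by exists 0%N, (fun=> 0), (fun=> 0); split; [case|rewrite big_ord0].
Qed.

Lemma ideal_genM (R : comNzRingType) (X : R -> Prop) c x : X x -> ideal_gen X (c * x).
Proof. by move=> Xx; exists 1%N, (fun=> c), (fun=> x); split=> //; rewrite big_ord1. Qed.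

Lemma ideal_genD (R : comNzRingType) (X : R -> Prop) x y :
  ideal_gen X x -> ideal_gen X y -> ideal_gen X (x + y).
Proof.
move=> [k [c [g [Xg ->]]]] [k' [c' [g' [Xg' ->]]]].
exists (k + k')%N, (fun i => match split i with inl j => c j | inr j => c' j end),
  (fun i => match split i with inl j => g j | inr j => g' j end); split.
  by move=> i; case: (split i).
rewrite big_split_ord /=; congr (_ + _); apply: eq_bigr => i _.
  by rewrite (unsplitK (inl i)).
by rewrite (unsplitK (inr i)).
Qed.

Lemma ideal_gen_sum (R : comNzRingType) (X : R -> Prop) (I : Type) (s : seq I) (P : pred I)
    (F : I -> R) :
  (forall i, P i -> ideal_gen X (F i)) -> ideal_gen X (\sum_(i <- s | P i) F i).
Proof.
by move=> H; elim/big_ind: _ => //; [exact: ideal_gen0|exact: ideal_genD].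
Qed.

Lemma ideal_gen_ind (R : comNzRingType) (X Q : R -> Prop) :
  Q 0 -> (forall x y, Q x -> Q y -> Q (x + y)) -> (forall c x, X x -> Q (c * x)) ->
  forall x, ideal_gen X x -> Q x.
Proof.
move=> Q0 QD QM x [k [c [g [Xg ->]]]].
by elim/big_ind: _ => // i _; apply: QM.
Qed.

Lemma ideal_gen_is_ideal (R : comNzRingType) (X : R -> Prop) : is_ideal (ideal_gen X).
Proof.
split; [exact: ideal_gen0|exact: ideal_genD|move=> a x].
apply: (ideal_gen_ind (Q := fun x => ideal_gen X (a * x))).
- by rewrite mulr0; apply: ideal_gen0.
- by move=> y z Xy Xz; rewrite mulrDr; apply: ideal_genD.
- by move=> c y Xy; rewrite mulrA; apply: ideal_genM.
Qed.

Lemma has_dim_card (K : fieldType) (V : lmodType K) (W : {pred V}) (T : finType)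
    (b : T -> V) :
  (forall t, b t \in W) ->
  (forall c : T -> K, \sum_t c t *: b t = 0 -> forall t, c t = 0) ->
  (forall v, v \in W -> exists c : T -> K, v = \sum_t c t *: b t) ->
  has_dim W #|T|.
Proof.
move=> bW free span; exists (fun i => b (enum_val i)); split=> [i|c|v /span[c ->]].
- exact: bW.
- rewrite (reindex _ (onW_bij _ (@enum_rank_bij T))) /= => H i; rewrite -(enum_valK i).
  apply: (free (fun t => c (enum_rank t))); rewrite -[RHS]H.
  by apply: eq_bigr => t _; rewrite enum_rankK.
- exists (fun i => c (enum_val i)).
  by rewrite (reindex _ (onW_bij _ (@enum_val_bij T))).
Qed.

Section NotFRegular.
Variables (K : finFieldType) (l : nat).
Hypothesis charl : l \in [pchar K].
Hypothesis two_neq0 : (2%:R : K) != 0.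
Local Notation S := {mpoly K[4]}.
Local Notation R := (inv_ring K).

Lemma exprDn_mpoly e (x y : S) : (x + y) ^+ (l ^ e) = x ^+ (l ^ e) + y ^+ (l ^ e).
Proof.
rewrite exprDn_pchar // pnatX; apply/orP; left.
by rewrite pnatE ?(pcharf_prime charl) //; apply: (rmorph_pchar (@mpolyC 4 K) charl).
Qed.

Lemma minimal_prime_domain (T : idomainType) (P : T -> Prop) c :
  is_minimal_prime P -> P c -> c = 0.
Proof.
move=> [[[P0 _ _] _ _] Pmin]; apply: (Pmin (fun x => x = 0)); last by move=> x ->.
split=> [||x y /eqP]; last by rewrite mulf_eq0 => /orP[]/eqP; [left|right].
  by split=> // [x y -> ->|a x ->]; rewrite ?addr0 ?mulr0.
by apply/eqP; rewrite oner_eq0.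
Qed.

(* The multiplier is [c = Tr b] for some [b] with [Tr b != 0]: if [h = \sum s_i x_i] in
   [S] then [c h^Q = Tr (b h^Q) = \sum Tr (b s_i^Q) x_i^Q]. *)
Lemma tight_closure_contraction (X : R -> Prop) (h : R) (k : nat) (s : 'I_k -> S)
    (x : 'I_k -> R) :
  (forall i, X (x i)) -> val h = \sum_i s i * val (x i) ->
  tight_closure l (ideal_gen X) h.
Proof.
move=> Xx Eh; have [b b0] := group_trace_neq0 two_neq0.
exists (InvRing (group_trace_inv b)); split.
  by move=> P Pmin /(minimal_prime_domain Pmin)/(congr1 val)/= E; rewrite E eqxx in b0.
exists 0%N => e _; set Q := (l ^ e)%N.
have -> : InvRing (group_trace_inv b) * h ^+ Q =
    \sum_i InvRing (group_trace_inv (b * s i ^+ Q)) * x i ^+ Q.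
  apply: val_inj; rewrite rmorphM rmorph_sum rmorphXn /= -group_traceMr; last first.
    by rewrite rpredX // inv_valP.
  rewrite [inv_val h]Eh.
  have -> : (\sum_i s i * val (x i)) ^+ Q = \sum_i s i ^+ Q * val (x i) ^+ Q.
    elim/big_ind2: _ => [|y y' z z' <- <-|i _]; [|exact: exprDn_mpoly|exact: exprMn].
    by rewrite expr0n expn_eq0; have := prime_gt0 (pcharf_prime charl); case: (l).
  have -> : b * (\sum_i s i ^+ Q * val (x i) ^+ Q) =
      \sum_i (b * s i ^+ Q) * val (x i ^+ Q).
    by rewrite mulr_sumr; apply: eq_bigr => i _; rewrite mulrA rmorphXn.
  elim/big_ind2: _ => [|y y' z z' <- <-|i _]; rewrite ?group_traceD //; last first.
    rewrite group_traceMr ?rmorphM //; exact: inv_valP.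
  by rewrite /group_trace big1 // => t _; apply: rmorph0.
apply: ideal_gen_sum => i _; apply: ideal_genM; exists (x i) => //.
by rewrite -[x i]mul1r; apply: ideal_genM.
Qed.

Lemma not_F_regular (X : R -> Prop) (h : R) (k : nat) (s : 'I_k -> S)
    (x : 'I_k -> R) :
  (forall i, X (x i)) -> val h = \sum_i s i * val (x i) -> ~ ideal_gen X h ->
  ~ F_regular l R.
Proof.
(* The ring is its own localization at {1}, so it would be weakly F-regular itself. *)
move=> Xx Eh nh /(_ R (fun y => y = 1) idfun) Freg; apply: nh; apply: Freg.
- split=> [|y ->|y|r].
  + by split=> // y z -> ->; rewrite mulr1.
  + by exists 1; rewrite mulr1.
  + by exists y, 1; split=> //; rewrite mul1r.
  + split=> [/= ->|[y [-> ]]]; last by rewrite mul1r.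
    by exists 1; rewrite mulr0.
- exact: ideal_gen_is_ideal.
- exact: tight_closure_contraction Eh.
Qed.

End NotFRegular.

(** * Unique factorization *)

Section InvariantUFD.
Variable K : finFieldType.
Local Notation S := {mpoly K[4]}.
Local Notation R := (inv_ring K).

Lemma inv_div_inv (x y : S) : x != 0 -> x \in @conj_invariant K ->
  y * x \in @conj_invariant K -> y \in @conj_invariant K.
Proof.
move=> x0 /conj_invariantE xi /conj_invariantE yxi; apply/conj_invariantE => a b c d D.
by apply: (mulIf x0); rewrite -(yxi _ _ _ _ D) rmorphM /= (xi _ _ _ _ D).
Qed.

Lemma inv_divides (x y : R) : x != 0 -> divides (val x) (val y) -> divides x y.
Proof.
move=> x0 [z Ez]; have zi : z \in @conj_invariant K.
  by apply: (@inv_div_inv (val x)); [|exact: inv_valP|rewrite -Ez; exact: inv_valP].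
by exists (InvRing zi); apply: val_inj; rewrite rmorphM.
Qed.

Lemma inv_unit (x : R) : val x \is a GRing.unit -> x \is a GRing.unit.
Proof.
move=> xu; apply: (@divides_unit _ _ 1); last exact: unitr1.
apply: inv_divides; first by apply: contraTneq xu => ->; rewrite rmorph0 unitr0.
by exists (val x)^-1; rewrite mulVr ?rmorph1.
Qed.

Lemma divides_sym_const (x y : S) : x != 0 -> divides x y -> divides y x ->
  exists c, y = c%:MP * x.
Proof.
move=> x0 [u Eu] [v Ev].
have : u \is a GRing.unit.
  apply: (@divides_unit _ _ 1); last exact: unitr1.
  by exists v; apply: (mulIf x0); rewrite mul1r {1}Ev Eu mulrA.
by case/andP => /eqP Eu' _; exists (u@_0); rewrite -Eu'.
Qed.

(* A greatest common divisor in [S] of two invariants is a semi-invariant, hence an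
   invariant, so that [S^G] inherits greatest common divisors from [S]. *)
Lemma inv_irreducible_prime (l : nat) (charl : l \in [pchar K]) (x y z : R) :
  is_irreducible x -> divides x (y * z) -> divides x y \/ divides x z.
Proof.
move=> [x0 xu xirr] xyz; have fS := @factorial_mpoly K 4.
have vx0 : val x != 0 by [].
have [d [dx dy dmax]] := exists_gcd fS (val y) vx0.
have d0 : d != 0 by case: dx => u Eu; apply: contraNneq vx0 => d0; rewrite Eu d0 mulr0.
have cjd a b c e : a * e - b * c = 1 -> divides (cj a b c e d) d.
  move=> D; have inv (r : R) : cj a b c e (val r) = val r.
    exact: (conj_invariantE _).1 (inv_valP r) _ _ _ _ D.
  by apply: dmax; rewrite -inv; apply: divides_morph.
have di : d \in @conj_invariant K.
  apply: (semi_invariant charl) => a b c e D; apply: (divides_sym_const d0 _ (cjd _ _ _ _ D)).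
  have := @cj_inv K e (- b) (- c) a d; rewrite !opprK => E.
  rewrite -{1}E; last by rewrite -D; ring.
  by apply: divides_morph; apply: cjd; rewrite -D; ring.
have [u Eu] := dx.
have ui : u \in @conj_invariant K.
  by apply: (@inv_div_inv d) => //; rewrite -Eu; apply: inv_valP.
have Ex : x = InvRing ui * InvRing di by apply: val_inj; rewrite rmorphM.
have [uu|du] := xirr _ _ Ex.
  left; apply: inv_divides => //; apply: divides_trans dy.
  have [v Ev] : exists v, v * InvRing ui = 1 by exists (InvRing ui)^-1; rewrite mulVr.
  exists (val v); rewrite Ex rmorphM mulrA -rmorphM Ev rmorph1 mul1r //.
right; apply: inv_divides => //; apply: (@coprime_divides _ fS _ (val y)) => //.
  move=> e ex ey; apply: divides_unit (dmax e ex ey) _.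
  have [v Ev] : exists v, v * InvRing di = 1 by exists (InvRing di)^-1; rewrite mulVr.
  apply: (@divides_unit _ _ 1); last exact: unitr1.
  by exists (val v); rewrite -[1]/(val (1 : R)) -Ev rmorphM.
by rewrite -rmorphM; apply: divides_morph.
Qed.

(** Irreducible factorizations exist by descent on the degree, since nonzero constants are units of
    S^G. *)
Lemma inv_ring_UFD (l : nat) (charl : l \in [pchar K]) : is_UFD R.
Proof.
apply: (@is_UFD_irreducible_prime _ (fun r => msize (val r))).
  move=> x y x0 y0 xu; rewrite rmorphM /= msizeM //.
  have y1 : (0 < msize (val y))%N by rewrite lt0n msize_poly_eq0.
  suff x1 : (1 < msize (val x))%N.
    by move: x1 y1; case: (msize (val x)) => [|[|a]] //= _; rewrite !addSn; lia.
  rewrite ltnNge; apply: contra xu => /msize1_polyC E; apply: inv_unit.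
  rewrite E; apply/andP; rewrite mcoeffC eqxx mulr1; split=> //.
  by rewrite unitfE; apply: contraNneq x0 => c0; apply/eqP/val_inj; rewrite E c0 rmorph0.
by move=> x y z; apply: (inv_irreducible_prime charl).
Qed.
End InvariantUFD.

(** * Presentation, Hilbert series and a-invariant *)

Section Presentation.
Variables (K : finFieldType) (f : 'I_4 -> {mpoly K[4]}) (h : {mpoly K[4]}).
Variables (e : 'I_4 -> nat) (dh : nat).
Local Notation S := {mpoly K[4]}.
Local Notation R := (inv_ring K).
Local Notation msub := (mmap (@mpolyC 4 K) f).
Hypothesis f_inv : forall i, f i \in @conj_invariant K.
Hypothesis h_inv : h \in @conj_invariant K.
Hypothesis f_homog : forall i, f i \is (e i).-homog.
Hypothesis h_homog : h \is dh.-homog.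
Hypothesis e_gt0 : forall i, (0 < e i)%N.
Hypothesis dh_gt0 : (0 < dh)%N.
Hypothesis generation : forall d p, p \is d.-homog -> p \in @conj_invariant K ->
  exists U V : S, [/\ U \is d.-homog for (wdeg e), V = 0 \/ (dh <= d)%N,
    V \is (d - dh).-homog for (wdeg e) & p = msub U + msub V * h].
Hypothesis uniqueness : forall U V, msub U + msub V * h = 0 -> U = 0 /\ V = 0.
Variable Phi : S.
Hypothesis Phi_homog : Phi \is (dh + dh).-homog for (wdeg e).
Hypothesis h_square : h ^+ 2 = msub Phi.

Definition fR i : R := InvRing (f_inv i).
Definition hR : R := InvRing h_inv.
Local Notation msubR := (mmap (in_alg R) fR).

Lemma val_alg (c : K) : val (in_alg R c) = c%:MP.
Proof. by rewrite -alg_mpolyC. Qed.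

Lemma val_msubR P : val (msubR P) = msub P.
Proof. exact: (rmorph_mmap (f := val : {rmorphism R -> S}) _ _ val_alg). Qed.

Lemma val_normal_form U V : val (msubR U + msubR V * hR) = msub U + msub V * h.
Proof. by rewrite -!val_msubR. Qed.

Lemma normal_form p : p \in @conj_invariant K -> exists U V, p = msub U + msub V * h.
Proof.
move=> /conj_invariantE pinv; rewrite (pihomog_partitionE (mf := mdeg) (leqnn (msize p))).
elim/big_ind: _ => [|p1 p2 [U1 [V1 ->]] [U2 [V2 ->]]|i _].
- by exists 0, 0; rewrite !rmorph0 mul0r addr0.
- by exists (U1 + U2), (V1 + V2); rewrite !rmorphD mulrDl addrACA.
have [|U [V [_ _ _ E]]] := generation (pihomogP mdeg i p); last by exists U, V.
by apply/conj_invariantE => x y z t D; rewrite -pihomog_cj pinv.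
Qed.

Lemma normal_formR (r : R) : exists U V, r = msubR U + msubR V * hR.
Proof.
have [U [V E]] := normal_form (inv_valP r); exists U, V; apply: val_inj.
by rewrite val_normal_form.
Qed.

Lemma uniquenessR U V : msubR U + msubR V * hR = 0 -> U = 0 /\ V = 0.
Proof.
by move=> /(congr1 val); rewrite val_normal_form rmorph0; apply: uniqueness.
Qed.

Lemma normal_form_inj U V U' V' :
  msubR U + msubR V * hR = msubR U' + msubR V' * hR -> U = U' /\ V = V'.
Proof.
move=> E; have [] := @uniquenessR (U - U') (V - V').
  by rewrite !rmorphB mulrBl addrACA -opprD E subrr.
move=> HU HV; split.
  exact: subr0_eq HU.
exact: subr0_eq HV.
Qed.

(** For the elements of the ideal, the coefficient of h in the basis 1, h has zero constant term. *)
Lemma h_notin_ideal : ~ ideal_gen (fun y => exists i, y = fR i) hR.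
Proof.
pose Q r := exists U V : S, r = msubR U + msubR V * hR /\ V@_0 = 0.
suff H : forall r, ideal_gen (fun y => exists i, y = fR i) r -> Q r.
  move=> /H[U [V [E V0]]]; have [|_ EV] := @normal_form_inj 0 1 U V.
    by rewrite rmorph0 rmorph1 mul1r add0r.
  by move: V0; rewrite -EV mcoeff1 eqxx => /eqP; rewrite oner_eq0.
apply: ideal_gen_ind => [|r r' [U [V [-> V0]]] [U' [V' [-> V0']]]|c _ [i ->]].
- by exists 0, 0; rewrite !rmorph0 mul0r addr0.
- exists (U + U'), (V + V'); split; last by rewrite mcoeffD V0 V0' addr0.
  by rewrite !rmorphD mulrDl addrACA.
have [U [V ->]] := normal_formR c; exists (U * 'X_i), (V * 'X_i); split.
  by rewrite !rmorphM /= mmapX mmap1U mulrDl mulrAC.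
by rewrite rmorphM /= mcoeffX -mdeg_eq0 mdeg1 mulr0.
Qed.

Definition f5 i : S := oapp f h (unlift ord_max i).
Definition w5 i : nat := oapp e dh (unlift ord_max i).
Definition f5R i : R := oapp fR hR (unlift (ord_max : 'I_5) i).
Definition emb : S -> {mpoly K[5]} := mmap (@mpolyC 5 K) (fun i => 'X_(lift ord_max i)).
HB.instance Definition _ := GRing.RMorphism.on emb.
Local Notation msub5 := (mmap (@mpolyC 4 K) f5).
Definition msub5R : {mpoly K[5]} -> R := mmap (in_alg R) f5R.
HB.instance Definition _ := GRing.RMorphism.on msub5R.

Lemma msub5R_scalable : scalable msub5R.
Proof. by move=> c p; rewrite /msub5R mmapZ mulr_algl. Qed.
HB.instance Definition _ :=
  GRing.isScalable.Build K {mpoly K[5]} R *:%R msub5R msub5R_scalable.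

Lemma val_msub5R P : val (msub5R P) = msub5 P.
Proof.
rewrite /msub5R (rmorph_mmap (f := val : {rmorphism R -> S}) _ _ val_alg).
by apply: eq_mmap => i; rewrite /f5R /f5; case: unlift.
Qed.

Lemma msub5_emb U : msub5 (emb U) = msub U.
Proof.
rewrite /emb (rmorph_mmap (f := msub5) (iota' := @mpolyC 4 K)) => [|c]; last exact: mmapC.
by apply: eq_mmap => i /=; rewrite mmapX mmap1U /f5 liftK.
Qed.

Lemma msub5X : msub5 'X_ord_max = h.
Proof. by rewrite mmapX mmap1U /f5 unlift_none. Qed.

Lemma msub5R_emb U : msub5R (emb U) = msubR U.
Proof. by apply: val_inj; rewrite val_msub5R msub5_emb val_msubR. Qed.

Lemma msub5RX : msub5R 'X_ord_max = hR.
Proof. by apply: val_inj; rewrite val_msub5R msub5X. Qed.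

Lemma conj_invariant_generators p :
  p \in @conj_invariant K <-> exists P, p = msub5 P.
Proof.
split=> [/normal_form[U [V ->]]|[P ->]].
  by exists (emb U + emb V * 'X_ord_max); rewrite rmorphD rmorphM /= !msub5_emb msub5X.
by rewrite -val_msub5R; apply: inv_valP.
Qed.

Definition relation : {mpoly K[5]} := 'X_ord_max ^+ 2 - emb Phi.

Lemma msub5R_relation : msub5R relation = 0.
Proof.
apply: val_inj; rewrite val_msub5R /relation rmorphB rmorphXn /= msub5X msub5_emb.
by rewrite h_square subrr.
Qed.

(** Euclidean division by the relation, which is monic of degree 2 in the last variable. *)
Lemma reduction P : exists Q U V, P = Q * relation + emb U + emb V * 'X_ord_max.
Proof.
elim/mpoly_alg_ind: P => [c|i|P P' [Q [U [V ->]]] [Q' [U' [V' ->]]]|].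
- by exists 0, c%:MP, 0; rewrite rmorph0 !mul0r add0r addr0 /emb mmapC.
- case: (unliftP ord_max i) => [j ->|->].
    by exists 0, 'X_j, 0; rewrite rmorph0 !mul0r add0r addr0 /emb mmapX mmap1U.
  by exists 0, 0, 1; rewrite rmorph0 rmorph1 mul0r mul1r !add0r.
- by exists (Q + Q'), (U + U'), (V + V'); rewrite !rmorphD; ring.
move=> P P' [Q [U [V ->]]] [Q' [U' [V' ->]]].
(* The square of the last variable is [relation + emb Phi]: the product of the two leading
   coefficients enters the quotient, and V V' Phi the remainder. *)
exists (Q * Q' * relation + Q * (emb U' + emb V' * 'X_ord_max)
        + Q' * (emb U + emb V * 'X_ord_max) + emb V * emb V').
exists (U * U' + V * V' * Phi), (U * V' + V * U').
rewrite !rmorphD !rmorphM /= /relation; ring.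
Qed.

Lemma hypersurface : is_hypersurface (@inv_gr K).
Proof.
have w5_homog i : f5 i \is (w5 i).-homog by rewrite /f5 /w5; case: unlift.
exists 5, w5, relation, (dh + dh)%N, (msub5R : {lrmorphism _ -> _}); split=> [i||d P hP|r|P].
- by rewrite /w5; case: unlift => /=.
- rewrite rpredB //.
    rewrite expr2 -mpolyXD dhomogX /= wdegD wdeg1.
    by rewrite /w5 unlift_none.
  apply: mmap_homog Phi_homog => i.
  by rewrite dhomogX /= wdeg1 /w5 liftK.
- by rewrite /inv_gr unfold_in /= val_msub5R; apply: (mmap_homog w5_homog).
- have [U [V ->]] := normal_formR r; exists (emb U + emb V * 'X_ord_max).
  by rewrite rmorphD rmorphM /= !msub5R_emb msub5RX.
split=> [|[Q ->]]; last by rewrite rmorphM /= msub5R_relation mulr0.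
have [Q [U [V ->]]] := reduction P; rewrite !rmorphD !rmorphM /= msub5R_relation.
rewrite !msub5R_emb msub5RX mulr0 add0r => /uniquenessR[-> ->].
by exists Q; rewrite rmorph0 mul0r !addr0.
Qed.

End Presentation.

Lemma mono_free (k : nat) (K : nzRingType) (T : finType) (g : T -> 'X_{1..k}) (c : T -> K) :
  injective g -> \sum_t c t *: 'X_[g t] = 0 -> forall t, c t = 0.
Proof.
move=> ginj /(congr1 (mcoeff (g _))) E t; have := E t; rewrite mcoeff0 raddf_sum /=.
rewrite (bigD1 t) //= mcoeffZ mcoeffX eqxx mulr1 big1 ?addr0 // => t' ne.
by rewrite mcoeffZ mcoeffX (inj_eq ginj) (negPf ne) mulr0.
Qed.

(** * Counting monomials of given weighted degree *)

Section WeightedMonomials.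
Variables (k : nat) (e : 'I_k -> nat).
Hypothesis e_gt0 : forall i, (0 < e i)%N.

Lemma leq_mnm_wdeg (m : 'X_{1..k}) i : (m i <= wdeg e m)%N.
Proof. by rewrite /wdeg (bigD1 i) //=; have := e_gt0 i; nia. Qed.

Lemma leq_mdeg_wdeg (m : 'X_{1..k}) : (mdeg m <= wdeg e m)%N.
Proof. by rewrite mdegE /wdeg; apply: leq_sum => i _; rewrite leq_pmulr. Qed.

(** With positive weights the degree is at most the weighted degree, so the bound on the degree
    excludes no monomial and makes the type finite. *)
Definition wmon d : finType := {m : 'X_{1..k < d.+1} | wdeg e m == d}.
Definition mon_of d (t : wmon d) : 'X_{1..k} := bmnm (val t).

Lemma mon_of_inj d : injective (@mon_of d).
Proof. by move=> t t' E; do 2!apply: val_inj. Qed.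

Lemma wmonP d (m : 'X_{1..k}) : wdeg e m = d -> exists t : wmon d, mon_of t = m.
Proof.
move=> E; have bm : (mdeg m < d.+1)%N by rewrite ltnS -E leq_mdeg_wdeg.
have wm : wdeg e (BMultinom bm) == d by rewrite /= E.
by exists (exist _ (BMultinom bm) wm).
Qed.

Lemma wdeg_mon_of d (t : wmon d) : wdeg e (mon_of t) = d.
Proof. exact/eqP/(valP t). Qed.

Lemma wmon_span (K : nzRingType) d (P : {mpoly K[k]}) : P \is d.-homog for (wdeg e) ->
  P = \sum_(t : wmon d) P@_(mon_of t) *: 'X_[mon_of t].
Proof.
move=> /dhomogP hP; apply/mpolyP => m; rewrite raddf_sum /=.
have [E|ne] := eqVneq (wdeg e m) d.
  have [t Et] := wmonP E; rewrite (bigD1 t) //= mcoeffZ mcoeffX Et eqxx mulr1.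
  rewrite big1 ?addr0 // => t' ne; rewrite mcoeffZ mcoeffX -Et (inj_eq (@mon_of_inj d)).
  by rewrite (negPf ne) mulr0.
rewrite big1 => [|t _].
  by apply: memN_msupp_eq0; apply: contra ne => /hP/= ->.
rewrite mcoeffZ mcoeffX; case: eqP => [E|]; last by rewrite mulr0.
by rewrite -E wdeg_mon_of eqxx in ne.
Qed.

(** The expansion of the product of the 1/(1 - z^(e_i)), each geometric series being cut after M
    terms; coefficients of degree less than M are not affected. *)
Definition trunc_series (M : nat) : {poly int} := \prod_i \sum_(j < M) 'X^(e i * j).

Lemma trunc_seriesE M : trunc_series M =
  \sum_(f : {ffun 'I_k -> 'I_M}) 'X^(\sum_i f i * e i)%N.
Proof.
rewrite /trunc_series bigA_distr_bigA /=; apply: eq_bigr => f _.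
by rewrite expr_sum; apply: eq_bigr => i _; rewrite mulnC.
Qed.

Lemma coef_trunc_series M d : (d < M)%N -> (trunc_series M)`_d = #|wmon d|%:Z.
Proof.
case: M => // M dM; pose j (t : wmon d) : {ffun 'I_k -> 'I_M.+1} := [ffun i => inord (mon_of t i)].
have jE t i : j t i = mon_of t i :> nat.
  by rewrite ffunE inordK // (leq_ltn_trans (leq_mnm_wdeg _ _)) // wdeg_mon_of.
have j_inj : injective j.
  by move=> t t' E; apply: mon_of_inj; apply/mnmP => i; rewrite -!jE E.
rewrite trunc_seriesE coef_sum -(card_imset _ j_inj) -sum1_card -[RHS]natz natr_sum.
rewrite [RHS]big_mkcond /=; apply: eq_bigr => f _; rewrite coefXn.
suff -> : (f \in [set j t | t : wmon d]) = (d == \sum_i f i * e i)%N by case: eqP.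
apply/imsetP/eqP => [[t _ ->]|E].
  by rewrite -[LHS](wdeg_mon_of t); apply: eq_bigr => i _; rewrite -jE.
have [|t Et] := @wmonP d [multinom (f i : nat) | i < k].
  by rewrite E; apply: eq_bigr => i _; rewrite mnmE.
by exists t => //; apply/ffunP => i; apply: val_inj; rewrite /= jE Et mnmE.
Qed.

Lemma trunc_series_inv M : exists r,
  (\prod_i (1 - 'X^(e i))) * trunc_series M = 1 + 'X^M * r :> {poly int}.
Proof.
rewrite /trunc_series -big_split /=; elim/big_ind: _ => [|x y [r ->] [s ->]|i _].
- by exists 0; rewrite mulr0 addr0.
- by exists (r + s + 'X^M * r * s); ring.
exists (- 'X^(M * (e i).-1)).
under eq_bigr do rewrite exprM.
rewrite -opprB mulNr -subrX1 opprB -exprM mulrN -exprD.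
by congr (1 - 'X^_); have := e_gt0 i; case: (e i) => // a _; rewrite mulnC mulnS.
Qed.
End WeightedMonomials.

Section Hilbert.
Variables (K : finFieldType) (f : 'I_4 -> {mpoly K[4]}) (h : {mpoly K[4]}).
Variables (e : 'I_4 -> nat) (dh : nat).
Local Notation S := {mpoly K[4]}.
Local Notation R := (inv_ring K).
Local Notation msub := (mmap (@mpolyC 4 K) f).
Hypothesis f_inv : forall i, f i \in @conj_invariant K.
Hypothesis h_inv : h \in @conj_invariant K.
Hypothesis f_homog : forall i, f i \is (e i).-homog.
Hypothesis h_homog : h \is dh.-homog.
Hypothesis e_gt0 : forall i, (0 < e i)%N.
Hypothesis generation : forall d p, p \is d.-homog -> p \in @conj_invariant K ->
  exists U V : S, [/\ U \is d.-homog for (wdeg e), V = 0 \/ (dh <= d)%N,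
    V \is (d - dh).-homog for (wdeg e) & p = msub U + msub V * h].
Hypothesis uniqueness : forall U V, msub U + msub V * h = 0 -> U = 0 /\ V = 0.
Local Notation msubR := (mmap (in_alg R) (fR f_inv)).
Local Notation hR := (hR h_inv).

(** The factor ['I_(dh <= n)] is empty or a singleton: multiples of h exist only from degree [dh]
    on. *)
Definition basis_type n : finType :=
  (wmon e n + ('I_(dh <= n)%N * wmon e (n - dh)))%type.

Definition basis n (t : basis_type n) : R :=
  match t with
  | inl t => msubR 'X_[mon_of t]
  | inr t => msubR 'X_[mon_of t.2] * hR
  end.

Lemma sum_basis n (c : basis_type n -> K) : \sum_t c t *: basis t =
  msubR (\sum_t c (inl t) *: 'X_[mon_of t]) + msubR (\sum_t c (inr t) *: 'X_[mon_of t.2]) * hR.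
Proof.
rewrite big_sumType /= !rmorph_sum mulr_suml; congr (_ + _); apply: eq_bigr => t _.
  by rewrite /= mmapZ mulr_algl.
by rewrite /= mmapZ mulr_algl scalerAl.
Qed.

Lemma has_dim_inv_gr n :
  has_dim (@inv_gr K n) (#|wmon e n| + (dh <= n) * #|wmon e (n - dh)|)%N.
Proof.
have -> : (#|wmon e n| + (dh <= n) * #|wmon e (n - dh)|)%N = #|{: basis_type n}|.
  by rewrite card_sum card_prod card_ord.
apply: (has_dim_card (b := @basis n)) => [[t|[i t]]|c|v vn].
- rewrite /inv_gr unfold_in /= val_msubR; apply: (mmap_homog f_homog).
  by rewrite dhomogX /= wdeg_mon_of.
- change (val (msubR 'X_[mon_of t] * hR) \is n.-homog).
  have -> : val (msubR 'X_[mon_of t] * hR) = msub 'X_[mon_of t] * h by rewrite -val_msubR.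
  have dn : (dh <= n)%N by case: i; case: (dh <= n)%N.
  rewrite -{2}(subnK dn) dhomogM //; apply: (mmap_homog f_homog).
  by rewrite dhomogX /= wdeg_mon_of.
- rewrite sum_basis => /(uniquenessR uniqueness)[U0 V0] [t|t].
    exact: (mono_free (@mon_of_inj _ _ _) U0).
  apply: (mono_free _ V0) => -[i t1] [j t2] /= /mon_of_inj->; congr (_, _).
  by apply: val_inj; move: i j; case: (dh <= n)%N => -[[|i] Hi] [[|j] Hj].
have [U [V [hU dV hV E]]] := generation vn (inv_valP v).
have EV : \sum_(t : 'I_(dh <= n)%N * wmon e (n - dh)) V@_(mon_of t.2) *: 'X_[mon_of t.2] = V.
  case: dV => [->|dn]; first by rewrite big1 // => t _; rewrite mcoeff0 scale0r.
  rewrite [RHS](wmon_span e_gt0 hV) dn.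
  by rewrite -(pair_bigA _ (fun i t => V@_(mon_of t) *: 'X_[mon_of t])) big_ord1.
exists (fun t => match t with inl t => U@_(mon_of t) | inr t => V@_(mon_of t.2) end).
rewrite sum_basis EV -wmon_span //; apply: val_inj.
by rewrite val_normal_form; exact: E.
Qed.

Lemma hilbert_series :
  has_hilbert_series (@inv_gr K) (1 + 'X^dh) (\prod_i (1 - 'X^(e i))).
Proof.
have D0 : \prod_i (1 - 'X^(e i)) != 0 :> {poly int}.
  apply/prodf_neq0 => i _; apply/eqP => /(congr1 (fun p : {poly int} => p`_0)).
  by rewrite coefB coef1 coefXn coef0; case: (e i) (e_gt0 i).
split=> //; exists (fun n => (#|wmon e n| + (dh <= n) * #|wmon e (n - dh)|)%N).
split=> [|n]; first exact: has_dim_inv_gr.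
have [r Er] := trunc_series_inv e_gt0 n.+1.
set D := \prod_i _ in Er *; pose A := trunc_series e n.+1.
(* [A] is inverse to [D] modulo 'X^(n.+1), which leaves the coefficient of degree n unchanged. *)
have -> : (1 + 'X^dh : {poly int})`_n = (D * (A * (1 + 'X^dh)))`_n.
  rewrite mulrA Er mulrDl mul1r [RHS]coefD -mulrA coefXnM ltnSn addr0 //.
rewrite coefM; apply: eq_bigr => -[i Hi] _ /=; congr (_ * _).
have lin : (n - i < n.+1)%N by rewrite ltnS leq_subr.
rewrite mulrDr mulr1 coefD coef_trunc_series // coefMXn PoszD; congr (_ + _).
case: ltnP => H; first by rewrite mul0n.
by rewrite mul1n coef_trunc_series // (leq_ltn_trans (leq_subr _ _)).
Qed.
End Hilbert.

Section AInvariant.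
Variables (K : finFieldType) (f : 'I_4 -> {mpoly K[4]}) (h : {mpoly K[4]}).
Variables (e : 'I_4 -> nat) (dh : nat).
Local Notation S := {mpoly K[4]}.
Local Notation R := (inv_ring K).
Local Notation msub := (mmap (@mpolyC 4 K) f).
Hypothesis f_inv : forall i, f i \in @conj_invariant K.
Hypothesis h_inv : h \in @conj_invariant K.
Hypothesis f_homog : forall i, f i \is (e i).-homog.
Hypothesis h_homog : h \is dh.-homog.
Hypothesis e_gt0 : forall i, (0 < e i)%N.
Hypothesis generation : forall d p, p \is d.-homog -> p \in @conj_invariant K ->
  exists U V : S, [/\ U \is d.-homog for (wdeg e), V = 0 \/ (dh <= d)%N,
    V \is (d - dh).-homog for (wdeg e) & p = msub U + msub V * h].
Hypothesis uniqueness : forall U V, msub U + msub V * h = 0 -> U = 0 /\ V = 0.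
Local Notation xR := (fR f_inv).
Local Notation msubR := (mmap (in_alg R) xR).
Local Notation hR := (hR h_inv).

Lemma hsop : is_hsop (@inv_gr K) xR e.
Proof.
split=> [i|P P0|]; first by rewrite /inv_gr unfold_in /=.
  by have [|] := uniquenessR (f_inv := f_inv) (h_inv := h_inv) uniqueness (U := P) (V := 0);
    rewrite ?rmorph0 ?mul0r ?addr0.
exists 2, (fun i => if i == 0 then 1 else hR) => r.
have [U [V ->]] := normal_formR f_inv h_inv generation r.
exists (fun i => if i == 0 then U else V).
by rewrite big_ord_recl big_ord1 /= mulr1.
Qed.

(** In the coefficient of h, the monomial (x_1 .. x_4)^j occurs with coefficient 1 on the left, but
    it is divisible by no x_i^(j + 1), hence absent from all elements of the ideal. *)
Lemma h_notin_powers j :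
  ~ ideal_gen (fun y => exists i, y = xR i ^+ j.+1) ((\prod_i xR i) ^+ j * hR).
Proof.
pose M : 'X_{1..4} := [multinom j | i < 4].
pose Q r := exists U V : S, r = msubR U + msubR V * hR /\ V@_M = 0.
suff H : forall r, ideal_gen (fun y => exists i, y = xR i ^+ j.+1) r -> Q r.
  move=> /H[U [V [E V0]]].
  have [|_ EV] := normal_form_inj uniqueness (U := 0) (V := 'X_[M]) (U' := U) (V' := V)
    (f_inv := f_inv) (h_inv := h_inv).
    rewrite -E rmorph0 add0r; congr (_ * _); rewrite mmapX -prodrXl.
    by apply: eq_bigr => i _; rewrite mnmE.
  by move: V0; rewrite -EV mcoeffX eqxx => /eqP; rewrite oner_eq0.
apply: ideal_gen_ind => [|r r' [U [V [-> V0]]] [U' [V' [-> V0']]]|c _ [i ->]].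
- by exists 0, 0; rewrite !rmorph0 mul0r addr0 mcoeff0.
- exists (U + U'), (V + V'); split; last by rewrite mcoeffD V0 V0' addr0.
  by rewrite !rmorphD mulrDl addrACA.
have [U [V ->]] := normal_formR f_inv h_inv generation c.
exists (U * 'X_i ^+ j.+1), (V * 'X_i ^+ j.+1); split.
  by rewrite !rmorphM !rmorphXn /= mmapX mmap1U mulrDl mulrAC.
rewrite mpolyXn [V]mpolyE mulr_suml raddf_sum big1 // => m _ /=.
rewrite -scalerAl -mpolyXD mcoeffZ mcoeffX; case: eqP => [|_]; last by rewrite mulr0.
by move=> /(congr1 (fun m : 'X_{1..4} => m i)); rewrite mnmDE mulmnE mnm1E eqxx mnmE; lia.
Qed.

Lemma msubR_in_powers t U : (forall m, m \in msupp U -> exists i, t <= m i)%N ->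
  ideal_gen (fun y => exists i, y = xR i ^+ t) (msubR U).
Proof.
move=> HU; rewrite /mmap big_seq; apply: ideal_gen_sum => m /HU[i tm].
rewrite /mmap1 (bigD1 i) //= -(subnK tm) exprD mulrAC mulrA mulrAC mulrC -!mulrA.
rewrite mulrCA !mulrA; apply: ideal_genM; by exists i.
Qed.

(** If all exponents were less than t, the weighted degree would be at most t - 1 times the sum of
    the weights. *)
Lemma large_exponent t m : (t * \sum_i e i < wdeg e m + \sum_i e i)%N -> exists i, (t <= m i)%N.
Proof.
move=> H; apply: NNPP => nH; move: H; apply/negP; rewrite -leqNgt /wdeg -big_split big_distrr /=.
apply: leq_sum => i _; have : ~~ (t <= m i)%N by apply/negP => tm; apply: nH; exists i.
by rewrite -ltnNge -mulSnr leq_mul2r => ->; rewrite orbT.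
Qed.

(** The class of h / (x_1 .. x_4) is nonzero of degree -a. In a class of larger degree with
    denominator (x_1 .. x_4)^t, every monomial of both coefficients of the numerator on 1, h has an
    exponent at least t, so the class vanishes already with j = 0. *)
Lemma a_invariant a : (\sum_i e i = dh + a)%N -> has_a_invariant (@inv_gr K) (- a%:Z).
Proof.
move=> Ea; exists 4, xR, e; split; first exact: hsop.
  exists 1%N, dh, hR; split=> //; first by rewrite Ea; lia.
  exact: h_notin_powers.
move=> n an [t [m [r [rm En /(_ 0%N)]]]]; apply.
have {an En}H : (t * \sum_i e i < m + a)%N.
  by move: an; rewrite En; move: (t * _)%N => s; lia.
rewrite expr0 mul1r addn0; have [U [V [/dhomogP hU dV /dhomogP hV E]]] := generation rm (inv_valP r).
have -> : r = msubR U + hR * msubR V.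
  by apply: val_inj; rewrite mulrC val_normal_form; exact: E.
apply: ideal_genD; last first.
  have [_ _ idM] := ideal_gen_is_ideal (fun y => exists i, y = xR i ^+ t).
  apply: idM; apply: msubR_in_powers => m' m's; case: dV m's => [->|dm m's].
    by rewrite msupp0.
  by apply: large_exponent; rewrite (hV _ m's) Ea; lia.
apply: msubR_in_powers => m' m's; apply: large_exponent.
by rewrite (hU _ m's) Ea; lia.
Qed.
End AInvariant.

Lemma irreducible_no_root (K : fieldType) (delta : K) :
  irreducible_poly ('X^2 + delta%:P) -> forall x, x ^+ 2 + delta != 0.
Proof.
move=> [_ irr] x; apply/negP => /eqP x0.
have sz : size ('X^2 + delta%:P) = 3.
  by rewrite size_polyDl size_polyXn // size_polyC; case: (_ != 0).
have /irr : size ('X - x%:P) != 1 by rewrite size_XsubC.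
rewrite dvdp_XsubCl /root !hornerE x0 => /(_ (eqxx _))/eqp_size.
by rewrite size_XsubC sz.
Qed.

(** * The assertions for an arbitrary square root g of f4 *)

Section Main.
Variables (K : finFieldType) (l n : nat) (delta : K).
Hypothesis charl : l \in [pchar K].
Hypothesis cardK : #|K| = (l ^ n)%N.
Hypothesis n_gt0 : (0 < n)%N.
Hypothesis two_neq0 : (2%:R : K) != 0.
Hypothesis irr : irreducible_poly ('X^2 + delta%:P).
Local Notation S := {mpoly K[4]}.
Local Notation q := #|K|.
Local Notation m := #|@hsys K|.

Lemma bin2_card : 'C(q, 2) = (q * m)%N.
Proof.
by rewrite bin2 (card_half two_neq0) /= -doubleMr doubleK.
Qed.

Lemma bin2_cardS : 'C(q.+1, 2) = (q + q * m)%N.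
Proof. by rewrite binS bin1 bin2_card addnC. Qed.

Section Root.
Variable g : S.
Hypothesis g_sqrt : g ^+ 2 = f4 delta.
Local Notation dg := (q * m)%N.
Local Notation dh := (q + q * m)%N.
Local Notation gens := (generators g).
Local Notation degs := (gen_degs K dg).
Local Notation msub := (mmap (@mpolyC 4 K) gens).

Let noroot := irreducible_no_root irr.

Lemma generators_inv i : gens i \in @conj_invariant K.
Proof. exact: (gens_inv charl cardK two_neq0 noroot (f4_sqrtE two_neq0 g_sqrt)). Qed.

Lemma sqrt_homog : g \is dg.-homog.
Proof.
have [c _ ->] := f4_sqrtE two_neq0 g_sqrt.
by rewrite cst_mul_homog // g0_homog.
Qed.

Lemma generators_homog i : gens i \is (degs i).-homog.
Proof. exact: gens_homog sqrt_homog i. Qed.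

Lemma gen_degs_gt0 i : (0 < degs i)%N.
Proof.
rewrite /gen_degs; elim/ord4_ind: i; rewrite (tnth_nth 0%N) /= inordK //=.
exact: degg0_gt0.
Qed.

Let jinv : jacg g \in @conj_invariant K := jacg_inv charl cardK two_neq0 noroot g_sqrt.
Let jhomog : jacg g \is dh.-homog := jacg_homog charl cardK n_gt0 two_neq0 g_sqrt.

Lemma jacobian_generation d p : p \is d.-homog -> p \in @conj_invariant K ->
  exists U V : S, [/\ U \is d.-homog for (wdeg degs), V = 0 \/ (dh <= d)%N,
    V \is (d - dh).-homog for (wdeg degs) & p = msub U + msub V * jacg g].
Proof.
have [L [iota [w [w2 Lgen cardL]]]] := quadratic_extension irr.
exact: (invariant_generation charl cardK n_gt0 two_neq0 noroot w2 Lgen cardL g_sqrt).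
Qed.

Lemma jacobian_uniqueness U V : msub U + msub V * jacg g = 0 -> U = 0 /\ V = 0.
Proof.
have [L [iota [w [w2 Lgen cardL]]]] := quadratic_extension irr.
exact: (generation_unique charl cardK n_gt0 two_neq0 noroot w2 Lgen cardL g_sqrt).
Qed.

Lemma invariants_generated r : r \in @conj_invariant K <->
  in_subalg_gen [tuple inv_trace K; inv_det K; inv_P1det K; g; jacg g] r.
Proof.
have E P : P \mPo [tuple inv_trace K; inv_det K; inv_P1det K; g; jacg g] =
    mmap (@mpolyC 4 K) (f5 gens (jacg g)) P.
  apply: eq_mmap => i; rewrite /f5 (tnth_nth 0).
  case: unliftP => [j ->|-> //] /=; rewrite /generators (tnth_nth 0) /= /bump leqNgt ltn_ord add0n.
  by move: j; elim/ord4_ind; rewrite inordK.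
have H := conj_invariant_generators generators_inv jinv jacobian_generation r.
by split=> [/H.1|] [P EP]; [|apply: (H.2)]; exists P; rewrite EP E.
Qed.

Lemma inv_ring_hypersurface : is_hypersurface (@inv_gr K).
Proof.
have [L [iota [w [w2 Lgen cardL]]]] := quadratic_extension irr.
have [Phi hPhi EPhi] :=
  jacg_square charl cardK n_gt0 two_neq0 noroot w2 Lgen cardL g_sqrt.
apply: (hypersurface generators_inv jinv generators_homog jhomog gen_degs_gt0 _
  jacobian_generation jacobian_uniqueness hPhi EPhi).
by rewrite addn_gt0 (card_half two_neq0).
Qed.

Lemma inv_ring_hilbert : has_hilbert_series (@inv_gr K) (1 + 'X^('C(q.+1, 2)))
  ((1 - 'X) * (1 - 'X^2) * (1 - 'X^(q.+1)) * (1 - 'X^('C(q, 2)))).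
Proof.
rewrite bin2_card bin2_cardS.
have := hilbert_series generators_inv jinv generators_homog jhomog gen_degs_gt0
  jacobian_generation jacobian_uniqueness.
rewrite [\prod_i _](_ : _ = (1 - 'X) * (1 - 'X^2) * (1 - 'X^(q.+1)) * (1 - 'X^(q * m))) //.
by rewrite !big_ord_recr big_ord0 /= mul1r.
Qed.

Lemma inv_ring_a_invariant : has_a_invariant (@inv_gr K) (- 4%:Z).
Proof.
apply: (a_invariant generators_inv jinv generators_homog jhomog gen_degs_gt0
  jacobian_generation jacobian_uniqueness).
(* The degrees satisfy 1 + 2 + (q + 1) + q m = (q + q m) + 4. *)
rewrite !big_ord_recr big_ord0 /= /gen_degs !(tnth_nth 0%N) /=; lia.
Qed.

Lemma inv_ring_not_F_regular : ~ F_regular l (inv_ring K).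
Proof.
have dg0 : (q * m)%:R = 0 :> K.
  by rewrite natrM (card_eq0 charl cardK n_gt0 idfun) mul0r.
have [s1 [s2 [s3 E]]] := jac_ideal charl cardK n_gt0 sqrt_homog dg0.
(* The ideal taken in S^G is generated by all four invariants, g entering with coefficient 0, since
   h is known to lie outside this larger ideal. *)
apply: (not_F_regular charl two_neq0 (X := fun y => exists i, y = fR generators_inv i)
  (h := hR jinv) (s := tnth [tuple s1; s2; s3; 0]) (x := fR generators_inv)).
- by move=> i; exists i.
- rewrite [LHS]E !big_ord_recr big_ord0 /= add0r.
  by rewrite /generators !(tnth_nth 0) /= mul0r addr0.
- exact: (h_notin_ideal jacobian_generation jacobian_uniqueness).
Qed.

End Root.
End Main.

Theorem theorem8p1 (p n : nat) (p_prime : prime p) (p_odd : odd p)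
    (n_gt0 : (0 < n)%N) (K : finFieldType) (cardK : #|K| = (p ^ n)%N)
    (delta : K) (irr : irreducible_poly ('X^2 + delta%:P)) :
  let q := (p ^ n)%N in
  [/\ exists g : {mpoly K[4]}, g ^+ 2 = f4 delta,
      (forall g : {mpoly K[4]}, g ^+ 2 = f4 delta ->
         let h := jacobian [tuple inv_trace K; inv_det K; inv_P1det K; g] in
         forall r : {mpoly K[4]}, r \in @conj_invariant K <->
           in_subalg_gen [tuple inv_trace K; inv_det K; inv_P1det K; g; h] r),
      is_hypersurface (@inv_gr K),
      has_hilbert_series (@inv_gr K)
        (1 + 'X^('C(q.+1, 2)))
        ((1 - 'X) * (1 - 'X^2) * (1 - 'X^(q.+1)) * (1 - 'X^('C(q, 2))))
    & [/\ ~ F_regular p (inv_ring K), is_UFD (inv_ring K)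
        & has_a_invariant (@inv_gr K) (- 4%:Z)]].
Proof.
have charl := card_finPcharP cardK p_prime.
have two_neq0 : 2%:R != 0 :> K.
  rewrite -(dvdn_pcharf charl); apply: contraL p_odd.
  by rewrite dvdn_prime2 // => /eqP->.
rewrite /= -cardK; have [g Eg] := f4_sqrt delta two_neq0; split.
- by exists g.
- by move=> g' Eg'; apply: (invariants_generated charl cardK n_gt0 two_neq0 irr Eg').
- exact: (inv_ring_hypersurface charl cardK n_gt0 two_neq0 irr Eg).
- exact: (inv_ring_hilbert charl cardK n_gt0 two_neq0 irr Eg).
split.
- exact: (inv_ring_not_F_regular charl cardK n_gt0 two_neq0 irr Eg).
- exact: (inv_ring_UFD charl).
- exact: (inv_ring_a_invariant charl cardK n_gt0 two_neq0 irr Eg).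
Qed.
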